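(* Fix $\kappa>0$ and $\theta\in(0,1)$. There exists $s_\theta<0$ such that, for every $s\le s_\theta$, one can choose $\varepsilon=\varepsilon(s,\theta)>0$ for which $\varepsilon\ge C_Xe^{2s\gamma}$ and $$\|\Phi_s(U)-\Phi_s(V)\|_{G_s}\le\theta\,\|U-V\|_{G_s}\qquad\text{for all }U,V\in\mathbb A.$$ Thus $\Phi_s$ is a contraction on $\mathbb A$ with respect to the metric induced by $\|\cdot\|_{G_s}$.
   Context: All functions are real-valued. Let $c,T>0$, $Q=(0,\infty)\times(0,T)$, $\square v=v_{tt}-c^2v_{xx}$, $\widetilde\square\psi=|\psi_t|^2-c^2|\psi_x|^2$. Fix $0<X<cT$ and $-\frac13<\lambda<0$. Put $\psi(x,t)=-\log(1+ct)-\log(1+x+ct)$, $\varphi=e^{\lambda\psi}=(1+ct)^{-\lambda}(1+x+ct)^{-\lambda}$. Weights and forms. For $s<0$: $\omega_s(x,t)=\exp[s(\varphi(x,t)-1)]$, $\omega_{s,0}(x)=\omega_s(x,0)$, $\rho_s(x)=\omega_{s,0}(x)^2\varphi(x,0)^3$, and $$E_s[v]=\int_Q\omega_s^2\{(-s)^3\varphi^3|v|^2+(-s)(|v_t|^2+|v_x|^2)\}\,dx\,dt.$$ $\mathcal X_s^m$ is the Hilbert space of distributions $v$ on $Q$ with $\|v\|_{\mathcal X_s^m}^2=\sum_{j+k\le m}\int_Q\rho_s(x)|\partial_x^j\partial_t^kv|^2\,dx\,dt<\infty$; boundary and initial conditions are in the trace sense. Let $$a_0(x)=\lambda^2\varphi(x,0)\varphi_t(x,0)(\widetilde\square\psi)(x,0),\qquad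 r_0(x)=-\tfrac{\lambda^2}{2}\,\partial_t(\varphi\,\widetilde\square\psi)(x,0)$$ (both positive), and for a trace $p$ on $(0,\infty)$ $$I_{s,X}[p]=\int_0^X\omega_{s,0}^2a_0|p|^2\,dx,\qquad \mathcal G_s[p]=(-s)\int_0^\infty\omega_{s,0}^2\left[c^2\varphi_t(x,0)|p_x|^2+\bigl(r_0(x)+2s^2\varphi(x,0)a_0(x)\bigr)|p|^2\right]dx.$$ Cutoff. Choose $X/c<T_-<T_+<T$ and $\chi\in C^\infty([0,T])$ with $0\le\chi\le1$, $\chi=1$ on $[0,T_-]$, $\chi=0$ on $[T_+,T]$. Put $\gamma=\inf_{x\ge0,\,t\in\operatorname{supp}\chi'}(\varphi(x,t)-\varphi(x,0))>0$. The constant $C_X$. Fix $m\ge4$. $C_X>0$ denotes a constant (independent of $s$ and $z$) such that for all $-s$ sufficiently large and all $z\in\mathcal X_s^m$ with $z(0,t)=z_x(0,t)=0$ and $z_t(x,0)=0$, $$E_s[\chi z]+s^2I_{s,X}[z(\cdot,0)]\le C_X\left(\|\omega_s\chi\square z\|_{L^2(Q)}^2+\mathcal G_s[z(\cdot,0)]+e^{2s\gamma}\|z\|_{\mathcal X_s^1}^2\right);$$ such a constant exists. Semilinear problem. The model is $\square u+\mathcal N(x,t,u,u_t,u_x)=f$ in $Q$, $u(0,t)=h(t)$, $u_x(0,t)=g(t)$ for $0<t<T$, $u_t(x,0)=\varphi_1(x)$ for $x>0$. $\mathcal N$ is globally Lipschitz: there are $K_0,K_1,K_2\ge0$ with $|\mathcal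 N(x,t,a,b,d)-\mathcal N(x,t,\tilde a,\tilde b,\tilde d)|\le K_0|a-\tilde a|+K_1|b-\tilde b|+K_2|d-\tilde d|$ (and $\mathcal N(\cdot,\cdot,U,U_t,U_x)$ is measurable for the $U$ considered). Standing assumptions, imposed for each $s$ under consideration: $\omega_s\chi f\in L^2(Q)$, $\omega_s\chi\mathcal N(\cdot,\cdot,0,0,0)\in L^2(Q)$, and there exists an exact solution $u^\dagger\in\mathcal X_s^m$ of the model with the prescribed traces $h,g,\varphi_1$. Set $$\mathbb A=\{v\in\mathcal X_s^m:\ v(0,t)=h(t),\ v_x(0,t)=g(t),\ v_t(x,0)=\varphi_1(x)\}.$$ Graph norm and frozen map. For $\varepsilon,\kappa>0$, $$\|z\|_{G_s}^2=E_s[\chi z]+s^2I_{s,X}[z(\cdot,0)]+\varepsilon\|z\|_{\mathcal X_s^m}^2+\kappa\,\mathcal G_s[z(\cdot,0)].$$ For $U\in\mathbb A$, $\Phi_s(U)$ is the unique minimizer over $v\in\mathbb A$ of $$J_s^U(v)=\|\omega_s\chi(\square v+\mathcal N(x,t,U,U_t,U_x)-f)\|_{L^2(Q)}^2+\varepsilon\|v\|_{\mathcal X_s^m}^2+\kappa\,\mathcal G_s[v(\cdot,0)].$$ *)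

(* Defs.v *)
From HB Require Import structures.
From mathcomp Require Import all_boot all_order all_algebra.
From mathcomp Require Import all_classical all_reals all_analysis.

Set Implicit Arguments.
Unset Strict Implicit.
Unset Printing Implicit Defensive.

Import Order.TTheory GRing.Theory Num.Theory numFieldNormedType.Exports.
Local Open Scope classical_set_scope.
Local Open Scope ring_scope.

(* Points of the plane are pairs p = (x, t).  Functions on Q = (0,oo) x (0,T)
   are represented by functions on R * R whose values outside Q are
   irrelevant; two functions that agree a.e. on Q represent the same class. *)

Section Calculus.
Context {R : realType}.

(* R * R with its Borel sigma-algebra *)
Definition plane := (measurableTypeR R * measurableTypeR R)%type.

Definition mu2 : {measure set plane -> \bar R} :=
  (@lebesgue_measure R \x @lebesgue_measure R)%E.

Definition dx (f : R * R -> R) : R * R -> R :=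
  fun p => derive1 (fun x => f (x, p.2)) p.1.

Definition dt (f : R * R -> R) : R * R -> R :=
  fun p => derive1 (fun t => f (p.1, t)) p.2.

Fixpoint Ck (n : nat) (f : R * R -> R) : Prop :=
  continuous f /\
  if n is n'.+1 then
    [/\ forall p, derivable (fun x => f (x, p.2)) p.1 1,
        forall p, derivable (fun t => f (p.1, t)) p.2 1,
        Ck n' (dx f) & Ck n' (dt f)]
  else True.

(* C_c^oo(O), extended by zero to the plane *)
Definition test_fun (O : set (R * R)) (eta : R * R -> R) : Prop :=
  (forall n, Ck n eta) /\
  exists K : set (R * R), [/\ compact K, K `<=` O & forall p, ~ K p -> eta p = 0].

Definition smooth1 (f : R -> R) : Prop := forall n x, derivable (derive1n n f) x 1.

Definition test_fun1 (O : set R) (eta : R -> R) : Prop :=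
  smooth1 eta /\
  exists K : set R, [/\ compact K, K `<=` O & forall x, ~ K x -> eta x = 0].

(* Integrability on D near every compact subset of O.  For D = O this is
   L^1_loc(O); when O also contains a part of the boundary of D, it is local
   integrability up to that part of the boundary. *)
Definition loc_int (D O : set (R * R)) (f : R * R -> R) : Prop :=
  measurable_fun (D : set plane) f /\
  forall K, compact K -> K `<=` O -> mu2.-integrable (D `&` K) (EFin \o f).

Definition is_weak_deriv (Q : set (R * R)) (j k : nat) (v w : R * R -> R) : Prop :=
  [/\ loc_int Q Q v, loc_int Q Q w &
      forall eta, test_fun Q eta ->
        \int[mu2]_(p in Q) (v p * iter j dx (iter k dt eta) p) =
        (-1) ^+ (j + k) * \int[mu2]_(p in Q) (w p * eta p)].

Definition has_weak_deriv (Q : set (R * R)) (j k : nat) (v : R * R -> R) : Prop :=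
  exists w, is_weak_deriv Q j k v w.

(* the weak derivative d_x^j d_t^k v on Q; 0 if there is none *)
Definition wD (Q : set (R * R)) (j k : nat) (v : R * R -> R) : R * R -> R :=
  xget (fun=> 0) [set w | is_weak_deriv Q j k v w].

Definition half_line : set R := `]0, +oo[.

Definition is_weak_deriv1 (p q : R -> R) : Prop :=
  [/\ locally_integrable half_line p, locally_integrable half_line q &
      forall eta, test_fun1 half_line eta ->
        \int[lebesgue_measure]_(x in half_line) (p x * derive1 eta x) =
        - \int[lebesgue_measure]_(x in half_line) (q x * eta x)].

(* the weak derivative of p on (0,oo); 0 if there is none *)
Definition wD1 (p : R -> R) : R -> R := xget (fun=> 0) [set q | is_weak_deriv1 p q].

End Calculus.

Section Problem.
Context {R : realType} (c T X lam : R).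

Definition Qset : set (R * R) := [set p | 0 < p.1 /\ 0 < p.2 < T].

(* Q together with its bottom side {t = 0}, fattened to an open set *)
Definition Obot : set (R * R) := [set p | 0 < p.1 /\ p.2 < T].

(* Q together with its lateral side {x = 0}, fattened to an open set *)
Definition Olat : set (R * R) := [set p | 0 < p.2 < T].

Definition time_int : set R := `]0, T[.

(* Traces of Sobolev functions, defined through Green's formula against test
   functions that need not vanish on the side of Q under consideration. *)
Definition is_trace_t0 (v : R * R -> R) (p : R -> R) : Prop :=
  [/\ locally_integrable half_line p, loc_int Qset Obot v &
      exists w, [/\ is_weak_deriv Qset 0 1 v w, loc_int Qset Obot w &
        forall eta, test_fun Obot eta ->
          \int[mu2]_(q in Qset) (w q * eta q + v q * dt eta q) =
          - \int[lebesgue_measure]_(x in half_line) (p x * eta (x, 0))]].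

Definition is_trace_x0 (v : R * R -> R) (h : R -> R) : Prop :=
  [/\ locally_integrable time_int h, loc_int Qset Olat v &
      exists w, [/\ is_weak_deriv Qset 1 0 v w, loc_int Qset Olat w &
        forall eta, test_fun Olat eta ->
          \int[mu2]_(q in Qset) (w q * eta q + v q * dx eta q) =
          - \int[lebesgue_measure]_(t in time_int) (h t * eta (0, t))]].

(* the trace v(.,0); 0 if there is none *)
Definition trace_t0 (v : R * R -> R) : R -> R :=
  xget (fun=> 0) [set p | is_trace_t0 v p].

Definition v_t (v : R * R -> R) := wD Qset 0 1 v.
Definition v_x (v : R * R -> R) := wD Qset 1 0 v.

Definition box (v : R * R -> R) : R * R -> R :=
  fun p => wD Qset 0 2 v p - c ^+ 2 * wD Qset 2 0 v p.

Definition sqnorm_L2 (g : R * R -> R) : \bar R :=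
  (\int[mu2]_(p in Qset) (g p ^+ 2)%:E)%E.

Definition in_L2 (g : R * R -> R) : Prop :=
  measurable_fun (Qset : set (plane (R := R))) g /\ (sqnorm_L2 g < +oo)%E.

Definition psi (p : R * R) : R := - ln (1 + c * p.2) - ln (1 + p.1 + c * p.2).

Definition phi (p : R * R) : R := expR (lam * psi p).

Definition box_psi (p : R * R) : R := dt psi p ^+ 2 - c ^+ 2 * dx psi p ^+ 2.

Definition omega (s : R) (p : R * R) : R := expR (s * (phi p - 1)).

Definition omega0 (s x : R) : R := omega s (x, 0).

Definition rho (s x : R) : R := omega0 s x ^+ 2 * phi (x, 0) ^+ 3.

Definition Efun (s : R) (v : R * R -> R) : \bar R :=
  (\int[mu2]_(p in Qset)
     (omega s p ^+ 2 *
       ((- s) ^+ 3 * phi p ^+ 3 * v p ^+ 2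
        + (- s) * (v_t v p ^+ 2 + v_x v p ^+ 2)))%:E)%E.

Definition sqnorm_X (s : R) (m : nat) (v : R * R -> R) : \bar R :=
  (\sum_(j < m.+1) \sum_(k < m.+1 | (j + k <= m)%N)
     \int[mu2]_(p in Qset) (rho s p.1 * wD Qset j k v p ^+ 2)%:E)%E.

Definition in_X (s : R) (m : nat) (v : R * R -> R) : Prop :=
  (forall j k, (j + k <= m)%N -> has_weak_deriv Qset j k v) /\
  (sqnorm_X s m v < +oo)%E.

Definition a0 (x : R) : R :=
  lam ^+ 2 * phi (x, 0) * dt phi (x, 0) * box_psi (x, 0).

Definition r0 (x : R) : R :=
  - (lam ^+ 2 / 2) * dt (fun p => phi p * box_psi p) (x, 0).

Definition obs_int : set R := `]0, X[.

Definition Ifun (s : R) (p : R -> R) : \bar R :=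
  (\int[lebesgue_measure]_(x in obs_int) (omega0 s x ^+ 2 * a0 x * p x ^+ 2)%:E)%E.

Definition Gfun (s : R) (p : R -> R) : \bar R :=
  ((- s)%:E * \int[lebesgue_measure]_(x in half_line)
     (omega0 s x ^+ 2 *
       (c ^+ 2 * dt phi (x, 0) * wD1 p x ^+ 2
        + (r0 x + 2 * s ^+ 2 * phi (x, 0) * a0 x) * p x ^+ 2))%:E)%E.

(* A function in C^oo([0,T]) that is 1 near 0 and 0 near T extends by
   constants to a smooth function on R, so chi is taken smooth on R. *)
Definition is_cutoff (Tm Tp : R) (chi : R -> R) : Prop :=
  [/\ smooth1 chi,
      forall t, 0 <= t <= T -> 0 <= chi t <= 1,
      forall t, 0 <= t <= Tm -> chi t = 1 &
      forall t, Tp <= t <= T -> chi t = 0].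

Context (chi : R -> R).

Definition supp_dchi : set R :=
  closure [set t | 0 <= t <= T /\ derive1 chi t != 0].

Definition gamma : R :=
  inf [set y | exists x t, [/\ 0 <= x, supp_dchi t & y = phi (x, t) - phi (x, 0)]].

Definition cut (v : R * R -> R) : R * R -> R := fun p => chi p.2 * v p.

(* in_X, with v(0,t) = h, v_x(0,t) = g and v_t(x,0) = phi1 *)
Definition adm (s : R) (m : nat) (h g phi1 : R -> R) (v : R * R -> R) : Prop :=
  [/\ in_X s m v, is_trace_x0 v h, is_trace_x0 (v_x v) g & is_trace_t0 (v_t v) phi1].

Definition is_carleman_const (m : nat) (CX : R) : Prop :=
  0 < CX /\
  exists2 s0 : R, s0 < 0 & forall s, s <= s0 ->
    forall z, adm s m (fun=> 0) (fun=> 0) (fun=> 0) z ->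
    (Efun s (cut z) + (s ^+ 2)%:E * Ifun s (trace_t0 z) <=
     CX%:E * (sqnorm_L2 (fun p => (omega s p * chi p.2 * box z p)%R)
              + Gfun s (trace_t0 z)
              + (expR (2 * s * gamma))%:E * sqnorm_X s 1 z))%E.

Definition Gnorm (m : nat) (s eps kappa : R) (z : R * R -> R) : \bar R :=
  sqrte (Efun s (cut z) + (s ^+ 2)%:E * Ifun s (trace_t0 z)
         + eps%:E * sqnorm_X s m z + kappa%:E * Gfun s (trace_t0 z))%E.

Context (N : R -> R -> R -> R -> R -> R) (f : R * R -> R) (h g phi1 : R -> R).

Definition lipschitzN (K0 K1 K2 : R) : Prop :=
  forall x t, Qset (x, t) -> forall a b d a' b' d',
    `|N x t a b d - N x t a' b' d'| <=
    K0 * `|a - a'| + K1 * `|b - b'| + K2 * `|d - d'|.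

Definition NU (U : R * R -> R) : R * R -> R :=
  fun p => N p.1 p.2 (U p) (v_t U p) (v_x U p).

Definition standing (m : nat) (s : R) : Prop :=
  [/\ in_L2 (fun p => omega s p * chi p.2 * f p),
      in_L2 (fun p => omega s p * chi p.2 * N p.1 p.2 0 0 0),
      forall U, adm s m h g phi1 U -> measurable_fun (Qset : set (plane (R := R))) (NU U) &
      exists2 u, adm s m h g phi1 u &
        {ae mu2, forall p, Qset p -> box u p + NU u p = f p}].

Definition Jfun (m : nat) (s eps kappa : R) (U v : R * R -> R) : \bar R :=
  (sqnorm_L2 (fun p => (omega s p * chi p.2 * (box v p + NU U p - f p))%R)
   + eps%:E * sqnorm_X s m v + kappa%:E * Gfun s (trace_t0 v))%E.

Definition is_minimizer (m : nat) (s eps kappa : R) (U u : R * R -> R) : Prop :=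
  adm s m h g phi1 u /\
  forall v, adm s m h g phi1 v ->
    (Jfun m s eps kappa U u <= Jfun m s eps kappa U v)%E.

(* Phi sends each admissible U to the unique (up to null sets) minimizer of J^U *)
Definition is_frozen_map (m : nat) (s eps kappa : R)
    (Phi : (R * R -> R) -> (R * R -> R)) : Prop :=
  forall U, adm s m h g phi1 U ->
    is_minimizer m s eps kappa U (Phi U) /\
    forall v, is_minimizer m s eps kappa U v ->
      {ae mu2, forall p, Qset p -> v p = Phi U p}.

End Problem.

(* Main.v *)
Require Import Defs.
From HB Require Import structures.
From mathcomp Require Import all_boot all_order all_algebra.
From mathcomp Require Import all_classical all_reals all_analysis.
From mathcomp Require Import measurable_realfun.
From mathcomp Require Import ring lra.

Set Implicit Arguments.
Unset Strict Implicit.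
Unset Printing Implicit Defensive.

Import Order.TTheory GRing.Theory Num.Theory numFieldNormedType.Exports.
Local Open Scope classical_set_scope.
Local Open Scope ring_scope.

(** Why the frozen map contracts.  The functional [Jfun] is a sum of squared
    norms, and two frozen problems, for U and V, differ only in the nonlinear
    term of their data norm.  Let u and v be the minimizers, d = u - v and
    w = U - V, and let n be [omega * chi] times the difference of the two
    nonlinear terms.  The midpoint (u + v) / 2 has the prescribed traces, so it
    competes in both problems.  Adding the two minimality inequalities, the
    parallelogram identities for the regularizing terms and the pointwise
    midpoint inequality [midpoint_dint] for the data terms leaves
      |omega chi box d|^2 / 4 + (eps |d|_X^2 + kappa G[d]) / 2 <= |n|^2.
    The prescribed traces of d vanish, so the Carleman estimate applies to d.  Its last
    term is absorbed as soon as [eps] is at least C_X e^(2 s gamma), and the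
    graph norm satisfies |d|_G^2 <= C' |n|^2 with C' depending on C_X and kappa
    only.

    On the other side, [nonlinear_diff_le] bounds |n|^2 by w.  Since
    chi w_t = (chi w)_t - chi' w, the Lipschitz condition leaves two kinds of
    terms.  The energy of chi w controls the first kind with the factor
    1 / (- s).  The other one lives where chi' does not vanish, and there the
    squared weight is smaller than on the bottom side by the factor
    e^(2 s gamma) ([omega_supp_le]).  Taking eps = M e^(2 s gamma) with M large,
    and then - s large, makes both terms small against the graph norm of w;
    [contraction_real] is this computation.

    Everything else makes these manipulations legitimate: the quantities
    involved have to be finite, and weak derivatives and traces have to be
    linear up to null sets.  Weak derivatives and traces are unique by the
    fundamental lemma ([fundamental_lemma_Q], [fundamental_lemma_half_line]),
    whose bump functions are built from the given cutoff ([step_exists]).  The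
    trace of a function v of the state space exists because
    [- (zeta v_t + zeta' v)], integrated over (0, T) for a cutoff zeta with
    zeta = 1 near t = 0 and zeta = 0 near t = T, is the value of v on the bottom
    side ([bottom_avg_trace]).  This average inherits the weighted L^2 bound of v
    and v_t, as the weight depends on x alone ([bottom_avg_L2]), and its
    derivative is the corresponding average of v_x and v_xt
    ([bottom_avg_wd1]).  Finally the coefficients of the forms on the bottom side
    are nonnegative and dominated by that weight ([bottom_weights_bound]). *)

(** * Smooth functions of one variable *)

Section Smooth1.
Context {R : realType}.
Implicit Types f g : R -> R.

Lemma derivable_continuous1 f x : derivable f x 1 -> {for x, continuous f}.
Proof. by move=> /derivable1_diffP /differentiable_continuous. Qed.

Lemma derivable_addf f g x : derivable f x 1 -> derivable g x 1 ->
  derivable (fun y => f y + g y) x 1.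
Proof. by move=> df dg; have := derivableD df dg; rewrite /GRing.add/=. Qed.

Lemma derive1_addf f g x : derivable f x 1 -> derivable g x 1 ->
  derive1 (fun y => f y + g y) x = derive1 f x + derive1 g x.
Proof. by move=> df dg; rewrite !derive1E; exact: (deriveD df dg). Qed.

Lemma derivable_mulf f g x : derivable f x 1 -> derivable g x 1 ->
  derivable (fun y => f y * g y) x 1.
Proof. by move=> df dg; exact: (derivableM df dg). Qed.

Lemma derive1_mulf f g x : derivable f x 1 -> derivable g x 1 ->
  derive1 (fun y => f y * g y) x = derive1 f x * g x + f x * derive1 g x.
Proof.
move=> df dg; rewrite !derive1E; have := deriveM df dg.
by rewrite /GRing.mul/= => ->; rewrite /GRing.scale/= addrC [g x * _]mulrC.
Qed.

Lemma derive1_constf (k : R) x : derive1 (fun=> k) x = 0.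
Proof. exact: derive1_cst. Qed.

(** Finite orders of differentiability, so that closure under products can be
    proved by induction on the order. *)
Definition Cn n f := forall k x, (k < n)%N -> derivable (derive1n k f) x 1.

Lemma Cn0 f : Cn 0 f.
Proof. by move=> k x; rewrite ltn0. Qed.

Lemma CnS n f :
  Cn n.+1 f <-> (forall x, derivable f x 1) /\ Cn n (derive1 f).
Proof.
split=> [h|[h0 h] [|k] x kn //]; last by rewrite derive1Sn; exact: h.
by split=> [x|k x kn]; [exact: (h 0%N)|rewrite -derive1Sn; exact: h].
Qed.

Lemma smooth1Cn f : smooth1 f <-> forall n, Cn n f.
Proof. by split=> [h n k x _|h n x]; [exact: h|exact: (h n.+1)]. Qed.

Lemma CnW n f : Cn n.+1 f -> Cn n f.
Proof. by move=> h k x kn; apply: h; exact: ltnW. Qed.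

Lemma CnD n f g : Cn n f -> Cn n g -> Cn n (fun x => f x + g x).
Proof.
elim: n f g => [f g _ _|n IH f g]; first exact: Cn0.
move=> /CnS[f0 fn] /CnS[g0 gn]; apply/CnS; split.
  by move=> x; exact: derivable_addf.
rewrite (_ : derive1 _ = fun x => derive1 f x + derive1 g x); first exact: IH.
by apply/funext => x; exact: derive1_addf.
Qed.

Lemma CnM n f g : Cn n f -> Cn n g -> Cn n (fun x => f x * g x).
Proof.
elim: n f g => [f g _ _|n IH f g]; first exact: Cn0.
move=> Cf Cg; apply/CnS.
have [[f0 fn] [g0 gn]] := ((CnS n f).1 Cf, (CnS n g).1 Cg); split.
  by move=> x; exact: derivable_mulf.
rewrite (_ : derive1 _ = fun x => derive1 f x * g x + f x * derive1 g x).
  by apply: CnD; apply: IH; [exact: fn|exact: CnW|exact: CnW|exact: gn].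
by apply/funext => x; exact: derive1_mulf.
Qed.

Lemma derivable_cstE (k x : R) : derivable (fun _ : R => k) x 1.
Proof. exact: derivable_cst. Qed.

Arguments derivable_cstE : clear implicits.

Lemma Cn_cst n (k : R) : Cn n (fun=> k).
Proof.
elim: n k => [k|n IH k]; first exact: Cn0.
apply/CnS; split; first by move=> x; exact: derivable_cstE.
by rewrite (_ : derive1 _ = fun=> 0) //; apply/funext => x; exact: derive1_constf.
Qed.

Lemma derivable_affine (a b x : R) : derivable (fun y => a * y + b) x 1.
Proof.
by apply: derivable_addf; [apply: derivable_mulf; [exact: derivable_cstE|exact: derivable_id]|exact: derivable_cstE].
Qed.

Lemma derive1_affine (a b x : R) : derive1 (fun y => a * y + b) x = a.
Proof.
rewrite derive1_addf; first last.
- exact: derivable_cstE.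
- by apply: derivable_mulf; [exact: derivable_cstE|exact: derivable_id].
rewrite derive1_mulf; [|exact: derivable_cstE|exact: derivable_id].
by rewrite !derive1_constf derive1_id mul0r add0r addr0 mulr1.
Qed.

Arguments derivable_affine : clear implicits.

Lemma Cn_affine n f (a b : R) : Cn n f -> Cn n (fun x => f (a * x + b)).
Proof.
elim: n f => [f _|n IH f]; first exact: Cn0.
move=> /CnS[f0 fn]; apply/CnS; split.
  move=> x; apply/derivable1_diffP.
  apply: (@differentiable_comp _ _ _ _ (fun y => a * y + b) f).
    exact/derivable1_diffP/derivable_affine.
  exact/derivable1_diffP/f0.
rewrite (_ : derive1 _ = fun x => derive1 f (a * x + b) * a).
  by apply: CnM; [exact: IH|exact: Cn_cst].
apply/funext => x.
have := @derive1_comp _ (fun y => a * y + b) f x (derivable_affine a b x) (f0 _).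
by rewrite /comp => ->; rewrite derive1_affine.
Qed.

Lemma smooth1M f g : smooth1 f -> smooth1 g -> smooth1 (fun x => f x * g x).
Proof. by move=> /smooth1Cn hf /smooth1Cn hg; apply/smooth1Cn => n; exact: CnM. Qed.

Lemma smooth1_cst (k : R) : smooth1 (fun=> k).
Proof. by apply/smooth1Cn => n; exact: Cn_cst. Qed.

Lemma smooth1_affine f (a b : R) : smooth1 f -> smooth1 (fun x => f (a * x + b)).
Proof. by move=> /smooth1Cn hf; apply/smooth1Cn => n; exact: Cn_affine. Qed.

Lemma smooth1_derive f : smooth1 f -> smooth1 (derive1 f).
Proof. by move=> hf n x; rewrite -derive1Sn; exact: hf. Qed.

Lemma smooth1_derivable f x : smooth1 f -> derivable f x 1.
Proof. by move=> hf; exact: (hf 0%N). Qed.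

Arguments smooth1_derivable : clear implicits.
Arguments smooth1_derivable {f} x _.

Lemma smooth1_continuous f : smooth1 f -> continuous f.
Proof. by move=> hf x; apply: derivable_continuous1; exact: smooth1_derivable. Qed.

Lemma near_derive1 f g (x : R) : (\forall y \near x, f y = g y) ->
  \forall y \near x, derive1 f y = derive1 g y.
Proof.
move=> fg; have : \forall y \near x, \forall z \near y, f z = g z by exact: nbhs_interior.
apply: filterS => y fgy.
by rewrite !derive1E; exact: near_eq_derive.
Qed.

Lemma near_derive1n n f g (x : R) :
  (\forall y \near x, f y = g y) ->
  \forall y \near x, derive1n n f y = derive1n n g y.
Proof.
by elim: n => [//|n IH] fg; rewrite !derive1nS; apply: near_derive1; exact: IH.
Qed.

Lemma smooth1_local f :
  (forall x : R, exists2 g, smooth1 g & \forall y \near x, g y = f y) -> smooth1 f.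
Proof.
move=> h n x; have [g sg gf] := h x.
exact: (near_eq_derivable (near_derive1n n gf) (sg n x)).
Qed.

End Smooth1.
Arguments derivable_cstE {R} k x.
Arguments derivable_affine {R} a b x.
Arguments smooth1_derivable {R f} x _.

Section Step.
Context {R : realType}.

Definition is_step (sg : R -> R) : Prop :=
  [/\ smooth1 sg, forall y, 0 <= sg y <= 1,
      forall y, y <= 0 -> sg y = 0 & forall y, 1 <= y -> sg y = 1].

(** The cutoff itself, extended by constants beyond [0, T] and rescaled.  Every
    test function used below is built from this step. *)
Lemma step_exists (T Tm Tp : R) (chi : R -> R) :
  0 < Tm -> Tm < Tp -> Tp < T -> is_cutoff T Tm Tp chi ->
  exists sg, is_step sg.
Proof.
move=> Tm0 mp pT [schi chi01 chi1 chi0].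
pose S t := if t < 0 then 1 else if t < T then chi t else 0.
have S1 t : t <= Tm -> S t = 1.
  rewrite /S; case: ltP => // t0 tm; rewrite ifT; first by apply: chi1; lra.
  by lra.
have S0 t : Tp <= t -> S t = 0.
  rewrite /S => tp; case: ltP => [|t0]; first by lra.
  by case: ltP => // tT; apply: chi0; lra.
have SC t : 0 < t -> t < T -> S t = chi t.
  by move=> t0 tT; rewrite /S tT; case: ltP => //; lra.
have S01 t : 0 <= S t <= 1.
  rewrite /S; case: ltP => t0; first by rewrite ler01 lexx.
  by case: ltP => tT; [apply: chi01; lra|rewrite ler01 lexx].
have sS : smooth1 S.
  apply: smooth1_local => t.
  have [tm|tm] := ltP t Tm.
    exists (fun=> 1); first exact: smooth1_cst.
    by near=> y; rewrite S1//; apply/ltW; near: y; exact: lt_nbhsl.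
  have [tp|tp] := ltP Tp t.
    exists (fun=> 0); first exact: smooth1_cst.
    by near=> y; rewrite S0//; apply/ltW; near: y; exact: lt_nbhsr.
  exists chi => //; near=> y; rewrite SC//; near: y.
    by apply: lt_nbhsr; lra.
  by apply: lt_nbhsl; lra.
exists (fun y => S ((Tm - Tp) * y + Tp)); split.
- exact: smooth1_affine.
- by move=> y; exact: S01.
- by move=> y y0; apply: S0; nra.
- by move=> y y0; apply: S1; nra.
Unshelve. all: by end_near. Qed.

End Step.

(** * Smooth functions and test functions in the plane *)

Section Smooth2.
Context {R : realType}.
Implicit Types f g : R * R -> R.

Lemma Ck_cont n f : Ck n f -> continuous f.
Proof. by case: n => [|n] []. Qed.

Lemma CkS n f : Ck n.+1 f <-> [/\ continuous f,
  forall p, derivable (fun x => f (x, p.2)) p.1 1,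
  forall p, derivable (fun t => f (p.1, t)) p.2 1, Ck n (dx f) & Ck n (dt f)].
Proof. by split=> [[cf []]|[cf ? ? ? ?]]; do ?split. Qed.

Lemma CkW n f : Ck n.+1 f -> Ck n f.
Proof.
elim: n f => [f /Ck_cont cf|n IH f]; first by split.
by move=> /CkS[cf fx ft Cx Ct]; apply/CkS; split; [|exact: fx|exact: ft|exact: IH|exact: IH].
Qed.

Lemma dxE f x t : dx f (x, t) = derive1 (fun x => f (x, t)) x.
Proof. by []. Qed.

Lemma dtE f x t : dt f (x, t) = derive1 (fun t => f (x, t)) t.
Proof. by []. Qed.

Lemma Ck_cst n (k : R) : Ck n (fun=> k).
Proof.
elim: n k => [k|n IH k]; first by split=> // p; exact: cst_continuous.
apply/CkS; split.
- by move=> p; exact: cst_continuous.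
- by move=> p; exact: derivable_cstE.
- by move=> p; exact: derivable_cstE.
- by rewrite (_ : dx _ = fun=> 0) //; apply/funext => p; exact: derive1_constf.
- by rewrite (_ : dt _ = fun=> 0) //; apply/funext => p; exact: derive1_constf.
Qed.

Lemma CkD n f g : Ck n f -> Ck n g -> Ck n (fun p => f p + g p).
Proof.
elim: n f g => [f g [cf _] [cg _]|n IH f g].
  by split=> // p; exact: (continuousD (cf p) (cg p)).
move=> /CkS[cf fx ft Cfx Cft] /CkS[cg gx gt Cgx Cgt]; apply/CkS; split.
- by move=> p; exact: (continuousD (cf p) (cg p)).
- by move=> p; exact: (derivable_addf (fx p) (gx p)).
- by move=> p; exact: (derivable_addf (ft p) (gt p)).
- rewrite (_ : dx _ = fun p => dx f p + dx g p); first exact: IH.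
  by apply/funext => p; exact: (derive1_addf (fx p) (gx p)).
- rewrite (_ : dt _ = fun p => dt f p + dt g p); first exact: IH.
  by apply/funext => p; exact: (derive1_addf (ft p) (gt p)).
Qed.

Lemma CkM n f g : Ck n f -> Ck n g -> Ck n (fun p => f p * g p).
Proof.
elim: n f g => [f g [cf _] [cg _]|n IH f g].
  by split=> // p; exact: (continuousM (cf p) (cg p)).
move=> Cf Cg.
have [[cf fx ft Cfx Cft] [cg gx gt Cgx Cgt]] := ((CkS n f).1 Cf, (CkS n g).1 Cg).
apply/CkS; split.
- by move=> p; exact: (continuousM (cf p) (cg p)).
- by move=> p; exact: (derivable_mulf (fx p) (gx p)).
- by move=> p; exact: (derivable_mulf (ft p) (gt p)).
- rewrite (_ : dx _ = fun p => dx f p * g p + f p * dx g p).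
    by apply: CkD; apply: IH; [exact: Cfx|exact: CkW|exact: CkW|exact: Cgx].
  by apply/funext => -[x t]; exact: (derive1_mulf (fx (x, t)) (gx (x, t))).
- rewrite (_ : dt _ = fun p => dt f p * g p + f p * dt g p).
    by apply: CkD; apply: IH; [exact: Cft|exact: CkW|exact: CkW|exact: Cgt].
  by apply/funext => -[x t]; exact: (derive1_mulf (ft (x, t)) (gt (x, t))).
Qed.

Lemma Ck_fst n (a : R -> R) : smooth1 a -> Ck n (fun p => a p.1).
Proof.
elim: n a => [a sa|n IH a sa].
  split=> // p; apply: (@continuous_comp _ _ _ fst a); first exact: cvg_fst.
  exact: smooth1_continuous.
apply/CkS; split.
- move=> p; apply: (@continuous_comp _ _ _ fst a); first exact: cvg_fst.
  exact: smooth1_continuous.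
- by move=> p; exact: (smooth1_derivable p.1 sa).
- by move=> p; exact: (derivable_cstE (a p.1) p.2).
- exact: (IH _ (smooth1_derive sa)).
- rewrite (_ : dt _ = fun=> 0); first exact: Ck_cst.
  by apply/funext => p; exact: (derive1_constf (a p.1) p.2).
Qed.

Lemma Ck_snd n (a : R -> R) : smooth1 a -> Ck n (fun p => a p.2).
Proof.
elim: n a => [a sa|n IH a sa].
  split=> // p; apply: (@continuous_comp _ _ _ snd a); first exact: cvg_snd.
  exact: smooth1_continuous.
apply/CkS; split.
- move=> p; apply: (@continuous_comp _ _ _ snd a); first exact: cvg_snd.
  exact: smooth1_continuous.
- by move=> p; exact: (derivable_cstE (a p.2) p.1).
- by move=> p; exact: (smooth1_derivable p.2 sa).
- rewrite (_ : dx _ = fun=> 0); first exact: Ck_cst.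
  by apply/funext => p; exact: (derive1_constf (a p.2) p.1).
- exact: (IH _ (smooth1_derive sa)).
Qed.

Lemma Ck_bottom n f : Ck n f -> Ck n (fun p => f (p.1, 0)).
Proof.
have cb (h : R * R -> R) : continuous h -> continuous (fun p : R * R => h (p.1, 0) : R).
  move=> ch p; have hp : (q.1, 0 : R) @[q --> p] --> (p.1, 0 : R).
    by apply: (@cvg_pair _ _ _ _ (nbhs p.1) (nbhs (0 : R))); [exact: cvg_fst|exact: cvg_cst].
  exact: (cvg_comp _ h hp (ch (p.1, 0))).
elim: n f => [f [cf _]|n IH f]; first by split=> //; exact: cb.
move=> /CkS[cf fx ft Cx Ct]; apply/CkS; split.
- exact: cb.
- by move=> p; exact: (fx (p.1, 0)).
- by move=> p; exact: (derivable_cstE (f (p.1, 0)) p.2).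
- exact: (IH _ Cx).
- rewrite (_ : dt _ = fun=> 0); first exact: Ck_cst.
  by apply/funext => p; exact: (derive1_constf (f (p.1, 0)) p.2).
Qed.

Lemma test_cont O f : test_fun O f -> continuous f.
Proof. by move=> [/(_ 0%N)[]]. Qed.

Lemma test_derx O f p : test_fun O f -> derivable (fun x => f (x, p.2)) p.1 1.
Proof. by move=> [/(_ 1%N) /CkS[]]. Qed.

Lemma test_dert O f p : test_fun O f -> derivable (fun t => f (p.1, t)) p.2 1.
Proof. by move=> [/(_ 1%N) /CkS[]]. Qed.

Lemma compact_closed2 (K : set (R * R)) : compact K -> closed K.
Proof. by apply: compact_closed; exact: norm_hausdorff. Qed.

Lemma near_out (K : set (R * R)) p : closed K -> ~ K p ->
  \forall q \near p, ~ K q.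
Proof.
move=> cK Kp; have : open_nbhs p (~` K) by split=> //; exact: closed_openC.
by move=> /open_nbhs_nbhs.
Qed.

Lemma dx_out f (K : set (R * R)) p : closed K ->
  (forall q, ~ K q -> f q = 0) -> ~ K p -> dx f p = 0.
Proof.
case: p => x t cK f0 Kp; rewrite dxE -(@derive1_constf R 0 x) !derive1E.
apply: near_eq_derive.
have h : (y, t) @[y --> x] --> (x, t) by apply: (@cvg_pair _ _ _ _ (nbhs x) (nbhs t)); [exact: cvg_id|exact: cvg_cst].
have hn : \forall y \near x, ~ K (y, t) by exact: (h _ (near_out cK Kp)).
by apply: filterS hn => y /f0.
Qed.

Lemma dt_out f (K : set (R * R)) p : closed K ->
  (forall q, ~ K q -> f q = 0) -> ~ K p -> dt f p = 0.
Proof.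
case: p => x t cK f0 Kp; rewrite dtE -(@derive1_constf R 0 t) !derive1E.
apply: near_eq_derive.
have h : (x, y) @[y --> t] --> (x, t) by apply: (@cvg_pair _ _ _ _ (nbhs x) (nbhs t)); [exact: cvg_cst|exact: cvg_id].
have hn : \forall y \near t, ~ K (x, y) by exact: (h _ (near_out cK Kp)).
by apply: filterS hn => y /f0.
Qed.

Lemma test_dx O f : test_fun O f -> test_fun O (dx f).
Proof.
move=> [Cf [K [cK KO f0]]]; split.
  by move=> n; have /CkS[] := Cf n.+1.
exists K; split=> // p Kp; apply: dx_out f0 Kp; exact: compact_closed2.
Qed.

Lemma test_dt O f : test_fun O f -> test_fun O (dt f).
Proof.
move=> [Cf [K [cK KO f0]]]; split.
  by move=> n; have /CkS[] := Cf n.+1.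
exists K; split=> // p Kp; apply: dt_out f0 Kp; exact: compact_closed2.
Qed.

Lemma test_iter O f j k : test_fun O f -> test_fun O (iter j dx (iter k dt f)).
Proof.
move=> tf; elim: j => [|j IH] /=; last exact: test_dx.
by elim: k => [//|k IH] /=; exact: test_dt.
Qed.

Lemma testMr O f g : test_fun O f -> (forall n, Ck n g) ->
  test_fun O (fun p => f p * g p).
Proof.
move=> [Cf [K [cK KO f0]]] Cg; split; first by move=> n; exact: CkM.
by exists K; split=> // p /f0 ->; rewrite mul0r.
Qed.

Lemma testD O f g : test_fun O f -> test_fun O g ->
  test_fun O (fun p => f p + g p).
Proof.
move=> [Cf [K [cK KO f0]]] [Cg [L [cL LO g0]]].
split; first by move=> n; exact: CkD.
exists (K `|` L); split; first exact: compactU.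
  by rewrite subUset.
by move=> p /not_orP[/f0 -> /g0 ->]; rewrite addr0.
Qed.

Lemma testS O O' f : O `<=` O' -> test_fun O f -> test_fun O' f.
Proof.
move=> OO' [Cf [K [cK KO f0]]]; split=> //.
by exists K; split=> //; exact: subset_trans OO'.
Qed.

Lemma test_prod (A B : set R) (a b : R -> R) : test_fun1 A a -> test_fun1 B b ->
  test_fun [set p | A p.1 /\ B p.2] (fun p => a p.1 * b p.2).
Proof.
move=> [sa [K [cK KA a0]]] [sb [L [cL LB b0]]].
split; first by move=> n; apply: CkM; [exact: Ck_fst|exact: Ck_snd].
exists (K `*` L); split; first exact: compact_setX.
  by move=> p [/KA ? /LB].
move=> p /not_andP[/a0 ->|/b0 ->]; first by rewrite mul0r.
by rewrite mulr0.
Qed.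

Lemma dx_prod (a b : R -> R) : smooth1 a ->
  dx (fun p => a p.1 * b p.2) = fun p => derive1 a p.1 * b p.2.
Proof.
move=> sa; apply/funext => -[x t]; rewrite dxE/= derive1_mulf.
- by rewrite derive1_constf mulr0 addr0.
- exact: smooth1_derivable.
- exact: derivable_cstE.
Qed.

Lemma dt_prod (a b : R -> R) : smooth1 b ->
  dt (fun p => a p.1 * b p.2) = fun p => a p.1 * derive1 b p.2.
Proof.
move=> sb; apply/funext => -[x t]; rewrite dtE/= derive1_mulf.
- by rewrite derive1_constf mul0r add0r.
- exact: derivable_cstE.
- exact: smooth1_derivable.
Qed.

Lemma test1_derive O (a : R -> R) : test_fun1 O a -> test_fun1 O (derive1 a).
Proof.
move=> [sa [K [cK KO a0]]]; split; first exact: smooth1_derive.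
exists K; split=> // x Kx; rewrite -(@derive1_constf R 0 x) !derive1E.
apply: near_eq_derive.
have oK : open (~` K).
  by apply: closed_openC; apply: compact_closed => //; exact: Rhausdorff.
have : open_nbhs x (~` K) by [].
by move=> /open_nbhs_nbhs; apply: filterS => y /a0.
Qed.

Lemma test1S O O' (a : R -> R) : O `<=` O' -> test_fun1 O a -> test_fun1 O' a.
Proof.
move=> OO' [Cf [K [cK KO f0]]]; split=> //.
by exists K; split=> //; exact: subset_trans OO'.
Qed.

End Smooth2.

(** * Borel sets of the plane and pi-systems of boxes *)

Section Dynkin.
Context d d' {T : measurableType d} {T' : measurableType d'} {R : realType}.
Variable mu : {measure set T -> \bar R}.
Local Open Scope ereal_scope.

(** The sets over which [f] integrates to zero form a lambda-system.  The map
    [pr] selects the coordinate in which intervals are enlarged to Borel sets. *)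
Lemma integral0_dynkin (D : set T) (f : T -> \bar R) (pr : T -> T')
    (G : set (set T')) :
  @measurable _ T' = <<s G >> -> setI_closed G -> measurable D ->
  measurable_fun setT pr -> mu.-integrable D f ->
  \int[mu]_(x in D) f x = 0 ->
  (forall A, G A -> \int[mu]_(x in D `&` pr @^-1` A) f x = 0) ->
  forall A, measurable A -> \int[mu]_(x in D `&` pr @^-1` A) f x = 0.
Proof.
move=> GE GI mD mpr fi D0 G0 A mA.
have mpre B : measurable B -> measurable (pr @^-1` B).
  by move=> mB; rewrite -[X in measurable X]setTI; exact: mpr.
have mf := measurable_int _ fi.
apply: (dynkin_induction (P := fun A => \int[mu]_(x in D `&` pr @^-1` A) f x = 0) GE) => //.
- by rewrite preimage_setT setIT.
- move=> S mS S0.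
  have : \int[mu]_(x in (D `&` pr @^-1` S) `|` (D `&` pr @^-1` (~` S))) f x = 0.
    by rewrite -setIUr preimage_setC setUv setIT.
  rewrite integral_setU.
  - by rewrite S0 add0e.
  - by apply: measurableI => //; exact: mpre.
  - by apply: measurableI => //; apply: mpre; exact: measurableC.
  - by rewrite -setIUr preimage_setC setUv setIT.
  - rewrite disj_set2E; apply/eqP; rewrite -setIIr preimage_setC setICr setI0.
    by [].
- move=> F mF tF F0.
  rewrite preimage_bigcup setI_bigcupr integral_bigcup.
  + by apply: eseries0 => i _ _; exact: F0.
  + move=> i j _ _ [x [[_ xi] [_ xj]]]; apply: tF => //.
    by exists (pr x).
  + by move=> k; apply: measurableI => //; exact: mpre.
  + rewrite -setI_bigcupr; apply: integrableS fi => //.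
      by apply: measurableI => //; apply: bigcupT_measurable => k; exact: mpre.
- by rewrite -GE.
Qed.

End Dynkin.

Section Plane.
Context {R : realType}.
Local Notation plane := (plane (R := R)).

Lemma measurable_fst_plane : measurable_fun setT (fst : plane -> measurableTypeR R).
Proof. exact: measurable_fst. Qed.

Lemma measurable_snd_plane : measurable_fun setT (snd : plane -> measurableTypeR R).
Proof. exact: measurable_snd. Qed.

Lemma measurable_rect (A B : set R) : measurable (A : set (measurableTypeR R)) ->
  measurable (B : set (measurableTypeR R)) -> measurable (A `*` B : set plane).
Proof. by move=> mA mB; exact: measurableX. Qed.

(** An open set is a countable union of boxes with rational corners. *)
Lemma open_measurable2 (U : set (R * R)) : open U -> measurable (U : set plane).
Proof.
move=> oU.
pose bx (q : rat * rat * (rat * rat)) : set (R * R) :=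
  `]ratr q.1.1, ratr q.1.2[ `*` `]ratr q.2.1, ratr q.2.2[.
pose F q := if `[< bx q `<=` U >] then bx q else set0.
have mF q : measurable (F q : set plane).
  rewrite /F; case: ifP => // _.
  by apply: measurable_rect; exact: measurable_itv.
suff -> : U = \bigcup_q F q.
  by apply: countable_bigcupT_measurable.
apply/seteqP; split; last first.
  by move=> p [q _]; rewrite /F; case: ifPn => // /asboolP; apply.
move=> [x t] Up; have /nbhs_ballP[e /= e0 eU] : nbhs (x, t) U by exact: open_nbhs_nbhs.
have rat_near (z : R) : exists a b : rat,
    [/\ z - e < ratr a, ratr a < z, z < ratr b & ratr b < z + e].
  have /rat_in_itvoo[a] : z - e < z by rewrite gtrBl.
  rewrite in_itv/= => /andP[a1 a2].
  have /rat_in_itvoo[b] : z < z + e by rewrite ltrDl.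
  by rewrite in_itv/= => /andP[b1 b2]; exists a, b; split.
have [a [b [a1 a2 b1 b2]]] := rat_near x.
have [a' [b' [a'1 a'2 b'1 b'2]]] := rat_near t.
exists ((a, b), (a', b')) => //.
have sub : bx ((a, b), (a', b')) `<=` U.
  move=> [y u] [/=]; rewrite !in_itv/= => /andP[ya yb] /andP[ua ub]; apply: eU.
  by split => /=; rewrite /ball/= ltr_norml; apply/andP; split; lra.
rewrite /F asboolT//=; split => /=; rewrite in_itv/=; apply/andP; split=> //.
Qed.

Lemma closed_measurable2 (K : set (R * R)) : closed K -> measurable (K : set plane).
Proof.
by move=> /closed_openC/open_measurable2 m; rewrite -[X in measurable X]setCK; exact: measurableC.
Qed.

Lemma compact_measurable2 (K : set (R * R)) : compact K -> measurable (K : set plane).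
Proof. by move=> /compact_closed2; exact: closed_measurable2. Qed.

Lemma continuous_measurable2 (f : R * R -> R) : continuous f ->
  measurable_fun setT (f : plane -> R).
Proof.
move=> /continuousP cf; apply: (measurability _ (RGenOpens.measurableE R)).
move=> _ [_ [a [b ->] <-]]; rewrite setTI.
by apply: open_measurable2; apply: cf; exact: interval_open.
Qed.

(** One pass of [integral0_dynkin] for each coordinate replaces intervals by
    Borel sets; a third pass goes from Borel boxes to the product sigma-algebra. *)
Lemma itvoo_rect_dynkin (D : set plane) (f : plane -> \bar R) :
  measurable D -> mu2.-integrable D f ->
  (forall a b c d, (\int[mu2]_(p in D `&` (`]a, b[ `*` `]c, d[)) f p = 0)%E) ->
  (\int[mu2]_(p in D) f p = 0)%E ->
  (forall a b, (\int[mu2]_(p in D `&` (`]a, b[ `*` setT)) f p = 0)%E) ->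
  (forall c d, (\int[mu2]_(p in D `&` (setT `*` `]c, d[)) f p = 0)%E) ->
  ae_eq mu2 D f (cst 0%E).
Proof.
move=> mD fi rect0 D0 row0 col0.
pose GI := [set A : set R | exists x y, A = `]x, y[%classic].
have GIE : @measurable _ (measurableTypeR R) = <<s GI >>.
  exact: (RGenOpens.measurableE R).
have GII : setI_closed GI.
  move=> _ _ [x [y ->]] [x' [y' ->]].
  exists (Num.max x x'), (Num.min y y'); apply/seteqP; split=> z /=;
    rewrite !in_itv/= gt_max lt_min.
    by move=> [/andP[-> ->] /andP[-> ->]].
  by move=> /andP[/andP[-> ->] /andP[-> ->]].
have step1 c d (A : set (measurableTypeR R)) : measurable A ->
    (\int[mu2]_(p in D `&` (A `*` `]c, d[)) f p = 0)%E.
  move=> mA.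
  have mD' : measurable (D `&` (setT `*` `]c, d[) : set plane).
    apply: measurableI => //; apply: measurable_rect => //; exact: measurable_itv.
  have := @integral0_dynkin _ _ plane (measurableTypeR R) R mu2
    (D `&` (setT `*` `]c, d[)) f fst GI GIE GII mD' measurable_fst_plane.
  have -> : D `&` (A `*` `]c, d[) = D `&` (setT `*` `]c, d[) `&` fst @^-1` A.
    by apply/seteqP; split=> -[x y] /=; tauto.
  apply=> //.
  - by apply: integrableS fi => //; exact: subIsetl.
  - move=> _ [x [y ->]].
    rewrite (_ : D `&` _ `&` _ = D `&` (`]x, y[ `*` `]c, d[)); first exact: rect0.
    by apply/seteqP; split=> -[x' y'] /=; tauto.
have step2 (A : set (measurableTypeR R)) (B : set (measurableTypeR R)) :
    measurable A -> measurable B ->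
    (\int[mu2]_(p in D `&` (A `*` B)) f p = 0)%E.
  move=> mA mB.
  have mD' : measurable (D `&` (A `*` setT) : set plane).
    by apply: measurableI => //; exact: measurable_rect.
  have := @integral0_dynkin _ _ plane (measurableTypeR R) R mu2
    (D `&` (A `*` setT)) f snd GI GIE GII mD' measurable_snd_plane.
  have -> : D `&` (A `*` B) = D `&` (A `*` setT) `&` snd @^-1` B.
    by apply/seteqP; split=> -[x y] /=; tauto.
  apply=> //.
  - by apply: integrableS fi => //; exact: subIsetl.
  - have := @integral0_dynkin _ _ plane (measurableTypeR R) R mu2
      D f fst GI GIE GII mD measurable_fst_plane fi D0.
    rewrite (_ : D `&` (A `*` _) = D `&` fst @^-1` A); last first.
      by apply/seteqP; split=> -[x y] /=; tauto.
    apply=> // _ [x [y ->]].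
    rewrite (_ : D `&` (fst @^-1` _) = D `&` (`]x, y[ `*` setT)); first exact: row0.
    by apply/seteqP; split=> -[x' y'] /=; tauto.
  - move=> _ [x [y ->]].
    rewrite (_ : D `&` _ `&` _ = D `&` (A `*` `]x, y[)); first exact: step1.
    by apply/seteqP; split=> -[x' y'] /=; tauto.
apply: integral_ae_eq => // E ED mE; rewrite integral0.
pose GR := [set A `*` B | A in @measurable _ (measurableTypeR R) &
  B in @measurable _ (measurableTypeR R)].
rewrite (_ : E = D `&` id @^-1` E); last by rewrite setIC; apply/esym/setIidPl.
apply: (@integral0_dynkin _ _ plane plane R mu2 D f id GR) => //.
- exact: measurable_prod_measurableType.
- move=> _ _ [A mA [B mB <-]] [A' mA' [B' mB' <-]].
  exists (A `&` A'); first exact: measurableI.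
  by exists (B `&` B'); [exact: measurableI|rewrite setXI].
- by move=> _ [A mA [B mB <-]]; exact: step2.
Qed.

Lemma itvoo_dynkin (D : set (measurableTypeR R)) (f : measurableTypeR R -> \bar R) :
  measurable D -> (@lebesgue_measure R).-integrable D f ->
  (forall a b, (\int[lebesgue_measure]_(x in D `&` `]a, b[) f x = 0)%E) ->
  (\int[lebesgue_measure]_(x in D) f x = 0)%E ->
  ae_eq (@lebesgue_measure R) D f (cst 0%E).
Proof.
move=> mD fi itv0 D0.
pose GI := [set A : set R | exists x y, A = `]x, y[%classic].
have GIE : @measurable _ (measurableTypeR R) = <<s GI >>.
  exact: (RGenOpens.measurableE R).
have GII : setI_closed GI.
  move=> _ _ [x [y ->]] [x' [y' ->]].
  exists (Num.max x x'), (Num.min y y'); apply/seteqP; split=> z /=;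
    rewrite !in_itv/= gt_max lt_min.
    by move=> [/andP[-> ->] /andP[-> ->]].
  by move=> /andP[/andP[-> ->] /andP[-> ->]].
apply: integral_ae_eq => // E ED mE; rewrite integral0.
rewrite (_ : E = D `&` id @^-1` E); last by rewrite setIC; apply/esym/setIidPl.
apply: (@integral0_dynkin _ _ _ (measurableTypeR R) R _ D f id GI) => //.
by move=> _ [x [y ->]]; exact: itv0.
Qed.

End Plane.

(** * Dominated convergence and bump functions *)

Section GeneralMeasure.
Context d {T : measurableType d} {R : realType}.
Variable mu : {measure set T -> \bar R}.

Lemma integrable_bump (D K : set T) (f eta : T -> R) (M : R) :
  measurable D -> measurable K -> measurable_fun D f ->
  mu.-integrable (D `&` K) (EFin \o f) -> measurable_fun D eta ->
  (forall p, D p -> `|eta p| <= M) -> (forall p, D p -> ~ K p -> eta p = 0) ->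
  mu.-integrable D (EFin \o (fun p => f p * eta p)).
Proof.
move=> mD mK mf fi me etaM eta0.
have gi : mu.-integrable D ((fun p => (M%:E * `|f p|%:E)%E) \_ K).
  apply/integrable_restrict => //.
  by apply: integrableZl; [exact: measurableI|exact: integrable_norm].
apply: le_integrable gi => //.
  by apply/measurable_EFinP; exact: measurable_funM.
move=> p Dp; rewrite /patch /=; case: ifPn => [_|].
  rewrite -EFinM /= lee_fin normrM [leRHS]ger0_norm.
    by rewrite mulrC ler_wpM2r//; exact: etaM.
  by apply: mulr_ge0 => //; exact: (le_trans _ (etaM _ Dp)).
by rewrite notin_setE => Kp; rewrite eta0// mulr0 normr0 abse0.
Qed.

Lemma Rintegral_dct (D : set T) (h_ : nat -> T -> R) (h g : T -> R) :
  measurable D -> (forall n, measurable_fun D (h_ n)) -> measurable_fun D h ->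
  (forall x, D x -> h_ ^~ x @ \oo --> h x) ->
  mu.-integrable D (EFin \o g) ->
  (forall n x, D x -> `|h_ n x| <= g x) ->
  mu.-integrable D (EFin \o h) /\
  \int[mu]_(x in D) h_ n x @[n --> \oo] --> \int[mu]_(x in D) h x.
Proof.
move=> mD mh_ mh cv ig dom.
have [] := @dominated_convergence _ T R mu D mD (fun n => EFin \o h_ n)
  (EFin \o h) (EFin \o g).
- by move=> n; apply/measurable_EFinP.
- by apply/measurable_EFinP.
- by apply: aeW => x Dx /=; apply: cvg_EFin; [exact: nearW|exact: cv].
- exact: ig.
- by apply: aeW => x n Dx /=; rewrite lee_fin; exact: dom.
move=> hi _ c; split=> //; apply: fine_cvg; rewrite fineK//.
exact: integrable_fin_num.
Qed.

Lemma Rintegral_indic (D E : set T) (f : T -> R) : measurable D ->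
  \int[mu]_(x in D) (f x * \1_E x) = \int[mu]_(x in D `&` E) f x.
Proof.
move=> mD; rewrite Rintegral_mkcondr; apply: eq_Rintegral => x _.
by rewrite patchE indicE; case: ifP => /= _; rewrite ?mulr1 ?mulr0.
Qed.

End GeneralMeasure.

Section Bumps.
Context {R : realType}.

(** Steps are dilated at both ends of the interval, so that each bump has compact
    support inside it while the sequence converges to its indicator function. *)
Lemma bump_seq (sg : R -> R) : is_step sg -> forall a b : R,
  exists u : nat -> R -> R, [/\ forall n, test_fun1 `]a, b[ (u n),
    forall n x, 0 <= u n x <= 1,
    forall n x, ~ `]a, b[%classic x -> u n x = 0 &
    forall x, `]a, b[%classic x -> u ^~ x @ \oo --> (1 : R)].
Proof.
move=> [ssg sg01 sg0 sg1] a b.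
pose k n : R := n.+1%:R.
have k0 n : 0 < k n by rewrite /k ltr0n.
pose u n x := sg (k n * x + (- k n * a - 1)) * sg (- k n * x + (k n * b - 1)).
have u0 n x : ~~ ((a + (k n)^-1 <= x) && (x <= b - (k n)^-1)) -> u n x = 0.
  rewrite negb_and -!ltNge => /orP[xa|xb].
    rewrite /u sg0 ?mul0r//.
    have := k0 n; move: xa; rewrite -ltrBlDl.
    rewrite -[X in _ < X]div1r ltr_pdivlMr// mulrBl => h h0.
    by rewrite mulNr; move: h; rewrite ![_ * k n]mulrC; lra.
  rewrite /u [X in _ * X]sg0 ?mulr0//.
  have := k0 n; move: xb; rewrite ltrBlDr -ltrBlDl.
  rewrite -[X in _ < X]div1r ltr_pdivlMr// mulrBl => h h0.
  by rewrite mulNr; move: h; rewrite ![_ * k n]mulrC; lra.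
exists u; split.
- move=> n; split.
    by apply: smooth1M; apply: smooth1_affine.
  exists `[a + (k n)^-1, b - (k n)^-1]%classic; split.
  + exact: segment_compact.
  + move=> x /=; rewrite !in_itv/= => /andP[xa xb].
    have : 0 < (k n)^-1 by rewrite invr_gt0.
    by move: (k n)^-1 xa xb => q xa xb q0; apply/andP; split; lra.
  + by move=> x /= /negP; rewrite in_itv/=; exact: u0.
- move=> n x; rewrite /u; have /andP[p1 p2] := sg01 (k n * x + (- k n * a - 1)).
  have /andP[q1 q2] := sg01 (- k n * x + (k n * b - 1)).
  by rewrite mulr_ge0//= mulr_ile1.
- move=> n x /= /negP; rewrite in_itv/= => xab; apply: u0.
  apply: contra xab => /andP[xa xb].
  have : 0 < (k n)^-1 by rewrite invr_gt0.
  by move: (k n)^-1 xa xb => q xa xb q0; apply/andP; split; lra.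
- move=> x /=; rewrite in_itv/= => /andP[xa xb].
  apply: cvg_near_cst.
  have lim0 (e : R) : 0 < e -> \forall n \near \oo, (k n)^-1 * 2 <= e.
    move=> e0; have e20 : 0 < e / 2 by rewrite divr_gt0.
    near=> n; rewrite -ler_pdivlMr// /k; apply/ltW.
    near: n; exact: (near_infty_natSinv_lt (PosNum e20)).
  near=> n; rewrite /u.
  have h1 : (k n)^-1 * 2 <= x - a by near: n; apply: lim0; lra.
  have h2 : (k n)^-1 * 2 <= b - x by near: n; apply: lim0; lra.
  rewrite ler_pdivrMl// in h1; rewrite ler_pdivrMl// in h2.
  rewrite mulrBr in h1; rewrite mulrBr in h2.
  by rewrite !sg1 ?mulr1// mulNr; lra.
Unshelve. all: by end_near. Qed.

(** The value 1 is taken on both sides of t = 0, so that the derivative vanishes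
    in a neighbourhood of the bottom side. *)
Lemma plateau_exists (sg : R -> R) (T : R) : is_step sg -> 0 < T ->
  exists2 zeta, test_fun1 [set t | t < T] zeta &
    forall t, -1 <= t <= T / 3 -> zeta t = 1.
Proof.
move=> [ssg sg01 sg0 sg1] T0.
pose zeta t := sg (1 * t + 2) * sg (- (3 / T) * t + 2).
have z0 t : 2 * T / 3 <= t -> zeta t = 0.
  move=> tT; rewrite /zeta [X in _ * X]sg0 ?mulr0//.
  have : 3 / T * (2 * T / 3) <= 3 / T * t by rewrite ler_wpM2l// divr_ge0// ltW.
  rewrite (_ : 3 / T * (2 * T / 3) = 2); first by lra.
  by field; rewrite gt_eqF.
exists zeta.
- split; first by apply: smooth1M; exact: smooth1_affine.
  exists `[-2, 2 * T / 3]%classic; split; first exact: segment_compact.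
    by move=> t /=; rewrite in_itv/= => /andP[_ t2]; lra.
  move=> t /= /negP; rewrite in_itv/= negb_and -!ltNge => /orP[t2|/ltW /z0//].
  by rewrite /zeta sg0 ?mul0r//; lra.
- move=> t /andP[t1 t2].
  have h : 3 / T * t <= 1.
    apply: (@le_trans _ _ (3 / T * (T / 3))).
      by rewrite ler_wpM2l// divr_ge0// ltW.
    by rewrite le_eqVlt; apply/orP; left; apply/eqP; field; rewrite gt_eqF.
  by rewrite /zeta !sg1 ?mulr1//; lra.
Qed.

End Bumps.

(** * Local integrability and the fundamental lemma of the calculus of variations *)

Section LocInt.
Context {R : realType}.
Local Notation plane := (plane (R := R)).
Local Notation lm := (@lebesgue_measure R).
Implicit Types (f g eta : R * R -> R) (D O : set (R * R)).

Lemma test_bounded O eta : test_fun O eta -> exists2 M, 0 <= M & forall p, `|eta p| <= M.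
Proof.
move=> te; have [_ [K [cK KO e0]]] := te.
have [M [_ hM]] : bounded_set (eta @` K).
  apply: compact_bounded; apply: continuous_compact => //.
  by apply: continuous_subspaceT; exact: test_cont te.
exists (Num.max M 0 + 1); first by rewrite addr_ge0// le_max lexx orbT.
move=> p; have [Kp|/e0 ->] := pselect (K p).
  apply: hM; last by exists p.
  by rewrite (le_lt_trans (_ : _ <= Num.max M 0))// ?le_max ?lexx// ltrDl.
by rewrite normr0 addr_ge0// le_max lexx orbT.
Qed.

Lemma test_measurable O eta (D : set plane) : test_fun O eta ->
  measurable_fun D (eta : plane -> R).
Proof.
by move=> te; apply: measurable_funTS; apply: continuous_measurable2; exact: test_cont te.
Qed.

Lemma loc_int_integrable (D : set plane) O f eta (M : R) (K : set (R * R)) :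
  measurable D -> loc_int D O f -> compact K -> K `<=` O ->
  measurable_fun D (eta : plane -> R) -> (forall p, D p -> `|eta p| <= M) ->
  (forall p, D p -> ~ K p -> eta p = 0) ->
  mu2.-integrable D (EFin \o (fun p => f p * eta p)).
Proof.
move=> mD [mf fi] cK KO me eM e0; apply: (@integrable_bump _ plane R mu2 D K f eta M) => //.
  exact: compact_measurable2.
exact: fi.
Qed.

Lemma loc_int_test (D : set plane) O f eta : measurable D -> loc_int D O f ->
  test_fun O eta -> mu2.-integrable D (EFin \o (fun p => f p * eta p)).
Proof.
move=> mD lf te; have [M M0 eM] := test_bounded te.
have [_ [K [cK KO e0]]] := te.
apply: (loc_int_integrable (K := K) (M := M) mD lf) => //.
- exact: test_measurable te.
- by move=> p _; exact: e0.
Qed.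

Lemma loc_intS D O O' f : O' `<=` O -> loc_int D O f -> loc_int D O' f.
Proof.
move=> OO [mf fi]; split=> // K cK KO; apply: fi => //.
exact: subset_trans OO.
Qed.

Lemma loc_intD (D : set plane) O f g : measurable D -> loc_int D O f -> loc_int D O g ->
  loc_int D O (fun p => f p + g p).
Proof.
move=> mD [mf fi] [mg gi]; split; first exact: measurable_funD.
move=> K cK KO; have := integrableD _ (fi K cK KO) (gi K cK KO).
apply; apply: measurableI => //; exact: compact_measurable2.
Qed.

Lemma loc_intM (D : set plane) O f eta : measurable D -> loc_int D O f ->
  measurable_fun D (eta : plane -> R) ->
  (forall K, compact K -> K `<=` O -> exists M : R, forall p, D p -> K p -> `|eta p| <= M) ->
  loc_int D O (fun p => eta p * f p).
Proof.
move=> mD [mf fi] me eb; split; first exact: measurable_funM.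
move=> K cK KO; have [M eM] := eb K cK KO.
have mK : measurable (D `&` K).
  by apply: measurableI => //; exact: compact_measurable2.
have := @integrableMr _ plane R mu2 (D `&` K) mK eta (EFin \o f).
apply; last exact: fi.
- by apply: measurable_funS me => //; exact: subIsetl.
- exists M; split; first exact: num_real.
  move=> y My p /= [Dp Kp]; apply: le_trans (ltW My); exact: eM.
Qed.

Lemma loc_intZ (D : set plane) O f (k : R) : measurable D -> loc_int D O f ->
  loc_int D O (fun p => k * f p).
Proof.
move=> mD lf; apply: (@loc_intM _ _ f (cst k)) => //.
by move=> K _ _; exists `|k|.
Qed.

Lemma integrable_ae_congr d (T : measurableType d) (mu : {measure set T -> \bar R})
    (D : set T) (f g : T -> R) : measurable D -> measurable_fun D g ->
  {ae mu, forall p, D p -> f p = g p} ->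
  mu.-integrable D (EFin \o f) -> mu.-integrable D (EFin \o g).
Proof.
move=> mD mg fg fi; have mf := (measurable_EFinP _ _).1 (measurable_int _ fi).
apply/integrableP; split; first exact/measurable_EFinP.
have /integrableP[_] := fi; congr (_ < _)%E.
apply: ge0_ae_eq_integral => //.
- by apply: measurableT_comp => //; exact/measurable_EFinP.
- by apply: measurableT_comp => //; exact/measurable_EFinP.
- by apply: filterS fg => p h /h /= ->.
Qed.

Lemma Rintegral_ae_congr d (T : measurableType d) (mu : {measure set T -> \bar R})
    (D : set T) (f g : T -> R) : measurable D -> measurable_fun D f ->
  measurable_fun D g -> {ae mu, forall p, D p -> f p = g p} ->
  \int[mu]_(x in D) f x = \int[mu]_(x in D) g x.
Proof.
move=> mD mf mg fg; congr fine; apply: ae_eq_integral => //.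
- exact/measurable_EFinP.
- exact/measurable_EFinP.
- by apply: filterS fg => p h /h /= ->.
Qed.

Lemma aeS (P P' : plane -> Prop) : (forall p, P p -> P' p) ->
  {ae (@mu2 R), forall p, P p} -> {ae (@mu2 R), forall p, P' p}.
Proof. by move=> PP; apply: filterS => p; exact: PP. Qed.

Lemma aeS2 (P P' P'' : plane -> Prop) : (forall p, P p -> P' p -> P'' p) ->
  {ae (@mu2 R), forall p, P p} -> {ae (@mu2 R), forall p, P' p} ->
  {ae (@mu2 R), forall p, P'' p}.
Proof. by move=> PP; apply: filterS2 => p; exact: PP. Qed.

Lemma ae1S (P P' : measurableTypeR R -> Prop) : (forall p, P p -> P' p) ->
  {ae lm, forall p, P p} -> {ae lm, forall p, P' p}.
Proof. by move=> PP; apply: filterS => p; exact: PP. Qed.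

Lemma loc_int_ae (D : set plane) O f g : measurable D ->
  measurable_fun D (g : plane -> R) ->
  {ae mu2, forall p, D p -> f p = g p} -> loc_int D O f -> loc_int D O g.
Proof.
move=> mD mg fg [mf fi]; split=> // K cK KO.
have mK : measurable (D `&` K).
  by apply: measurableI => //; exact: compact_measurable2.
apply: integrable_ae_congr (fi K cK KO) => //.
  by apply: measurable_funS mg => //; exact: subIsetl.
by apply: filterS fg => p h [Dp _]; exact: h.
Qed.

Lemma test1_bounded (O : set R) (a : R -> R) : test_fun1 O a ->
  exists2 M, 0 <= M & forall x, `|a x| <= M.
Proof.
move=> [sa [K [cK KO e0]]].
have [M [_ hM]] : bounded_set (a @` K).
  apply: compact_bounded; apply: continuous_compact => //.
  by apply: continuous_subspaceT; exact: smooth1_continuous.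
exists (Num.max M 0 + 1); first by rewrite addr_ge0// le_max lexx orbT.
move=> p; have [Kp|/e0 ->] := pselect (K p).
  apply: hM; last by exists p.
  by rewrite (le_lt_trans (_ : _ <= Num.max M 0))// ?le_max ?lexx// ltrDl.
by rewrite normr0 addr_ge0// le_max lexx orbT.
Qed.

Lemma smooth1_measurable (a : R -> R) (D : set (measurableTypeR R)) : smooth1 a ->
  measurable_fun D (a : measurableTypeR R -> R).
Proof.
move=> sa; apply: measurable_funTS; apply: continuous_measurable_fun.
exact: smooth1_continuous.
Qed.

Lemma locally_integrable_integrable (O : set R) (p a : R -> R) (M : R) (K : set R) :
  locally_integrable O p -> compact K -> K `<=` O ->
  measurable_fun (O : set (measurableTypeR R)) (a : measurableTypeR R -> R) ->
  (forall x, O x -> `|a x| <= M) -> (forall x, O x -> ~ K x -> a x = 0) ->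
  lm.-integrable O (EFin \o (fun x => p x * a x)).
Proof.
move=> [mp oO pK] cK KO ma aM a0.
have mO : measurable (O : set (measurableTypeR R)) by exact: open_measurable.
have mK : measurable (K : set (measurableTypeR R)) by exact: compact_measurable.
apply: (@integrable_bump _ (measurableTypeR R) _ _ O K p a M) => //.
rewrite setIidr//; apply/integrableP; split.
  by apply/measurable_EFinP; apply: measurable_funS mp.
exact: pK.
Qed.

Lemma locally_integrable_test (O : set R) (p a : R -> R) :
  locally_integrable O p -> test_fun1 O a ->
  lm.-integrable O (EFin \o (fun x => p x * a x)).
Proof.
move=> lp ta; have [M M0 aM] := test1_bounded ta; have [sa [K [cK KO a0]]] := ta.
apply: (locally_integrable_integrable (K := K) (M := M)) => //.
- exact: smooth1_measurable.
- by move=> x _; exact: a0.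
Qed.

Lemma open_half_line : open (@half_line R).
Proof. exact: interval_open. Qed.

Lemma measurable_half_line : measurable (@half_line R : set (measurableTypeR R)).
Proof. exact: measurable_itv. Qed.

Lemma measurable_time_int (T : R) : measurable (time_int T : set (measurableTypeR R)).
Proof. exact: measurable_itv. Qed.

Lemma QsetE (T : R) : Qset T = half_line `*` time_int T.
Proof.
apply/seteqP; split=> -[x t]; rewrite /Qset /half_line /time_int /=.
  by move=> [x0 t0]; rewrite !in_itv/= andbT; split.
by rewrite !in_itv/= andbT => -[].
Qed.

Lemma measurable_Qset (T : R) : measurable (Qset T : set plane).
Proof.
by rewrite QsetE; apply: measurable_rect; [exact: measurable_half_line|exact: measurable_time_int].
Qed.

Lemma test_prodQ (T : R) (a b : R -> R) : test_fun1 half_line a ->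
  test_fun1 (time_int T) b -> test_fun (Qset T) (fun p => a p.1 * b p.2).
Proof. by move=> ta tb; rewrite QsetE; exact: test_prod. Qed.

End LocInt.
#[global] Hint Extern 0 (measurable (Qset _)) => exact: measurable_Qset : core.
#[global] Hint Extern 0 (measurable half_line) => exact: measurable_half_line : core.
#[global] Hint Extern 0 (measurable (time_int _)) => exact: measurable_time_int : core.

Section Fundamental.
Context {R : realType}.
Local Notation plane := (plane (R := R)).
Local Notation lm := (@lebesgue_measure R).

(** Products of bumps converge to the indicator function of the box, boundedly and
    inside one compact subset of Q. *)
Lemma fundamental_lemma_rect (sg : R -> R) (T : R) (f : R * R -> R) : is_step sg ->
  loc_int (Qset T) (Qset T) f ->
  (forall a b, test_fun1 half_line a -> test_fun1 (time_int T) b ->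
     \int[mu2]_(p in Qset T) (f p * (a p.1 * b p.2)) = 0) ->
  forall a b c d, 0 < a -> 0 < c -> d < T ->
    mu2.-integrable (`]a, b[ `*` `]c, d[ : set plane) (EFin \o f) /\
    (\int[mu2]_(p in `]a, b[ `*` `]c, d[) (f p)%:E = 0)%E.
Proof.
move=> isg lf H a b c d a0 c0 dT.
pose K : set (R * R) := `[a, b] `*` `[c, d].
pose Q : set plane := Qset T.
have mQ : measurable Q by exact: measurable_Qset.
pose rect : set plane := `]a, b[ `*` `]c, d[.
have cK : compact K by apply: compact_setX; exact: segment_compact.
have mK : measurable (K : set plane) by exact: compact_measurable2.
have KQ : K `<=` Qset T.
  move=> [x t] [/=]; rewrite !in_itv/= => /andP[x1 x2] /andP[t1 t2].
  by split=> /=; [lra|apply/andP; split; lra].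
have rectK : rect `<=` K.
  move=> [x t] [/=]; rewrite !in_itv/= => /andP[x1 x2] /andP[t1 t2].
  by split => /=; rewrite in_itv/=; apply/andP; split; lra.
have mrect : measurable rect by apply: measurable_rect; exact: measurable_itv.
have [mf fi] := lf.
have frect : mu2.-integrable rect (EFin \o f).
  apply: integrableS (fi K cK KQ) => //; first exact: measurableI.
  by move=> p rp; split; [apply: KQ; exact: rectK|exact: rectK].
split=> //.
have [u [tu u01 u0 ulim]] := bump_seq isg a b.
have [v [tv v01 v0 vlim]] := bump_seq isg c d.
have tu' n : test_fun1 half_line (u n).
  apply: test1S (tu n) => x; rewrite /half_line/= !in_itv/= andbT => /andP[x1 _]; lra.
have tv' n : test_fun1 (time_int T) (v n).
  apply: test1S (tv n) => x; rewrite /time_int/= !in_itv/= => /andP[x1 x2].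
  by apply/andP; split; lra.
have guv n (p : R * R) : ~ rect p -> u n p.1 * v n p.2 = 0.
  move=> /not_andP[/u0 ->|/v0 ->]; first by rewrite mul0r.
  by rewrite mulr0.
have [||||||_ clim] := @Rintegral_dct _ plane R mu2 Q
  (fun n p => f p * (u n p.1 * v n p.2)) (fun p => f p * \1_rect p)
  (fun p => `|f p| * \1_K p).
- exact: mQ.
- move=> n; apply: measurable_funM => //; apply: test_measurable.
  exact: (test_prodQ (tu' n) (tv' n)).
- by apply: measurable_funM => //; exact: measurable_indic.
- move=> p Qp; apply: cvgM; first exact: cvg_cst.
  have [rp|rp] := pselect (rect p).
    rewrite indicE mem_set// -[X in _ --> X](mulr1 (1 : R)).
    by case: rp => r1 r2; apply: cvgM; [exact: ulim|exact: vlim].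
  rewrite indicE memNset//; apply: cvg_near_cst; apply: nearW => n /=.
  exact: guv.
- apply: (@integrable_bump _ plane R mu2 Q K (fun p => `|f p|) \1_K 1) => //.
  + by apply: measurableT_comp.
  + by apply: integrable_norm; exact: fi.
  + by move=> p _; rewrite indicE; case: (_ \in _); rewrite ?normr1 ?normr0.
  + by move=> p _ Kp; rewrite indicE memNset.
- move=> n p Qp; rewrite normrM ler_wpM2l//.
  have [Kp|Kp] := pselect (K p).
    rewrite indicE mem_set//= normrM.
    have /andP[p1 p2] := u01 n p.1; have /andP[q1 q2] := v01 n p.2.
    by rewrite !ger0_norm// mulr_ile1.
  by rewrite guv ?normr0//; move/rectK.
move: clim; rewrite (_ : (fun n => _) = cst 0); last first.
  by apply/funext => n; exact: H.
move=> /(cvg_unique (@Rhausdorff R) (cvg_cst _))/esym.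
rewrite Rintegral_indic// setIidr; last by move=> p /rectK /KQ.
move=> h; have fin := integrable_fin_num mrect frect.
by rewrite -[LHS]fineK//; congr EFin; exact: h.
Qed.

Lemma itvooI (a b c d : R) :
  `]a, b[%classic `&` `]c, d[%classic = `]Num.max a c, Num.min b d[%classic.
Proof.
apply/seteqP; split=> x /=; rewrite !in_itv/= gt_max lt_min.
  by move=> [/andP[-> ->] /andP[-> ->]].
by move=> /andP[/andP[-> ->] /andP[-> ->]].
Qed.

(** Product test functions suffice because boxes generate the Borel sets; Q is
    exhausted by boxes on which [f] is integrable. *)
Lemma fundamental_lemma_Q (sg : R -> R) (T : R) (f : R * R -> R) : is_step sg ->
  loc_int (Qset T) (Qset T) f ->
  (forall a b, test_fun1 half_line a -> test_fun1 (time_int T) b ->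
     \int[mu2]_(p in Qset T) (f p * (a p.1 * b p.2)) = 0) ->
  {ae mu2, forall p, Qset T p -> f p = 0}.
Proof.
move=> isg lf H; have rect0 := fundamental_lemma_rect isg lf H.
pose e n : R := n.+1%:R^-1.
have e0 n : 0 < e n by rewrite /e invr_gt0.
pose D n : set plane := `]e n, n.+1%:R[ `*` `]e n, T - e n[.
have Dn n : {ae mu2, forall p, D n p -> (f p)%:E = cst 0%E p}.
  have [Dfi D0] := rect0 _ (n.+1%:R) _ (T - e n) (e0 n) (e0 n) (ltac:(rewrite gtrBl; exact: e0)).
  apply: (itvoo_rect_dynkin (D := D n) (f := EFin \o f)) => //.
  - by apply: measurable_rect; exact: measurable_itv.
  - move=> a b c d; rewrite /D -setXI !itvooI.
    apply: (rect0 _ _ _ _ _ _ _).2.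
    + by rewrite lt_max e0.
    + by rewrite lt_max e0.
    + by rewrite gt_min gtrBl e0.
  - move=> a b; rewrite /D -setXI setIT itvooI.
    apply: (rect0 _ _ _ _ _ _ _).2; [|exact: e0|by rewrite gtrBl].
    by rewrite lt_max e0.
  - move=> c d; rewrite /D -setXI setIT itvooI.
    apply: (rect0 _ _ _ _ _ _ _).2; first exact: e0.
      by rewrite lt_max e0.
    by rewrite gt_min gtrBl e0.
have := ae_foralln Dn; apply: filterS => -[x t] h [/= x0 /andP[t0 tT]].
have small (z : R) : 0 < z -> \forall n \near \oo, e n < z.
  by move=> z0; exact: (near_infty_natSinv_lt (PosNum z0)).
have [n [n1 n2 n3 n4]] : exists n, [/\ e n < x, e n < t, e n < T - t & x < n.+1%:R].
  near \oo => n; exists n; split.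
  - by near: n; exact: small.
  - by near: n; exact: small.
  - by near: n; apply: small; lra.
  - have : x < n%:R by near: n; exact: nbhs_infty_gtr.
    by move/lt_trans; apply; rewrite ltr_nat.
have : D n (x, t).
  by split=> /=; rewrite in_itv/=; apply/andP; split=> //; lra.
by move=> /(h n) [].
Unshelve. all: by end_near. Qed.

Lemma fundamental_lemma_itv (sg : R -> R) (f : R -> R) : is_step sg ->
  locally_integrable half_line f ->
  (forall a, test_fun1 half_line a ->
     \int[lm]_(x in half_line) (f x * a x) = 0) ->
  forall a b, 0 < a ->
    lm.-integrable `]a, b[ (EFin \o f) /\
    (\int[lm]_(x in `]a, b[) (f x)%:E = 0)%E.
Proof.
move=> isg lf H a b a0.
pose K : set R := `[a, b]%classic.
have cK : compact K by exact: segment_compact.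
have KH : K `<=` half_line.
  move=> x; rewrite /K /half_line /= !in_itv/= andbT => /andP[x1 x2]; lra.
have IK : `]a, b[%classic `<=` K.
  move=> x; rewrite /K /= !in_itv/= => /andP[x1 x2]; apply/andP; split; lra.
have [mf _ fi] := lf.
have mK : measurable (K : set (measurableTypeR R)) by exact: measurable_itv.
have mI : measurable (`]a, b[%classic : set (measurableTypeR R)) by exact: measurable_itv.
have fK : lm.-integrable K (EFin \o f).
  apply/integrableP; split; first by apply/measurable_EFinP; exact: measurable_funS mf.
  exact: fi.
have fI : lm.-integrable `]a, b[ (EFin \o f) by exact: integrableS fK.
split=> //.
have [u [tu u01 u0 ulim]] := bump_seq isg a b.
have tu' n : test_fun1 half_line (u n).
  by apply: test1S (tu n) => x /IK /KH.
have [||||||_ clim] := @Rintegral_dct _ (measurableTypeR R) R lm half_line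
  (fun n x => f x * u n x) (fun x => f x * \1_(`]a, b[%classic) x)
  (fun x => `|f x| * \1_K x).
- exact: measurable_half_line.
- move=> n; apply: measurable_funM => //; apply: smooth1_measurable.
  by have [] := tu n.
- by apply: measurable_funM => //; exact: measurable_indic.
- move=> x Qx; apply: cvgM; first exact: cvg_cst.
  have [rp|rp] := pselect (`]a, b[%classic x).
    by rewrite indicE mem_set//; exact: ulim.
  rewrite indicE memNset//; apply: cvg_near_cst; apply: nearW => n /=.
  exact: u0.
- apply: (@integrable_bump _ (measurableTypeR R) R lm half_line K (fun x => `|f x|) \1_K 1) => //.
  + by apply: measurableT_comp.
  + by apply: integrable_norm; rewrite setIidr.
  + by move=> p _; rewrite indicE; case: (_ \in _); rewrite ?normr1 ?normr0.
  + by move=> p _ Kp; rewrite indicE memNset.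
- move=> n x Qp; rewrite normrM ler_wpM2l//.
  have [Kp|Kp] := pselect (K x).
    rewrite indicE mem_set//=.
    by have /andP[p1 p2] := u01 n x; rewrite ger0_norm.
  by rewrite u0 ?normr0//; move/IK.
move: clim; rewrite (_ : (fun n => _) = cst 0); last first.
  by apply/funext => n; exact: H.
move=> /(cvg_unique (@Rhausdorff R) (cvg_cst _))/esym.
rewrite Rintegral_indic// setIidr; last by move=> p /IK /KH.
move=> h; have fin := integrable_fin_num mI fI.
by rewrite -[LHS]fineK//; congr EFin; exact: h.
Qed.

Lemma fundamental_lemma_half_line (sg : R -> R) (f : R -> R) : is_step sg ->
  locally_integrable half_line f ->
  (forall a, test_fun1 half_line a ->
     \int[lm]_(x in half_line) (f x * a x) = 0) ->
  {ae lm, forall x, half_line x -> f x = 0}.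
Proof.
move=> isg lf H; have itv0 := fundamental_lemma_itv isg lf H.
pose e n : R := n.+1%:R^-1.
have e0 n : 0 < e n by rewrite /e invr_gt0.
pose D n : set (measurableTypeR R) := `]e n, n.+1%:R[%classic.
have Dn n : {ae lm, forall p, D n p -> (f p)%:E = cst 0%E p}.
  have [Dfi D0] := itv0 _ (n.+1%:R) (e0 n).
  apply: (itvoo_dynkin (D := D n) (f := EFin \o f)) => //.
  - exact: measurable_itv.
  - by move=> a b; rewrite /D itvooI; apply: (itv0 _ _ _).2; rewrite lt_max e0.
have := ae_foralln Dn; apply: filterS => x h.
rewrite /half_line/= in_itv/= andbT => x0.
have [n [n1 n2]] : exists n, e n < x /\ x < n.+1%:R.
  near \oo => n; exists n; split.
  - by near: n; exact: (near_infty_natSinv_lt (PosNum x0)).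
  - have : x < n%:R by near: n; exact: nbhs_infty_gtr.
    by move/lt_trans; apply; rewrite ltr_nat.
have : D n x by rewrite /D/= in_itv/= n1 n2.
by move=> /(h n) [].
Unshelve. all: by end_near. Qed.

End Fundamental.

(** * Weak derivatives *)

Section Linearity.
Context d {T : measurableType d} {R : realType}.
Variable mu : {measure set T -> \bar R}.

Lemma integrable_lin (D : set T) (f g : T -> R) (a b : R) : measurable D ->
  mu.-integrable D (EFin \o f) -> mu.-integrable D (EFin \o g) ->
  mu.-integrable D (EFin \o (fun x => a * f x + b * g x)).
Proof.
move=> mD fi gi.
by have := integrableD mD (integrableZl mD a fi) (integrableZl mD b gi).
Qed.

Lemma Rintegral_lin (D : set T) (f g : T -> R) (a b : R) : measurable D ->
  mu.-integrable D (EFin \o f) -> mu.-integrable D (EFin \o g) ->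
  \int[mu]_(x in D) (a * f x + b * g x) =
  a * \int[mu]_(x in D) f x + b * \int[mu]_(x in D) g x.
Proof.
move=> mD fi gi.
have := integrableZl mD a fi; have := integrableZl mD b gi => gi' fi'.
by rewrite RintegralD// !RintegralZl.
Qed.

End Linearity.

Section WeakDeriv.
Context {R : realType} (T : R).
Local Notation plane := (plane (R := R)).
Local Notation lm := (@lebesgue_measure R).
Local Notation Q := (Qset T).
Implicit Types (v w u : R * R -> R).

Lemma wd_ae j k v v' w w' : is_weak_deriv Q j k v w ->
  measurable_fun (Q : set plane) v' -> measurable_fun (Q : set plane) w' ->
  {ae mu2, forall p, Q p -> v p = v' p} ->
  {ae mu2, forall p, Q p -> w p = w' p} -> is_weak_deriv Q j k v' w'.
Proof.
move=> [lv lw vw] mv' mw' vv' ww'; split.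
- exact: (loc_int_ae (measurable_Qset T) mv' vv' lv).
- exact: (loc_int_ae (measurable_Qset T) mw' ww' lw).
move=> eta te; have := vw _ te.
have mm (h h2 : R * R -> R) (th : test_fun Q h)
    (mh2 : measurable_fun (Q : set plane) (h2 : plane -> R)) :
    measurable_fun (Q : set plane) ((fun p => h2 p * h p) : plane -> R).
  by apply: measurable_funM => //; exact: test_measurable th.
have ti := test_iter j k te; have mQ := measurable_Qset T.
have mv : measurable_fun (Q : set plane) (v : plane -> R) by case: lv.
have mw : measurable_fun (Q : set plane) (w : plane -> R) by case: lw.
have c1 : {ae mu2, forall p, Q p ->
    v p * iter j dx (iter k dt eta) p = v' p * iter j dx (iter k dt eta) p}.
  by apply: aeS vv' => p h /h ->.
have c2 : {ae mu2, forall p, Q p -> w p * eta p = w' p * eta p}.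
  by apply: aeS ww' => p h /h ->.
rewrite (@Rintegral_ae_congr R _ plane mu2 Q _ _ mQ (mm _ _ ti mv) (mm _ _ ti mv') c1).
by rewrite (@Rintegral_ae_congr R _ plane mu2 Q _ _ mQ (mm _ _ te mw) (mm _ _ te mw') c2).
Qed.

Lemma wd_lin j k v1 v2 w1 w2 (a b : R) :
  is_weak_deriv Q j k v1 w1 -> is_weak_deriv Q j k v2 w2 ->
  is_weak_deriv Q j k (fun p => a * v1 p + b * v2 p) (fun p => a * w1 p + b * w2 p).
Proof.
move=> [lv1 lw1 h1] [lv2 lw2 h2]; split.
- by apply: loc_intD; [exact: measurable_Qset|exact: loc_intZ|exact: loc_intZ].
- by apply: loc_intD; [exact: measurable_Qset|exact: loc_intZ|exact: loc_intZ].
move=> eta te; have tie := test_iter j k te.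
have H := loc_int_test (measurable_Qset T).
have e1 f g h : (fun p : R * R => (a * f p + b * g p) * h p) =
    (fun p => a * (f p * h p) + b * (g p * h p)) :> (R * R -> R).
  by apply/funext => p; ring.
rewrite !e1 !Rintegral_lin//; try by apply: (H (Qset T)).
by rewrite h1// h2//; ring.
Qed.

Lemma wd_unique (sg : R -> R) j k v w1 w2 : is_step sg ->
  is_weak_deriv Q j k v w1 -> is_weak_deriv Q j k v w2 ->
  {ae mu2, forall p, Q p -> w1 p = w2 p}.
Proof.
move=> isg h1 h2; have [_ l12 H] := wd_lin 1 (-1) h1 h2.
have hP a b : test_fun1 half_line a -> test_fun1 (time_int T) b ->
    \int[mu2]_(p in Q) ((1 * w1 p + -1 * w2 p) * (a p.1 * b p.2)) = 0.
  move=> ta tb; have tab := test_prodQ ta tb.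
  have := H _ tab; rewrite (_ : (fun p => _) = cst 0); last first.
    by apply/funext => p /=; ring.
  rewrite Rintegral_cst// mul0r => /esym/eqP.
  by rewrite mulf_eq0 signr_eq0 => /eqP.
apply: aeS (fundamental_lemma_Q isg l12 hP) => p h /h /= h0.
by apply/eqP; rewrite -subr_eq0 -h0; apply/eqP; ring.
Qed.

Lemma wDP j k v : has_weak_deriv Q j k v -> is_weak_deriv Q j k v (wD Q j k v).
Proof. by move=> [w vw]; exact: (xgetPex (fun=> 0) (ex_intro _ w vw)). Qed.

Lemma has_wd_lin j k v1 v2 (a b : R) : has_weak_deriv Q j k v1 ->
  has_weak_deriv Q j k v2 -> has_weak_deriv Q j k (fun p => a * v1 p + b * v2 p).
Proof. by move=> [w1 h1] [w2 h2]; eexists; exact: wd_lin h1 h2. Qed.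

Lemma wD_unique (sg : R -> R) j k v w : is_step sg -> is_weak_deriv Q j k v w ->
  {ae mu2, forall p, Q p -> wD Q j k v p = w p}.
Proof. by move=> isg h; apply: (wd_unique isg _ h); apply: wDP; exists w. Qed.

Lemma wD_lin (sg : R -> R) j k v1 v2 (a b : R) : is_step sg -> has_weak_deriv Q j k v1 ->
  has_weak_deriv Q j k v2 -> {ae mu2, forall p, Q p ->
    wD Q j k (fun p => a * v1 p + b * v2 p) p = a * wD Q j k v1 p + b * wD Q j k v2 p}.
Proof.
by move=> isg h1 h2; exact: (wD_unique isg (wd_lin a b (wDP h1) (wDP h2))).
Qed.

Lemma wd_meas j k v w : is_weak_deriv Q j k v w -> measurable_fun (Q : set plane) w.
Proof. by move=> [_ []]. Qed.

Lemma wD_meas j k v : has_weak_deriv Q j k v ->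
  measurable_fun (Q : set plane) (wD Q j k v).
Proof. by move=> /wDP /wd_meas. Qed.

Lemma has_wd_meas j k v : has_weak_deriv Q j k v -> measurable_fun (Q : set plane) v.
Proof. by move=> [w [[]]]. Qed.

Lemma wd00 j k v w : is_weak_deriv Q j k v w -> is_weak_deriv Q 0 0 v v.
Proof. by move=> [lv _ _]; split=> // eta _; rewrite expr0 mul1r. Qed.

Lemma wD00 (sg : R -> R) v : is_step sg -> has_weak_deriv Q 0 0 v ->
  {ae mu2, forall p, Q p -> wD Q 0 0 v p = v p}.
Proof. by move=> isg [w h]; exact: (wD_unique isg (wd00 h)). Qed.

Lemma continuous_locbdd (h : R * R -> R) (D : set (R * R)) : continuous h ->
  forall K, compact K -> exists M : R, forall p, D p -> K p -> `|h p| <= M.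
Proof.
move=> ch K cK.
have [M [_ hM]] : bounded_set (h @` K).
  by apply: compact_bounded; apply: continuous_compact => //; exact: continuous_subspaceT.
by exists (M + 1) => p _ Kp; apply: hM; [rewrite ltrDl|exists p].
Qed.

Lemma loc_int_snd O v (a : R -> R) : loc_int Q O v -> smooth1 a ->
  loc_int Q O (fun p => a p.2 * v p).
Proof.
move=> lv sa; have ca : continuous (fun p : R * R => a p.2).
  exact: (Ck_cont (Ck_snd 0 sa)).
apply: (loc_intM (measurable_Qset T) lv (eta := fun p => a p.2)).
  by apply: measurable_funTS; exact: continuous_measurable2.
by move=> K cK _; exact: continuous_locbdd.
Qed.

(** A factor that depends on t alone commutes with [dx] and can be moved onto the
    test function. *)
Lemma wd_cut_x v w (a : R -> R) : smooth1 a -> is_weak_deriv Q 1 0 v w ->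
  is_weak_deriv Q 1 0 (Defs.cut a v) (Defs.cut a w).
Proof.
move=> sa [lv lw H]; split; [exact: loc_int_snd|exact: loc_int_snd|].
move=> eta te; have ta : test_fun Q (fun p => eta p * a p.2).
  by apply: testMr => // n; exact: Ck_snd.
have := H _ ta; rewrite /=.
have -> : dx (fun p => eta p * a p.2) = fun p => dx eta p * a p.2.
  apply/funext => -[x t]; rewrite !dxE /= derive1_mulf.
  - by rewrite derive1_constf mulr0 addr0.
  - exact: (@test_derx _ _ _ (x, t) te).
  - exact: (derivable_cstE (a t) x).
move=> h; rewrite /Defs.cut.
rewrite (_ : (fun p => _) = (fun p => v p * (dx eta p * a p.2))); last first.
  by apply/funext => p; ring.
rewrite h; congr (_ * _); apply: eq_Rintegral => p _; ring.
Qed.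

Lemma wd_cut_t v w (a : R -> R) : smooth1 a -> is_weak_deriv Q 0 1 v w ->
  is_weak_deriv Q 0 1 (Defs.cut a v) (fun p => a p.2 * w p + derive1 a p.2 * v p).
Proof.
move=> sa [lv lw H]; have sa' := smooth1_derive sa.
split; first exact: loc_int_snd.
  by apply: loc_intD => //; exact: loc_int_snd.
move=> eta te; have ta : test_fun Q (fun p => eta p * a p.2).
  by apply: testMr => // n; exact: Ck_snd.
have ta' : test_fun Q (fun p => eta p * derive1 a p.2).
  by apply: testMr => // n; exact: Ck_snd.
have := H _ ta; rewrite /=.
have dE : dt (fun p => eta p * a p.2) =
    fun p => dt eta p * a p.2 + eta p * derive1 a p.2.
  apply/funext => -[x t]; rewrite !dtE /= derive1_mulf//.
  - exact: (@test_dert _ _ _ (x, t) te).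
  - exact: smooth1_derivable.
have Ii := loc_int_test (measurable_Qset T).
have -> : (fun p => v p * dt (fun p => eta p * a p.2) p) =
   fun p => 1 * (Defs.cut a v p * dt eta p) + 1 * (v p * (eta p * derive1 a p.2)).
  by rewrite dE; apply/funext => p; rewrite /Defs.cut; ring.
have i1 : mu2.-integrable (Q : set plane) (EFin \o (fun p => Defs.cut a v p * dt eta p)).
  by apply: (Ii (Qset T)); [exact: loc_int_snd|exact: test_dt].
have i2 := Ii _ _ _ lv ta'.
rewrite Rintegral_lin//.
have -> : (fun p => (a p.2 * w p + derive1 a p.2 * v p) * eta p) =
   fun p => 1 * (w p * (eta p * a p.2)) + 1 * (v p * (eta p * derive1 a p.2)).
  by apply/funext => p; ring.
rewrite Rintegral_lin//; last exact: (Ii _ _ _ lw ta).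
rewrite !expr1 => h; lra.
Qed.

End WeakDeriv.

(** * Iterated integrals and the Cauchy-Schwarz inequality *)

Section FubiniPlane.
Context {R : realType}.
Local Notation plane := (plane (R := R)).
Local Notation lm := (@lebesgue_measure R).
Variables (A B : set (measurableTypeR R)).
Hypotheses (mA : measurable A) (mB : measurable B).

Let mAB : measurable (A `*` B : set plane).
Proof. exact: measurable_rect. Qed.

Lemma patch_sectionE (G : R * R -> \bar R) :
  (fun x => \int[lm]_t (G \_ (A `*` B)) (x, t))%E =
  (fun x => \int[lm]_(t in B) G (x, t))%E \_ A.
Proof.
apply/funext => x; rewrite [RHS]patchE; case: ifPn => xA.
  rewrite [RHS]integral_mkcond; apply: eq_integral => t _.
  rewrite !patchE; case: ifPn => [|h].
    by rewrite inE => -[_ tB]; rewrite mem_set.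
  case: ifPn => // tB; exfalso; move/negP: h; apply.
  by rewrite inE; split; [exact/set_mem|exact/set_mem].
apply: integral0_eq => t _; rewrite patchE ifN//.
by apply: contra xA; rewrite !inE => -[].
Qed.

Lemma ge0_section_measurable (G : R * R -> \bar R) :
  measurable_fun (A `*` B : set plane) (G : plane -> \bar R) ->
  (forall p, (A `*` B) p -> (0 <= G p)%E) ->
  measurable_fun A (fun x => \int[lm]_(t in B) G (x, t))%E.
Proof.
move=> mG G0; apply/(measurable_restrictT _ mA); rewrite -patch_sectionE.
apply: (@measurable_fun_fubini_tonelli_F _ _ (measurableTypeR R) (measurableTypeR R) R lm
  (G \_ (A `*` B))).
  by apply/(measurable_restrictT _ mAB).
by move=> p; rewrite patchE; case: ifPn => //; rewrite inE; exact: G0.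
Qed.

Lemma tonelli_plane (G : R * R -> \bar R) :
  measurable_fun (A `*` B : set plane) (G : plane -> \bar R) ->
  (forall p, (A `*` B) p -> (0 <= G p)%E) ->
  (\int[mu2]_(p in A `*` B) G p =
   \int[lm]_(x in A) \int[lm]_(t in B) G (x, t))%E.
Proof.
move=> mG G0; rewrite integral_mkcond [RHS]integral_mkcond -patch_sectionE.
apply: (@fubini_tonelli1 _ _ (measurableTypeR R) (measurableTypeR R) R lm lm
  (G \_ (A `*` B))).
  by apply/(measurable_restrictT _ mAB).
by move=> p; rewrite patchE; case: ifPn => //; rewrite inE; exact: G0.
Qed.

Lemma section_measurable (G : R * R -> R) (x : R) : A x ->
  measurable_fun (A `*` B : set plane) (G : plane -> R) ->
  measurable_fun B ((fun t => G (x, t)) : measurableTypeR R -> R).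
Proof.
move=> Ax mG; have mG' := (measurable_restrictT _ mAB).1 mG.
apply/(measurable_restrictT _ mB).
have -> : (fun t => G (x, t)) \_ B = (G \_ (A `*` B)) \o (fun t => (x, t)).
  apply/funext => t /=; rewrite !patchE; case: ifPn => tB.
    by rewrite ifT// inE; split=> //; exact/set_mem.
  by rewrite ifN//; apply: contra tB; rewrite !inE => -[].
apply: (@measurableT_comp _ _ _ _ plane _ (G \_ (A `*` B)) _ (fun t => (x, t))) => //.
exact: pair1_measurable.
Qed.

Lemma Rsection_measurable (G : R * R -> R) :
  measurable_fun (A `*` B : set plane) (G : plane -> R) ->
  measurable_fun A (fun x => \int[lm]_(t in B) G (x, t)).
Proof.
move=> mG; have mE : measurable_fun (A `*` B : set plane) (EFin \o G).
  exact/measurable_EFinP.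
apply: (@measurableT_comp _ _ _ _ _ _ fine) => //.
rewrite (_ : (fun x => _) = (fun x => \int[lm]_(t in B) (EFin \o G)^\+%E (x, t) -
   \int[lm]_(t in B) (EFin \o G)^\-%E (x, t))%E); last first.
  apply/funext => x; rewrite [LHS]integralE; congr (_ - _)%E.
    by apply: eq_integral => t _; rewrite !funeposE.
  by apply: eq_integral => t _; rewrite !funenegE.
apply: emeasurable_funB; apply: ge0_section_measurable => //.
- exact: measurable_funepos.
- exact: measurable_funeneg.
Qed.

Lemma Rfubini (G : R * R -> R) : mu2.-integrable (A `*` B : set plane) (EFin \o G) ->
  [/\ \int[mu2]_(p in A `*` B) G p = \int[lm]_(x in A) \int[lm]_(t in B) G (x, t),
      lm.-integrable A (EFin \o (fun x => \int[lm]_(t in B) G (x, t))) &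
      {ae lm, forall x, A x -> lm.-integrable B (fun t => (G (x, t))%:E)}].
Proof.
move=> Gi; have gi := (@integrable_mkcond _ plane R mu2 (A `*` B) (EFin \o G) mAB).1 Gi.
pose S x := (\int[lm]_(t in B) (G (x, t))%:E)%E.
have Si : lm.-integrable A S.
  apply/(integrable_mkcond _ mA); rewrite -(patch_sectionE (EFin \o G)).
  exact: (@integrable_fubini_F _ _ (measurableTypeR R) (measurableTypeR R) R lm lm _ gi).
have S12 : (\int[mu2]_(p in A `*` B) (G p)%:E = \int[lm]_(x in A) S x)%E.
  rewrite integral_mkcond [RHS]integral_mkcond -(patch_sectionE (EFin \o G)).
  exact/esym/(@integral12_prod_meas1 _ _ (measurableTypeR R) (measurableTypeR R) R lm lm _ gi).
have Sfin : {ae lm, forall x, A x -> S x \is a fin_num} by exact: integrable_ae Si.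
have mG : measurable_fun (A `*` B : set plane) (G : plane -> R).
  by apply/measurable_EFinP; exact: measurable_int Gi.
have mR := Rsection_measurable mG.
have SE : {ae lm, forall x, A x -> S x = (EFin \o (fun x => \int[lm]_(t in B) G (x, t))) x}.
  by apply: filterS Sfin => x h Ax /=; rewrite fineK//; exact: h.
split.
- rewrite /Rintegral S12; congr fine; apply: ae_eq_integral => //.
    exact: measurable_int Si.
  exact/measurable_EFinP.
- apply/integrableP; split; first exact/measurable_EFinP.
  have /integrableP[mS] := Si; congr (_ < _)%E.
  apply: ge0_ae_eq_integral => //.
  + exact: measurableT_comp.
  + by apply: measurableT_comp => //; exact/measurable_EFinP.
  + by apply: filterS SE => x h /h /= ->.
- have := @ae_integrable1 _ _ (measurableTypeR R) (measurableTypeR R) R lm lm _ gi.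
  apply: filterS => x h Ax; apply/(integrable_mkcond _ mB).
  congr (integrable _ _ _): h; apply/funext => t.
  rewrite !patchE; case: ifPn => [|tAB].
    by rewrite inE => -[_ tB]; rewrite mem_set.
  case: ifPn => // tB; exfalso; move/negP: tAB; apply.
  by rewrite inE; split=> //; exact/set_mem.
Qed.

(** Where [a x != 0] the section of [F] is integrable because that of [F * a] is;
    where [a x = 0] both sides vanish, although the section of [F] need not be
    integrable. *)
Lemma Rfubini_sep (F : R * R -> R) (a : R -> R) :
  measurable_fun (A `*` B : set plane) (F : plane -> R) ->
  measurable_fun A (a : measurableTypeR R -> R) ->
  mu2.-integrable (A `*` B : set plane) (EFin \o (fun p => F p * a p.1)) ->
  \int[mu2]_(p in A `*` B) (F p * a p.1) =
  \int[lm]_(x in A) ((\int[lm]_(t in B) F (x, t)) * a x).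
Proof.
move=> mF ma Gi; have [-> /measurable_int/measurable_EFinP mS si] := Rfubini Gi.
apply: Rintegral_ae_congr => //.
  by apply: measurable_funM => //; exact: Rsection_measurable.
apply: filterS si => x h Ax /=; have [a0|a0] := eqVneq (a x) 0.
  rewrite a0 mulr0 (_ : (fun t => _) = cst 0); last first.
    by apply/funext => t /=; rewrite mulr0.
  by rewrite Rintegral_cst// mul0r.
rewrite -RintegralZr//.
have := integrableZr mB (a x)^-1 (h Ax).
congr (integrable _ _ _); apply/funext => t /=.
by rewrite -EFinM -mulrA divff// mulr1.
Qed.

End FubiniPlane.

Section CauchySchwarz.
Context {R : realType}.
Local Notation lm := (@lebesgue_measure R).

(** The variance of [g] on (0, T) is nonnegative. *)
Lemma sqr_Rintegral_le (T : R) (g : R -> R) : 0 < T ->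
  measurable_fun (time_int T) (g : measurableTypeR R -> R) ->
  (((\int[lm]_(t in time_int T) g t) ^+ 2)%:E <=
   T%:E * \int[lm]_(t in time_int T) (g t ^+ 2)%:E)%E.
Proof.
move=> T0 mg; set B : set (measurableTypeR R) := time_int T.
have mB : measurable B by exact: measurable_time_int.
have lB : lm B = T%:E.
  rewrite /B /time_int lebesgue_measure_itv/= lte_fin T0 -EFinD subr0//.
have mg2 : measurable_fun B ((fun t => g t ^+ 2) : measurableTypeR R -> R).
  exact: measurable_funX.
have g20 : (0 <= \int[lm]_(t in B) (g t ^+ 2)%:E)%E.
  by apply: integral_ge0 => t _; rewrite lee_fin sqr_ge0.
have [->|gfin] := eqVneq (\int[lm]_(t in B) (g t ^+ 2)%:E)%E +oo%E.
  by rewrite gt0_muley ?leey// lte_fin.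
have i2 : lm.-integrable B (EFin \o (fun t => g t ^+ 2)).
  apply/integrableP; split; first exact/measurable_EFinP.
  rewrite [ltLHS](_ : _ = (\int[lm]_(t in B) (g t ^+ 2)%:E)%E); first by rewrite ltey.
  by apply: eq_integral => t _ /=; rewrite ger0_norm ?sqr_ge0.
have icst (k : R) : lm.-integrable B (EFin \o cst k).
  apply: measurable_bounded_integrable => //.
    by have : (lm B < +oo)%E by rewrite lB ltry.
  by exists `|k|; split; [exact: num_real|move=> M kM t _ /=; exact: ltW].
have i1 : lm.-integrable B (EFin \o g).
  apply: (le_integrable mB (f := EFin \o g)) (integrable_lin 1 1 mB (icst 1) i2).
    exact/measurable_EFinP.
  move=> t _ /=; rewrite lee_fin [leRHS]ger0_norm; last first.
    by rewrite addr_ge0// mul1r ?sqr_ge0.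
  rewrite !mul1r -(real_normK (num_real (g t))).
  by have := sqr_ge0 (`|g t| - 1); have := normr_ge0 (g t); nra.
set y := \int[lm]_(t in B) g t; set I := \int[lm]_(t in B) (g t ^+ 2).
have IE : (\int[lm]_(t in B) (g t ^+ 2)%:E = I%:E)%E.
  by rewrite /I /Rintegral fineK// ge0_fin_numE// ltey.
rewrite IE -EFinM lee_fin.
have : 0 <= \int[lm]_(t in B) ((g t - y / T) ^+ 2).
  by apply: Rintegral_ge0 => t _; exact: sqr_ge0.
rewrite (_ : (fun t => _) = (fun t => 1 * (g t ^+ 2) + 1 * ((- 2 * (y / T)) * g t + (y / T) ^+ 2 * cst 1 t))); last first.
  by apply/funext => t /=; ring.
rewrite Rintegral_lin//; last exact: integrable_lin.
rewrite Rintegral_lin// Rintegral_cst//.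
have -> : fine ((lm : {measure set (measurableTypeR R) -> \bar R}) B) = T by rewrite [X in fine X]lB.
rewrite -/y -/I.
have -> : 1 * I + 1 * (- 2 * (y / T) * y + (y / T) ^+ 2 * (1 * T)) = I - y ^+ 2 / T.
  by field; rewrite gt_eqF.
by rewrite subr_ge0 ler_pdivrMr// mulrC.
Qed.

End CauchySchwarz.

(** * Linearity and uniqueness of traces *)

Section Traces.
Context {R : realType} (T : R).
Local Notation plane := (plane (R := R)).
Local Notation lm := (@lebesgue_measure R).
Local Notation Q := (Qset T).
Implicit Types (v w u eta : R * R -> R).

(** Green's formula on either side of Q: [der] is the derivative normal to the
    side, and [iota] parametrizes the side by [L]. *)
Definition green (O : set (R * R)) (der : (R * R -> R) -> R * R -> R)
    (L : set R) (iota : R -> R * R) (v w : R * R -> R) (p : R -> R) :=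
  forall eta, test_fun O eta ->
    \int[mu2]_(q in Q) (w q * eta q + v q * der eta q) =
    - \int[lm]_(x in L) (p x * eta (iota x)).

Lemma green_lin O der (L : set (measurableTypeR R)) iota v1 v2 w1 w2 p1 p2 (a b : R) :
  measurable L ->
  (forall eta, test_fun O eta -> test_fun O (der eta)) ->
  (forall p eta, locally_integrable L p -> test_fun O eta ->
     lm.-integrable L (EFin \o (fun x => p x * eta (iota x)))) ->
  loc_int Q O v1 -> loc_int Q O v2 -> loc_int Q O w1 -> loc_int Q O w2 ->
  locally_integrable L p1 -> locally_integrable L p2 ->
  green O der L iota v1 w1 p1 -> green O der L iota v2 w2 p2 ->
  green O der L iota (fun q => a * v1 q + b * v2 q) (fun q => a * w1 q + b * w2 q)
    (fun x => a * p1 x + b * p2 x).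
Proof.
move=> mL td tL lv1 lv2 lw1 lw2 lp1 lp2 g1 g2 eta te.
have ti := loc_int_test (measurable_Qset T).
have ii v w : loc_int Q O v -> loc_int Q O w ->
    mu2.-integrable (Q : set plane) (EFin \o (fun q => w q * eta q + v q * der eta q)).
  move=> lv lw.
  have := integrable_lin 1 1 (measurable_Qset T) (ti _ _ _ lw te) (ti _ _ _ lv (td _ te)).
  by congr (integrable _ _ _); apply/funext => q /=; rewrite !mul1r.
rewrite (_ : (fun q => _) = (fun q =>
   a * (w1 q * eta q + v1 q * der eta q) + b * (w2 q * eta q + v2 q * der eta q))); last first.
  by apply/funext => q; ring.
rewrite Rintegral_lin//; [|exact: ii|exact: ii].
rewrite g1// g2//.
rewrite [in RHS](_ : (fun x => _) = (fun x =>
   a * (p1 x * eta (iota x)) + b * (p2 x * eta (iota x)))); last first.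
  by apply/funext => q; ring.
rewrite Rintegral_lin//; [ring|exact: tL|exact: tL].
Qed.

Lemma trace_x0_test (p : R -> R) eta : locally_integrable (time_int T) p ->
  test_fun (Olat T) eta -> lm.-integrable (time_int T) (EFin \o (fun t => p t * eta (0, t))).
Proof.
move=> lp te; have [M M0 eM] := test_bounded te; have [_ [K [cK KO e0]]] := te.
apply: (locally_integrable_integrable (M := M) (K := snd @` (K `&` [set q | q.1 = 0])) lp).
- apply: continuous_compact; first by apply: continuous_subspaceT => q; exact: cvg_snd.
  apply: compact_closedI => //.
  apply: (@preimage_closed _ _ (fst : R * R -> R) [set 0]); last exact: closed_eq.
  by move=> q _; exact: cvg_fst.
- by move=> _ [[x t] [/KO Kq _] <-]; rewrite /time_int/= in_itv.
- apply: measurable_funTS; apply: continuous_measurable_fun => t.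
  have ht : (0 : R, u) @[u --> t] --> (0 : R, t).
    by apply: (@cvg_pair _ _ _ _ (nbhs (0 : R)) (nbhs t)); [exact: cvg_cst|exact: cvg_id].
  have ce : continuous eta := test_cont te.
  exact: (cvg_comp _ eta ht (ce (0, t))).
- by move=> t _; exact: eM.
- move=> t _ nK; apply: e0 => Kq; apply: nK; by exists (0, t).
Qed.

Lemma trace_t0_cont eta O : test_fun O eta -> continuous (fun x : R => eta (x, 0)).
Proof.
move=> te x.
have ht : (u, 0 : R) @[u --> x] --> (x, 0 : R).
  by apply: (@cvg_pair _ _ _ _ (nbhs x) (nbhs (0 : R))); [exact: cvg_id|exact: cvg_cst].
have ce : continuous eta := test_cont te.
exact: (cvg_comp _ eta ht (ce (x, 0))).
Qed.

Lemma trace_t0_test (p : R -> R) eta : locally_integrable half_line p ->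
  test_fun (Obot T) eta -> lm.-integrable half_line (EFin \o (fun x => p x * eta (x, 0))).
Proof.
move=> lp te; have [M M0 eM] := test_bounded te; have [_ [K [cK KO e0]]] := te.
apply: (locally_integrable_integrable (M := M) (K := fst @` (K `&` [set q | q.2 = 0])) lp).
- apply: continuous_compact; first by apply: continuous_subspaceT => q; exact: cvg_fst.
  apply: compact_closedI => //.
  apply: (@preimage_closed _ _ (snd : R * R -> R) [set 0]); last exact: closed_eq.
  by move=> q _; exact: cvg_snd.
- by move=> _ [[x t] [/KO [Kq _] _] <-]; rewrite /half_line/= in_itv/= andbT.
- apply: measurable_funTS; apply: continuous_measurable_fun.
  exact: trace_t0_cont te.
- by move=> t _; exact: eM.
- move=> t _ nK; apply: e0 => Kq; apply: nK; by exists (t, 0).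
Qed.

Lemma Q_Obot : Q `<=` Obot T.
Proof. by move=> [x t] [x0 /andP[t0 tT]]. Qed.

Lemma locally_integrable_lin (L : set R) (p1 p2 : R -> R) (a b : R) :
  locally_integrable L p1 -> locally_integrable L p2 ->
  locally_integrable L (fun x => a * p1 x + b * p2 x).
Proof.
move=> [m1 oL i1] [m2 _ i2].
have mL : measurable (L : set (measurableTypeR R)) by exact: open_measurable.
split=> //.
  by apply: measurable_funD; apply: measurable_funM.
move=> K KL cK; have mK : measurable (K : set (measurableTypeR R)).
  exact: compact_measurable.
have ii p : measurable_fun (L : set (measurableTypeR R)) (p : measurableTypeR R -> R) ->
    (\int[lm]_(x in K) `|p x|%:E < +oo)%E -> lm.-integrable K (EFin \o p).
  move=> mp fp; apply/integrableP; split => //.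
  by apply/measurable_EFinP; apply: measurable_funS mp.
by have /integrableP[] := integrable_lin a b mK (ii _ m1 (i1 K KL cK)) (ii _ m2 (i2 K KL cK)).
Qed.

Lemma is_trace_x0_lin v1 v2 h1 h2 (a b : R) :
  is_trace_x0 T v1 h1 -> is_trace_x0 T v2 h2 ->
  is_trace_x0 T (fun q => a * v1 q + b * v2 q) (fun t => a * h1 t + b * h2 t).
Proof.
move=> [lh1 lv1 [w1 [d1 lw1 g1]]] [lh2 lv2 [w2 [d2 lw2 g2]]].
split; first exact: locally_integrable_lin.
  by apply: loc_intD; [exact: measurable_Qset|exact: loc_intZ|exact: loc_intZ].
exists (fun q => a * w1 q + b * w2 q); split; first exact: wd_lin.
  by apply: loc_intD; [exact: measurable_Qset|exact: loc_intZ|exact: loc_intZ].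
apply: (@green_lin (Olat T) dx (time_int T) (fun t => (0, t)) v1 v2 w1 w2 h1 h2 a b) => //.
- by move=> eta; exact: test_dx.
- exact: trace_x0_test.
Qed.

Lemma is_trace_t0_lin v1 v2 h1 h2 (a b : R) :
  is_trace_t0 T v1 h1 -> is_trace_t0 T v2 h2 ->
  is_trace_t0 T (fun q => a * v1 q + b * v2 q) (fun t => a * h1 t + b * h2 t).
Proof.
move=> [lh1 lv1 [w1 [d1 lw1 g1]]] [lh2 lv2 [w2 [d2 lw2 g2]]].
split; first exact: locally_integrable_lin.
  by apply: loc_intD; [exact: measurable_Qset|exact: loc_intZ|exact: loc_intZ].
exists (fun q => a * w1 q + b * w2 q); split; first exact: wd_lin.
  by apply: loc_intD; [exact: measurable_Qset|exact: loc_intZ|exact: loc_intZ].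
apply: (@green_lin (Obot T) dt half_line (fun x => (x, 0)) v1 v2 w1 w2 h1 h2 a b) => //.
- by move=> eta; exact: test_dt.
- exact: trace_t0_test.
Qed.

Lemma green_ae O der L iota v v' w p :
  (forall eta, test_fun O eta -> test_fun O (der eta)) ->
  measurable_fun (Q : set plane) (v : plane -> R) ->
  measurable_fun (Q : set plane) (v' : plane -> R) ->
  measurable_fun (Q : set plane) (w : plane -> R) ->
  {ae mu2, forall q, Q q -> v q = v' q} ->
  green O der L iota v w p -> green O der L iota v' w p.
Proof.
move=> td mv mv' mw vv' g eta te; rewrite -g//.
have mm (u : R * R -> R) (mu : measurable_fun (Q : set plane) (u : plane -> R)) :
    measurable_fun (Q : set plane) ((fun q => w q * eta q + u q * der eta q) : plane -> R).
  apply: measurable_funD; apply: measurable_funM => //; first exact: test_measurable te.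
  exact: test_measurable (td _ te).
apply: (@Rintegral_ae_congr R _ plane mu2 Q _ _ (measurable_Qset T) (mm _ mv') (mm _ mv)).
by apply: aeS vv' => q h /h ->.
Qed.

Lemma is_trace_x0_ae v v' h : measurable_fun (Q : set plane) (v' : plane -> R) ->
  {ae mu2, forall q, Q q -> v q = v' q} -> is_trace_x0 T v h -> is_trace_x0 T v' h.
Proof.
move=> mv' vv' [lh lv [w [d lw g]]]; split=> //.
  exact: (loc_int_ae (measurable_Qset T) mv' vv' lv).
exists w; split=> //.
  apply: wd_ae d _ _ vv' _ => //; first by case: lw.
  by apply: aeW.
apply: (@green_ae (Olat T) dx (time_int T) (fun t => (0, t)) v v' w h) => //.
- by move=> eta; exact: test_dx.
- by case: lv.
- by case: lw.
Qed.

Lemma is_trace_t0_ae v v' h : measurable_fun (Q : set plane) (v' : plane -> R) ->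
  {ae mu2, forall q, Q q -> v q = v' q} -> is_trace_t0 T v h -> is_trace_t0 T v' h.
Proof.
move=> mv' vv' [lh lv [w [d lw g]]]; split=> //.
  exact: (loc_int_ae (measurable_Qset T) mv' vv' lv).
exists w; split=> //.
  apply: wd_ae d _ _ vv' _ => //; first by case: lw.
  by apply: aeW.
apply: (@green_ae (Obot T) dt half_line (fun x => (x, 0)) v v' w h) => //.
- by move=> eta; exact: test_dt.
- by case: lv.
- by case: lw.
Qed.

Lemma test_bottom (a zeta : R -> R) : test_fun1 half_line a ->
  test_fun1 [set t | t < T] zeta -> test_fun (Obot T) (fun p => a p.1 * zeta p.2).
Proof.
move=> ta tz; apply: testS (test_prod ta tz) => -[x t] [/= x0 t0]; split=> //=.
by move: x0; rewrite /half_line/= in_itv/= andbT.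
Qed.

(** Test functions [a x * zeta t] with [zeta 0 = 1] turn Green's formula into the
    pairing of the trace with an arbitrary [a]. *)
Lemma is_trace_t0_unique (sg : R -> R) v p1 p2 : is_step sg -> 0 < T ->
  is_trace_t0 T v p1 -> is_trace_t0 T v p2 ->
  {ae lm, forall x, half_line x -> p1 x = p2 x}.
Proof.
move=> isg T0 [lp1 lv [w1 [d1 lw1 g1]]] [lp2 _ [w2 [d2 lw2 g2]]].
have ww := wd_unique isg d1 d2.
have [zeta tz z1] := plateau_exists isg T0.
have z0 : zeta 0 = 1 by apply: z1; rewrite lerN10/= divr_ge0// ltW.
have lp := locally_integrable_lin 1 (-1) lp1 lp2.
suff H a : test_fun1 half_line a ->
    \int[lm]_(x in half_line) ((1 * p1 x + -1 * p2 x) * a x) = 0.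
  apply: ae1S (fundamental_lemma_half_line isg lp H) => x h /h /= h0.
  by apply/eqP; rewrite -subr_eq0 -h0; apply/eqP; ring.
move=> ta; have te := test_bottom ta tz.
have mv : measurable_fun (Q : set plane) (v : plane -> R) by case: lv.
have mm (w : R * R -> R) (mw : measurable_fun (Q : set plane) (w : plane -> R)) :
    measurable_fun (Q : set plane) ((fun q => w q * (a q.1 * zeta q.2)
      + v q * dt (fun p => a p.1 * zeta p.2) q) : plane -> R).
  apply: measurable_funD; apply: measurable_funM => //; first exact: test_measurable te.
  exact: test_measurable (test_dt te).
have mw1 : measurable_fun (Q : set plane) (w1 : plane -> R) by case: lw1.
have mw2 : measurable_fun (Q : set plane) (w2 : plane -> R) by case: lw2.
have ee : {ae mu2, forall q, Q q -> w1 q * (a q.1 * zeta q.2)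
      + v q * dt (fun p => a p.1 * zeta p.2) q = w2 q * (a q.1 * zeta q.2)
      + v q * dt (fun p => a p.1 * zeta p.2) q}.
  by apply: aeS ww => q h /h ->.
have := @Rintegral_ae_congr R _ plane mu2 Q _ _ (measurable_Qset T) (mm _ mw1) (mm _ mw2) ee.
rewrite (g1 _ te) (g2 _ te) /= z0.
rewrite (_ : (fun x => (1 * p1 x + -1 * p2 x) * a x) =
  (fun x => 1 * (p1 x * (a x * 1)) + -1 * (p2 x * (a x * 1)))); last first.
  by apply/funext => x; ring.
have ea : (fun x => a x * 1) = a by apply/funext => x; rewrite mulr1.
have ii p : locally_integrable half_line p ->
    lm.-integrable half_line (EFin \o (fun x => p x * (a x * 1))).
  move=> lp'; have := locally_integrable_test lp' ta.
  by congr (integrable _ _ _); apply/funext => x /=; rewrite mulr1.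
rewrite Rintegral_lin//; [|exact: ii|exact: ii].
lra.
Qed.

Lemma trace_t0P v p : is_trace_t0 T v p -> is_trace_t0 T v (trace_t0 T v).
Proof. by move=> h; exact: (xgetPex (fun=> 0) (ex_intro _ p h)). Qed.

End Traces.

Section WeakDeriv1.
Context {R : realType}.
Local Notation lm := (@lebesgue_measure R).

Lemma wd1_ae (p p' q : R -> R) : is_weak_deriv1 p q ->
  locally_integrable half_line p' ->
  {ae lm, forall x, half_line x -> p x = p' x} -> is_weak_deriv1 p' q.
Proof.
move=> [lp lq H] lp' pp'; split=> // eta te; rewrite -H//.
have mm (u : R -> R) (lu : locally_integrable half_line u) :
    measurable_fun half_line ((fun x => u x * derive1 eta x) : measurableTypeR R -> R).
  case: lu => mu _ _; apply: measurable_funM => //; apply: smooth1_measurable.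
  by apply: smooth1_derive; case: te.
apply: (@Rintegral_ae_congr R _ (measurableTypeR R) lm half_line _ _ measurable_half_line (mm _ lp') (mm _ lp)).
by apply: ae1S pp' => x h /h ->.
Qed.

Lemma wd1_lin (p1 p2 q1 q2 : R -> R) (a b : R) :
  is_weak_deriv1 p1 q1 -> is_weak_deriv1 p2 q2 ->
  is_weak_deriv1 (fun x => a * p1 x + b * p2 x) (fun x => a * q1 x + b * q2 x).
Proof.
move=> [lp1 lq1 H1] [lp2 lq2 H2]; split.
- exact: locally_integrable_lin.
- exact: locally_integrable_lin.
move=> eta te; have te' := test1_derive te.
rewrite (_ : (fun x => (a * p1 x + b * p2 x) * derive1 eta x) =
  (fun x => a * (p1 x * derive1 eta x) + b * (p2 x * derive1 eta x))); last first.
  by apply/funext => x; ring.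
rewrite (_ : (fun x => (a * q1 x + b * q2 x) * eta x) =
  (fun x => a * (q1 x * eta x) + b * (q2 x * eta x))); last first.
  by apply/funext => x; ring.
rewrite !Rintegral_lin//; try exact: locally_integrable_test.
by rewrite H1// H2//; ring.
Qed.

Lemma wd1_unique (sg : R -> R) (p q1 q2 : R -> R) : is_step sg ->
  is_weak_deriv1 p q1 -> is_weak_deriv1 p q2 ->
  {ae lm, forall x, half_line x -> q1 x = q2 x}.
Proof.
move=> isg h1 h2; have [_ l12 H] := wd1_lin 1 (-1) h1 h2.
apply: ae1S (fundamental_lemma_half_line isg l12 _) => [x h /h /= h0|a ta].
  by apply/eqP; rewrite -subr_eq0 -h0; apply/eqP; ring.
have := H _ ta; rewrite (_ : (fun p => _) = cst 0); last first.
  by apply/funext => x /=; ring.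
by rewrite Rintegral_cst// mul0r => /esym/eqP; rewrite oppr_eq0 => /eqP.
Qed.

Lemma wD1P (p q : R -> R) : is_weak_deriv1 p q -> is_weak_deriv1 p (wD1 p).
Proof. by move=> h; exact: (xgetPex (fun=> 0) (ex_intro _ q h)). Qed.

End WeakDeriv1.

(** * Integration by parts up to the bottom side *)

Section BottomCutoff.
Context {R : realType} (sg : R -> R) (isg : is_step sg).

Let ssg : smooth1 sg. Proof. by case: isg. Qed.

Lemma dstep_out y : y < 0 \/ 1 < y -> derive1 sg y = 0.
Proof.
have [_ _ sg0 sg1] := isg; case=> hy.
  rewrite -(@derive1_constf R 0 y) !derive1E; apply: near_eq_derive.
  by near=> z; apply: sg0; apply/ltW; near: z; exact: lt_nbhsl.
rewrite -(@derive1_constf R 1 y) !derive1E; apply: near_eq_derive.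
by near=> z; apply: sg1; apply/ltW; near: z; exact: lt_nbhsr.
Unshelve. all: by end_near. Qed.

Lemma dstep_bounded : exists2 M, 0 <= M & forall y, `|derive1 sg y| <= M.
Proof.
have [M [_ hM]] : bounded_set (derive1 sg @` `[0, 1]).
  apply: compact_bounded; apply: continuous_compact; last exact: segment_compact.
  by apply: continuous_subspaceT; exact: smooth1_continuous (smooth1_derive ssg).
exists (Num.max M 0 + 1); first by rewrite addr_ge0// le_max lexx orbT.
move=> y; have [h|h] := boolP (0 <= y <= 1).
  apply: hM; last by exists y => //=; rewrite in_itv.
  by rewrite (le_lt_trans (_ : _ <= Num.max M 0))// ?le_max ?lexx// ltrDl.
rewrite dstep_out ?normr0 ?addr_ge0// ?le_max ?lexx ?orbT//.
by move: h; rewrite negb_and -!ltNge => /orP[]; [left|right].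
Qed.

(** A cutoff in time that vanishes near the bottom side and tends to 1 inside Q:
    multiplication by it makes a test function for [Obot] one for Q. *)
Definition rise n (t : R) : R := sg (n.+1%:R * t + (- 1)).

Lemma rise_smooth n : smooth1 (rise n).
Proof. exact: smooth1_affine. Qed.

Lemma rise01 n t : 0 <= rise n t <= 1.
Proof. by case: isg => _ h _ _; exact: h. Qed.

Lemma rise0 n t : t <= n.+1%:R^-1 -> rise n t = 0.
Proof.
case: isg => _ _ h _ tn; apply: h.
by rewrite subr_le0 -ler_pdivlMl ?ltr0n// mulr1.
Qed.

Lemma drise n t : derive1 (rise n) t = derive1 sg (n.+1%:R * t + (- 1)) * n.+1%:R.
Proof.
have := @derive1_comp _ (fun y => n.+1%:R * y + (- 1)) sg t
  (derivable_affine _ _ _) (smooth1_derivable _ ssg).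
by rewrite /comp => ->; rewrite derive1_affine.
Qed.

Lemma rise_near (t : R) : 0 < t -> \forall n \near \oo, 2 < n.+1%:R * t.
Proof.
move=> t0; near=> n; rewrite -ltr_pdivrMr//.
have : 2 / t < n%:R by near: n; exact: nbhs_infty_gtr.
by move/lt_trans; apply; rewrite ltr_nat.
Unshelve. all: by end_near. Qed.

Lemma rise_lim (t : R) : 0 < t -> rise ^~ t @ \oo --> (1 : R).
Proof.
move=> t0; apply: cvg_near_cst; near=> n; case: isg => _ _ _ h; apply: h.
have : 2 < n.+1%:R * t by near: n; exact: rise_near.
by lra.
Unshelve. all: by end_near. Qed.

Lemma drise_lim (t : R) : 0 < t -> (fun n => derive1 (rise n) t) @ \oo --> (0 : R).
Proof.
move=> t0; apply: cvg_near_cst; near=> n; rewrite drise dstep_out ?mul0r//; right.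
have : 2 < n.+1%:R * t by near: n; exact: rise_near.
by lra.
Unshelve. all: by end_near. Qed.

(** The derivative of [rise n] has size n, but it lives where t is of size 1 / n. *)
Lemma drise_bounded : exists2 M, 0 <= M & forall n t, 0 < t -> `|derive1 (rise n) t| * t <= M.
Proof.
have [M M0 hM] := dstep_bounded; exists (2 * M); first by rewrite mulr_ge0.
move=> n t t0; rewrite drise normrM [`|n.+1%:R|]ger0_norm// -mulrA.
have [h|h] := leP (n.+1%:R * t) 2; first by rewrite mulrC ler_pM// mulr_ge0// ltW.
rewrite dstep_out ?normr0 ?mul0r ?mulr_ge0//; right; lra.
Qed.

End BottomCutoff.

Section BottomLimits.
Context {R : realType} (sg : R -> R) (isg : is_step sg) (T : R).
Local Notation plane := (plane (R := R)).
Local Notation lm := (@lebesgue_measure R).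
Local Notation Q := (Qset T).
Local Notation rise := (rise sg).
Implicit Types (v w g eta : R * R -> R).

Lemma rise_test n eta : test_fun (Obot T) eta ->
  test_fun Q (fun p => eta p * rise n p.2).
Proof.
move=> te; have [Ce [K [cK KO e0]]] := te; split.
  by move=> k; apply: CkM => //; apply: Ck_snd; exact: rise_smooth.
exists (K `&` [set p | n.+1%:R^-1 <= p.2]); split.
- apply: compact_closedI => //.
  apply: (@preimage_closed _ _ (snd : R * R -> R) [set t | n.+1%:R^-1 <= t]).
    by move=> q _; exact: cvg_snd.
  exact: closed_ge.
- move=> [x t] [/KO[/= x0 tT] /= nt]; split=> //=; rewrite tT andbT.
  by apply: lt_le_trans nt; rewrite invr_gt0.
- move=> p /not_andP[/e0 ->|]; first by rewrite mul0r.
  by move=> /negP; rewrite -ltNge => /ltW /(rise0 isg) ->; rewrite mulr0.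
Qed.

Lemma rise_lim_int g eta : loc_int Q (Obot T) g -> test_fun (Obot T) eta ->
  \int[mu2]_(p in Q) (g p * (eta p * rise n p.2)) @[n --> \oo] -->
  \int[mu2]_(p in Q) (g p * eta p).
Proof.
move=> lg te; have mQ := measurable_Qset T.
have mg : measurable_fun (Q : set plane) (g : plane -> R) by case: lg.
have me : measurable_fun (Q : set plane) (eta : plane -> R) by exact: test_measurable te.
have [||||||_ //] := @Rintegral_dct _ plane R mu2 Q
  (fun n p => g p * (eta p * rise n p.2)) (fun p => g p * eta p)
  (fun p => `|g p * eta p|).
- exact: mQ.
- move=> n; apply: measurable_funM => //; exact: test_measurable (rise_test n te).
- exact: measurable_funM.
- move=> [x t] [x0 /= /andP[t0 _]]; rewrite -[X in _ --> X]mulr1.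
  under eq_fun do rewrite mulrA.
  by apply: cvgM; [exact: cvg_cst|exact: rise_lim].
- by apply: integrable_norm => //; exact: loc_int_test lg te.
- move=> n p _; rewrite mulrA normrM -[leRHS]mulr1 ler_wpM2l//.
  by have /andP[r0 r1] := rise01 isg n p.2; rewrite ger0_norm.
Qed.

Lemma test_lip eta : test_fun (Obot T) eta -> (forall x, eta (x, 0) = 0) ->
  exists2 M, 0 <= M & forall x t, 0 < t -> `|eta (x, t)| <= M * t.
Proof.
move=> te e0; have [M M0 hM] := test_bounded (test_dt te); exists M => // x t t0.
have [] := @MVT R (fun u => eta (x, u)) (derive1 (fun u => eta (x, u))) 0 t t0.
- move=> u _; rewrite derive1E; apply: DeriveDef => //.
  exact: (@test_dert _ _ _ (x, u) te).
- apply: derivable_within_continuous => u _.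
  exact: (@test_dert _ _ _ (x, u) te).
- move=> u _; rewrite e0 !subr0 => ->.
  by rewrite normrM [`|t|]gtr0_norm//; apply: ler_wpM2r; [exact: ltW|exact: (hM (x, u))].
Qed.

(** A test function that vanishes on the bottom side is O(t) there, and this
    compensates the size of the derivative of the cutoff. *)
Lemma drise_lim_int g eta : loc_int Q (Obot T) g -> test_fun (Obot T) eta ->
  (forall x, eta (x, 0) = 0) ->
  \int[mu2]_(p in Q) (g p * (eta p * derive1 (rise n) p.2)) @[n --> \oo] --> (0 : R).
Proof.
move=> lg te e0; have mQ := measurable_Qset T.
have mg : measurable_fun (Q : set plane) (g : plane -> R) by case: lg.
have [M M0 hM] := test_lip te e0.
have [M' M'0 hM'] := drise_bounded isg.
have [_ [K [cK KO K0]]] := te.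
have mK : measurable (K : set plane) by exact: compact_measurable2.
have bnd n x t : 0 < t -> `|eta (x, t) * derive1 (rise n) t| <= M * M'.
  move=> t0; rewrite normrM; apply: (@le_trans _ _ (M * t * `|derive1 (rise n) t|)).
    by rewrite ler_wpM2r//; exact: hM.
  by rewrite -mulrA ler_wpM2l// mulrC; exact: hM'.
have [||||||_] := @Rintegral_dct _ plane R mu2 Q
  (fun n p => g p * (eta p * derive1 (rise n) p.2)) (fun=> 0)
  (fun p => `|g p| * (M * M' * \1_K p)).
- exact: mQ.
- move=> n; apply: measurable_funM => //; apply: measurable_funM.
    exact: test_measurable te.
  apply: measurable_funTS; apply: continuous_measurable2.
  apply: (Ck_cont (Ck_snd 0 _)); apply: smooth1_derive; exact: rise_smooth.
- exact: measurable_cst.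
- move=> [x t] [x0 /= /andP[t0 _]].
  rewrite (_ : 0 = g (x, t) * (eta (x, t) * 0)); last by rewrite !mulr0.
  apply: cvgM; first exact: cvg_cst.
  by apply: cvgM; [exact: cvg_cst|exact: drise_lim].
- apply: (@integrable_bump _ plane R mu2 Q K (fun p => `|g p|) (fun p => M * M' * \1_K p) (M * M')) => //.
  + by apply: measurableT_comp.
  + by apply: integrable_norm; case: lg => _; apply.
  + by apply: measurable_funM => //; exact: measurable_indic.
  + move=> p _; rewrite indicE; case: (_ \in _); rewrite ?mulr1 ?mulr0 ?normr0.
      by rewrite ger0_norm// mulr_ge0.
    by rewrite mulr_ge0.
  + by move=> p _ Kp; rewrite indicE memNset//= mulr0.
- move=> n [x t] [x0 /= /andP[t0 _]]; rewrite normrM ler_wpM2l//.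
  have [Kp|Kp] := pselect (K (x, t)).
    by rewrite indicE mem_set//= mulr1; exact: bnd.
  by rewrite K0// mul0r normr0 mulr_ge0 ?mulr_ge0// indicE.
by rewrite Rintegral_cst// mul0r.
Qed.

(** The factor [rise n] makes [eta] a test function for Q, and the term with the
    derivative of this factor disappears in the limit. *)
Lemma green_bottom0 v w eta : is_weak_deriv Q 0 1 v w ->
  loc_int Q (Obot T) v -> loc_int Q (Obot T) w ->
  test_fun (Obot T) eta -> (forall x, eta (x, 0) = 0) ->
  \int[mu2]_(p in Q) (v p * dt eta p) = - \int[mu2]_(p in Q) (w p * eta p).
Proof.
move=> [_ _ vw] lv lw te e0; have mQ := measurable_Qset T.
have lim1 := rise_lim_int lv (test_dt te).
have lim2 := drise_lim_int lv te e0.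
have lim3 := rise_lim_int lw te.
have tE n : dt (fun p => eta p * rise n p.2) =
    fun p => dt eta p * rise n p.2 + eta p * derive1 (rise n) p.2.
  apply/funext => -[x t]; rewrite !dtE /= derive1_mulf//.
  - exact: (@test_dert _ _ _ (x, t) te).
  - apply: smooth1_derivable; exact: rise_smooth.
have E n : \int[mu2]_(p in Q) (v p * (dt eta p * rise n p.2)) +
    \int[mu2]_(p in Q) (v p * (eta p * derive1 (rise n) p.2)) =
    - \int[mu2]_(p in Q) (w p * (eta p * rise n p.2)).
  have tn := rise_test n te; have := vw _ tn; rewrite /= tE expr1 mulN1r => <-.
  have lvQ := loc_intS (@Q_Obot _ T) lv.
  have i1 := loc_int_test mQ lvQ (rise_test n (test_dt te)).
  have i0 := loc_int_test mQ lvQ (test_dt tn).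
  have i2 : mu2.-integrable (Q : set plane) (EFin \o (fun p => v p * (eta p * derive1 (rise n) p.2))).
    have := integrable_lin 1 (-1) mQ i0 i1.
    congr (integrable _ _ _); apply/funext => p /=; congr EFin.
    rewrite tE; ring.
  rewrite -RintegralD//; apply: eq_Rintegral => p _; ring.
have limL : (- \int[mu2]_(p in Q) (w p * (eta p * rise n p.2))) @[n --> \oo] -->
    \int[mu2]_(p in Q) (v p * dt eta p) + 0.
  under eq_fun do rewrite -E.
  exact: cvgD.
have limR : (- \int[mu2]_(p in Q) (w p * (eta p * rise n p.2))) @[n --> \oo] -->
    - \int[mu2]_(p in Q) (w p * eta p) by exact: cvgN.
by rewrite -[LHS]addr0; exact: (cvg_unique (@Rhausdorff R) limL limR).
Qed.

(** With [zeta * rise n] in place of [zeta], both sides are the integral of [v]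
    against the same mixed derivative of a test function for Q; the limit removes
    the factor [rise n]. *)
Lemma wd_mixed_bottom v vt vxt (a zeta : R -> R) :
  is_weak_deriv Q 0 1 v vt -> is_weak_deriv Q 1 1 v vxt ->
  loc_int Q (Obot T) vt -> loc_int Q (Obot T) vxt ->
  test_fun1 half_line a -> test_fun1 [set t | t < T] zeta ->
  \int[mu2]_(p in Q) (vt p * (derive1 a p.1 * zeta p.2)) =
  - \int[mu2]_(p in Q) (vxt p * (a p.1 * zeta p.2)).
Proof.
move=> [_ _ dvt] [_ _ dvxt] lvt lvxt ta tz.
have sa : smooth1 a by case: ta.
have sz n : smooth1 (fun t => zeta t * rise n t).
  by apply: smooth1M; [case: tz|exact: rise_smooth].
have te := test_bottom ta tz; have te' := test_bottom (test1_derive ta) tz.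
have limR : (- \int[mu2]_(p in Q) (vxt p * (a p.1 * zeta p.2 * rise n p.2))) @[n --> \oo] -->
    - \int[mu2]_(p in Q) (vxt p * (a p.1 * zeta p.2)).
  by apply: cvgN; exact: rise_lim_int lvxt te.
have limL := rise_lim_int lvt te'.
apply: (cvg_unique (@Rhausdorff R) limL).
rewrite (_ : (fun n => _) = (fun n => - \int[mu2]_(p in Q) (vxt p * (a p.1 * zeta p.2 * rise n p.2))))//.
apply/funext => n.
have := dvt _ (rise_test n te'); have := dvxt _ (rise_test n te).
have -> : (fun p => a p.1 * zeta p.2 * rise n p.2) =
    (fun p => a p.1 * (zeta p.2 * rise n p.2)) by apply/funext => p; rewrite mulrA.
have -> : (fun p => derive1 a p.1 * zeta p.2 * rise n p.2) =
    (fun p => derive1 a p.1 * (zeta p.2 * rise n p.2)) by apply/funext => p; rewrite mulrA.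
rewrite /= (dt_prod a (sz n)) (dx_prod _ sa) (dt_prod (derive1 a) (sz n)) => ->.
by rewrite sqrrN expr1n mul1r expr1 mulN1r => ->; rewrite opprK.
Qed.

End BottomLimits.

(** * Existence of the trace on the bottom side *)

Section WeightedL2.
Context d {T : measurableType d} {R : realType}.
Variable mu : {measure set T -> \bar R}.

Lemma weighted_L2_integrable (D E : set T) (r f : T -> R) (c : R) :
  measurable D -> measurable E -> E `<=` D -> (mu E < +oo)%E ->
  measurable_fun D f -> measurable_fun D r -> 0 < c ->
  (forall x, D x -> 0 <= r x) -> (forall x, E x -> c <= r x) ->
  (\int[mu]_(x in D) (r x * f x ^+ 2)%:E < +oo)%E ->
  mu.-integrable E (EFin \o f).
Proof.
move=> mD mE ED Efin mf mr c0 r0 rc rf.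
have i2 : mu.-integrable D (EFin \o (fun x => r x * f x ^+ 2)).
  apply/integrableP; split.
    by apply/measurable_EFinP; apply: measurable_funM => //; exact: measurable_funX.
  rewrite [ltLHS](_ : _ = (\int[mu]_(x in D) (r x * f x ^+ 2)%:E)%E)//.
  apply: eq_integral => x; rewrite inE => Dx /=.
  by rewrite ger0_norm// mulr_ge0 ?sqr_ge0// r0.
have i1 : mu.-integrable E (EFin \o cst (1 : R)).
  apply: measurable_bounded_integrable => //.
  by exists 1; split; [exact: num_real|move=> M M1 x _ /=; rewrite normr1 ltW].
apply: (le_integrable mE (f := EFin \o f)) (integrable_lin 1 c^-1 mE i1 (integrableS mD mE ED i2)).
  by apply/measurable_EFinP; exact: measurable_funS mf.
move=> x Ex; rewrite /= lee_fin mul1r.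
have rcx := rc _ Ex; have f2 : f x ^+ 2 <= c^-1 * (r x * f x ^+ 2).
  by rewrite ler_pdivlMl// ler_wpM2r// sqr_ge0.
have f20 := sqr_ge0 (f x).
rewrite [leRHS]ger0_norm; last by rewrite addr_ge0// (le_trans f20).
apply: le_trans (_ : 1 + f x ^+ 2 <= _); last by rewrite lerD2l.
rewrite -(real_normK (num_real (f x))).
by have := sqr_ge0 (`|f x| - 1); have := normr_ge0 (f x); nra.
Qed.

End WeightedL2.

Section TraceExists.
Context {R : realType} (sg : R -> R) (isg : is_step sg) (T : R) (T0 : 0 < T).
Local Notation plane := (plane (R := R)).
Local Notation lm := (@lebesgue_measure R).
Local Notation Q := (Qset T).
Implicit Types (v w g eta : R * R -> R).

(** The lower bound makes functions with finite weighted norm integrable near the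
    bottom side, on bounded sets. *)
Definition is_weight (r : R -> R) : Prop :=
  [/\ measurable_fun half_line (r : measurableTypeR R -> R),
      forall x, half_line x -> 0 <= r x &
      forall B, exists2 c, 0 < c & forall x, half_line x -> x <= B -> c <= r x].

Definition L2w (r : R -> R) v : Prop :=
  measurable_fun (Q : set plane) (v : plane -> R) /\
  (\int[mu2]_(p in Q) (r p.1 * v p ^+ 2)%:E < +oo)%E.

Lemma weight_measurable r : is_weight r ->
  measurable_fun (Q : set plane) ((fun p => r p.1) : plane -> R).
Proof.
move=> [mr _ _]; rewrite QsetE.
have mQ : measurable (half_line `*` time_int T : set plane).
  by rewrite -QsetE; exact: measurable_Qset.
have mr' := (measurable_restrictT r measurable_half_line).1 mr.
have : measurable_fun (half_line `*` time_int T : set plane) ((r \_ half_line) \o (fst : plane -> measurableTypeR R)).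
  by apply: measurable_funTS; apply: measurableT_comp => //; exact: measurable_fst.
apply: eq_measurable_fun => p; rewrite inE => -[px _] /=.
by rewrite patchE mem_set.
Qed.

Lemma half_lineP (x : R) : half_line x <-> 0 < x.
Proof. by rewrite /half_line/= in_itv/= andbT. Qed.

Lemma L2w_loc_int r v : is_weight r -> L2w r v -> loc_int Q (Obot T) v.
Proof.
move=> ir [mv vfin]; have mQ := measurable_Qset T.
have mr := weight_measurable ir; have [_ r0 rb] := ir.
split=> // K cK KO.
have [M [_ hM]] := compact_bounded cK.
pose B := Num.max M 0 + 1.
have KB p : K p -> `|p| <= B.
  move=> Kp; apply: hM => //.
  by rewrite (le_lt_trans (_ : _ <= Num.max M 0))// ?le_max ?lexx// ltrDl.
have [c c0 hc] := rb B.
apply: (@weighted_L2_integrable _ plane R mu2 Q _ (fun p => r p.1) v c) => //.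
- by apply: measurableI => //; exact: compact_measurable2.
- apply: (@le_lt_trans _ _ (mu2 (`[- B, B] `*` `[- B, B] : set plane))).
    apply: le_measure; rewrite ?inE.
    + by apply: measurableI => //; exact: compact_measurable2.
    + by apply: measurable_rect; exact: measurable_itv.
    move=> [x t] [_ /KB]; rewrite /Num.norm /= ge_max => /andP[].
    by rewrite !ler_norml => h1 h2; split => /=; rewrite in_itv.
  rewrite [ltLHS]product_measure1E//.
  rewrite [X in (X * _)%E]lebesgue_measure_itv [X in (_ * X)%E]lebesgue_measure_itv /=.
  by case: ifP => _; rewrite ?mul0e ?ltry// -EFinD -EFinM ltry.
- by move=> [x t] [x0 _]; apply: r0; apply/half_lineP.
- move=> [x t] [[/= x0 _] /KB]; rewrite /Num.norm /= ge_max => /andP[xB _].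
  apply: hc; first exact/half_lineP.
  by apply: le_trans xB; exact: ler_norm.
Qed.

Lemma L2w_locally_integrable (r p : R -> R) : is_weight r ->
  measurable_fun half_line (p : measurableTypeR R -> R) ->
  (\int[lm]_(x in half_line) (r x * p x ^+ 2)%:E < +oo)%E ->
  locally_integrable half_line p.
Proof.
move=> ir mp pfin; have [mr r0 rb] := ir; split; [exact: mp|exact: open_half_line|].
move=> K KH cK.
have [M [_ hM]] := compact_bounded cK.
pose B := Num.max M 0 + 1.
have KB x : K x -> `|x| <= B.
  move=> Kp; apply: hM => //.
  by rewrite (le_lt_trans (_ : _ <= Num.max M 0))// ?le_max ?lexx// ltrDl.
have [c c0 hc] := rb B.
have mK : measurable (K : set (measurableTypeR R)) by exact: compact_measurable.
suff /integrableP[] : lm.-integrable K (EFin \o p) by [].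
apply: (@weighted_L2_integrable _ (measurableTypeR R) R lm half_line K r p c) => //.
- have : (lm K < +oo)%E by exact: compact_finite_measure.
  by [].
- move=> x Kx; apply: hc; first exact: KH.
  by apply: le_trans (KB _ Kx); exact: ler_norm.
Qed.

Variable (zeta : R -> R).
Hypotheses (tz : test_fun1 [set t | t < T] zeta)
  (z1 : forall t, -1 <= t <= T / 3 -> zeta t = 1).

(** The fundamental theorem of calculus for [zeta v] on [(0, T)] gives the
    bottom value of [v] as an average over time, which needs no limit. *)
Definition bottom_avg v w (x : R) : R :=
  - \int[lm]_(t in time_int T) (zeta t * w (x, t) + derive1 zeta t * v (x, t)).

Let F v w (p : R * R) : R := zeta p.2 * w p + derive1 zeta p.2 * v p.

Let sz : smooth1 zeta. Proof. by case: tz. Qed.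

Let mF v w : measurable_fun (Q : set plane) (v : plane -> R) ->
  measurable_fun (Q : set plane) (w : plane -> R) ->
  measurable_fun (Q : set plane) (F v w : plane -> R).
Proof.
move=> mv mw; apply: measurable_funD; apply: measurable_funM => //.
  apply: measurable_funTS; apply: continuous_measurable2.
  exact: (Ck_cont (Ck_snd 0 sz)).
apply: measurable_funTS; apply: continuous_measurable2.
exact: (Ck_cont (Ck_snd 0 (smooth1_derive sz))).
Qed.

Lemma bottom_avg_measurable v w : measurable_fun (Q : set plane) (v : plane -> R) ->
  measurable_fun (Q : set plane) (w : plane -> R) ->
  measurable_fun half_line (bottom_avg v w : measurableTypeR R -> R).
Proof.
move=> mv mw; apply: measurableT_comp => //.
have := @Rsection_measurable R half_line (time_int T) measurable_half_line (measurable_time_int T) (F v w).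
by apply; have := mF mv mw; rewrite QsetE.
Qed.

(** The Cauchy-Schwarz inequality is applied in t alone: the weight does not
    depend on t and passes through the time integral. *)
Lemma bottom_avg_L2 r v w : is_weight r -> L2w r v -> L2w r w ->
  (\int[lm]_(x in half_line) (r x * bottom_avg v w x ^+ 2)%:E < +oo)%E.
Proof.
move=> ir [mv vfin] [mw wfin]; have [mr r0 rb] := ir.
have mQ := measurable_Qset T.
have mrQ := weight_measurable ir.
have mFQ := mF mv mw.
have [M1 M10 hM1] := test1_bounded tz.
have [M2 M20 hM2] := test1_bounded (test1_derive tz).
have mrF : measurable_fun (Q : set plane) ((fun p => (r p.1 * F v w p ^+ 2)%:E) : plane -> \bar R).
  by apply/measurable_EFinP; apply: measurable_funM => //; exact: measurable_funX.
have rF0 p : Q p -> (0 <= (r p.1 * F v w p ^+ 2)%:E)%E.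
  move=> [p1 _]; rewrite lee_fin mulr_ge0 ?sqr_ge0//; apply: r0.
  exact/half_lineP.
have mrf u : measurable_fun (Q : set plane) (u : plane -> R) ->
    measurable_fun (Q : set plane) ((fun p => (r p.1 * u p ^+ 2)%:E) : plane -> \bar R).
  by move=> mu; apply/measurable_EFinP; apply: measurable_funM => //; exact: measurable_funX.
have ru0 u p : Q p -> (0 <= (r p.1 * u p ^+ 2)%:E)%E.
  move=> [p1 _]; rewrite lee_fin mulr_ge0 ?sqr_ge0//; apply: r0.
  exact/half_lineP.
have rFfin : (\int[mu2]_(p in Q) (r p.1 * F v w p ^+ 2)%:E < +oo)%E.
  pose C := 2 * (M1 ^+ 2 + M2 ^+ 2).
  have C0 : 0 <= C by rewrite mulr_ge0// addr_ge0// sqr_ge0.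
  apply: (@le_lt_trans _ _ (\int[mu2]_(p in Q) (C%:E * (r p.1 * w p ^+ 2)%:E + C%:E * (r p.1 * v p ^+ 2)%:E))%E).
    apply: ge0_le_integral => //.
    - by apply: emeasurable_funD; apply: emeasurable_funM => //; exact: mrf.
    - move=> p Qp; rewrite -!EFinM -EFinD lee_fin.
      have rp : 0 <= r p.1 by apply: r0; apply/half_lineP; case: Qp.
      have -> : C * (r p.1 * w p ^+ 2) + C * (r p.1 * v p ^+ 2) =
        r p.1 * (C * w p ^+ 2 + C * v p ^+ 2) by ring.
      apply: ler_wpM2l => //.
      rewrite /F /C.
      have h1 : (zeta p.2) ^+ 2 <= M1 ^+ 2 by rewrite -(real_normK (num_real _)) ler_sqr ?nnegrE.
      have h2 : (derive1 zeta p.2) ^+ 2 <= M2 ^+ 2 by rewrite -(real_normK (num_real _)) ler_sqr ?nnegrE.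
      have w2 := sqr_ge0 (w p); have v2 := sqr_ge0 (v p).
      have := sqr_ge0 (zeta p.2 * w p - derive1 zeta p.2 * v p).
      have k1 := ler_wpM2r w2 h1; have k2 := ler_wpM2r v2 h2.
      have k3 := mulr_ge0 (sqr_ge0 M1) v2; have k4 := mulr_ge0 (sqr_ge0 M2) w2.
      by nra.
  rewrite ge0_integralD//.
  - rewrite !ge0_integralZl//; try exact: mrf; try by move=> p Qp; exact: ru0.
    by apply: lte_add_pinfty; apply: lte_mul_pinfty.
  - by move=> p Qp; apply: mule_ge0 => //; exact: ru0.
  - by apply: emeasurable_funM => //; exact: mrf.
  - by move=> p Qp; apply: mule_ge0 => //; exact: ru0.
  - by apply: emeasurable_funM => //; exact: mrf.
apply: (@le_lt_trans _ _ (T%:E * \int[mu2]_(p in Q) (r p.1 * F v w p ^+ 2)%:E)%E); last first.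
  by apply: lte_mul_pinfty => //; rewrite lee_fin ltW.
have mS : measurable_fun (half_line `*` time_int T : set plane)
    ((fun p => (r p.1 * F v w p ^+ 2)%:E) : plane -> \bar R) by rewrite -QsetE.
have S0 p : (half_line `*` time_int T) p -> (0 <= (r p.1 * F v w p ^+ 2)%:E)%E.
  by rewrite -QsetE; exact: rF0.
rewrite [in leRHS]QsetE (@tonelli_plane R half_line (time_int T) measurable_half_line (measurable_time_int T) _ mS S0).
rewrite -ge0_integralZl//; last 3 first.
- exact: (ge0_section_measurable measurable_half_line (measurable_time_int T) mS S0).
- move=> x Hx; apply: integral_ge0 => t Ht; exact: (S0 (x, t)).
- by rewrite lee_fin ltW.
apply: ge0_le_integral => //.
- by move=> x Hx; rewrite lee_fin mulr_ge0 ?sqr_ge0// r0.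
- apply/measurable_EFinP; apply: measurable_funM => //; apply: measurable_funX.
  exact: bottom_avg_measurable.
- apply: emeasurable_funM => //.
  exact: (ge0_section_measurable measurable_half_line (measurable_time_int T) mS S0).
- move=> x Hx /=.
  have mFx : measurable_fun (time_int T) ((fun t => F v w (x, t)) : measurableTypeR R -> R).
    have := @section_measurable R half_line (time_int T) measurable_half_line (measurable_time_int T) (F v w) x Hx.
    by apply; rewrite -QsetE.
  have := sqr_Rintegral_le T0 mFx.
  have mFx2 : measurable_fun (time_int T) ((fun t => (F v w (x, t) ^+ 2)%:E) : measurableTypeR R -> \bar R).
    by apply/measurable_EFinP; exact: measurable_funX.
  have rx : 0 <= r x by exact: r0.
  have -> : (\int[lm]_(t in time_int T) (r x * F v w (x, t) ^+ 2)%:E =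
      (r x)%:E * \int[lm]_(t in time_int T) (F v w (x, t) ^+ 2)%:E)%E.
    by rewrite -ge0_integralZl// => t _; rewrite lee_fin sqr_ge0.
  rewrite muleCA /bottom_avg sqrrN => h; rewrite [leLHS]EFinM.
  by apply: lee_wpmul2l => //; rewrite lee_fin.
Qed.

(** This turns a pairing on the bottom side into integrals over Q, where weak
    derivatives can be used. *)
Lemma bottom_avg_fubini v w (e : R -> R) :
  loc_int Q (Obot T) v -> loc_int Q (Obot T) w ->
  measurable_fun half_line (e : measurableTypeR R -> R) ->
  test_fun (Obot T) (fun p => e p.1 * zeta p.2) ->
  test_fun (Obot T) (fun p => e p.1 * derive1 zeta p.2) ->
  \int[mu2]_(p in Q) (w p * (e p.1 * zeta p.2)) +
  \int[mu2]_(p in Q) (v p * (e p.1 * derive1 zeta p.2)) =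
  - \int[lm]_(x in half_line) (bottom_avg v w x * e x).
Proof.
move=> lv lw me te te'; have mQ := measurable_Qset T.
have i1 := loc_int_test mQ lw te; have i2 := loc_int_test mQ lv te'.
have mv : measurable_fun (Q : set plane) (v : plane -> R) by case: lv.
have mw : measurable_fun (Q : set plane) (w : plane -> R) by case: lw.
rewrite -RintegralD//.
rewrite (_ : (fun p => _) = (fun p => F v w p * e p.1)); last first.
  by apply/funext => p; rewrite /F; ring.
have iF : mu2.-integrable (half_line `*` time_int T : set plane) (EFin \o (fun p => F v w p * e p.1)).
  rewrite -QsetE; have := integrable_lin 1 1 mQ i1 i2.
  by congr (integrable _ _ _); apply/funext => p /=; congr EFin; rewrite /F; ring.
have mF' : measurable_fun (half_line `*` time_int T : set plane) (F v w : plane -> R).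
  by rewrite -QsetE; exact: mF.
rewrite [in LHS]QsetE (Rfubini_sep measurable_half_line (measurable_time_int T) mF' me iF).
rewrite [in RHS](_ : (fun x => _) = fun x => - 1 * ((\int[lm]_(t in time_int T) F v w (x, t)) * e x)); last first.
  by apply/funext => x; rewrite /bottom_avg mulN1r mulNr.
rewrite RintegralZl//; first by rewrite mulN1r opprK.
have [_ + _] := Rfubini measurable_half_line (measurable_time_int T) iF.
move=> /[dup] iS /measurable_int /measurable_EFinP mS.
apply: (@integrable_ae_congr R _ (measurableTypeR R) lm half_line _ _ measurable_half_line _ _ iS).
  apply: measurable_funM => //.
  by have := @Rsection_measurable R half_line (time_int T) measurable_half_line (measurable_time_int T) (F v w); apply.
have [_ _] := Rfubini measurable_half_line (measurable_time_int T) iF.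
apply: ae1S => x h Hx /=; have [a0|a0] := eqVneq (e x) 0.
  rewrite a0 mulr0 (_ : (fun t => _) = cst 0); last first.
    by apply/funext => t /=; rewrite mulr0.
  by rewrite Rintegral_cst// mul0r.
rewrite -RintegralZr//.
have := integrableZr (measurable_time_int T) (e x)^-1 (h Hx).
congr (integrable _ _ _); apply/funext => t /=.
by rewrite -EFinM -mulrA divff// mulr1.
Qed.

Lemma bottom_lift_test eta : test_fun (Obot T) eta ->
  forall b : R -> R, test_fun1 [set t | t < T] b ->
  test_fun (Obot T) (fun p => eta (p.1, 0) * b p.2).
Proof.
move=> [Ce [K [cK KO e0]]] b [sb [L [cL LT b0]]]; split.
  by move=> n; apply: CkM; [exact: (Ck_bottom (Ce n))|exact: Ck_snd].
exists ((fst @` K) `*` L); split.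
- apply: compact_setX => //; apply: continuous_compact => //.
  by apply: continuous_subspaceT => q; exact: cvg_fst.
- move=> [x t] [/= [[x' t'] /KO [/= x0 _] <-]] /LT tT; by split.
- move=> [x t] /= /not_andP[nK|/b0 ->]; last by rewrite mulr0.
  by rewrite e0 ?mul0r// => Kx; apply: nK; exists (x, 0).
Qed.

(** A test function splits into [eta (x, 0) * zeta t], to which Fubini's theorem
    applies, and a remainder that vanishes on the bottom side, to which
    [green_bottom0] applies. *)
Lemma bottom_avg_trace r v w : is_weight r -> L2w r v -> L2w r w ->
  is_weak_deriv Q 0 1 v w -> is_trace_t0 T v (bottom_avg v w).
Proof.
move=> ir Lv Lw dvw.
have lv := L2w_loc_int ir Lv; have lw := L2w_loc_int ir Lw.
have mQ := measurable_Qset T.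
split=> //.
  apply: (L2w_locally_integrable ir); last exact: bottom_avg_L2.
  by apply: bottom_avg_measurable; [case: Lv|case: Lw].
exists w; split=> // eta te.
have tz' : test_fun1 [set t | t < T] (derive1 zeta) by exact: test1_derive.
have t1 := bottom_lift_test te tz; have t2 := bottom_lift_test te tz'.
have me : measurable_fun half_line ((fun x => eta (x, 0)) : measurableTypeR R -> R).
  by apply: measurable_funTS; apply: continuous_measurable_fun; exact: trace_t0_cont te.
have fub := bottom_avg_fubini lv lw me t1 t2.
pose b (p : R * R) := eta p + eta (p.1, 0) * zeta p.2 * -1.
have tb : test_fun (Obot T) b.
  by apply: testD => //; apply: testMr => // n; exact: Ck_cst.
have b0 x : b (x, 0) = 0.
  rewrite /b /= z1; first by rewrite mulr1 mulrN1 subrr.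
  by rewrite lerN10/= divr_ge0// ltW.
have bE : dt b = fun p => dt eta p + eta (p.1, 0) * derive1 zeta p.2 * -1.
  apply/funext => -[x t]; rewrite /b dtE /= derive1_addf; first last.
  - apply: derivable_mulf; last exact: (derivable_cstE (-1) t).
    by apply: derivable_mulf; [exact: (derivable_cstE (eta (x, 0)) t)|exact: smooth1_derivable].
  - exact: (@test_dert _ _ _ (x, t) te).
  congr (_ + _); rewrite derive1_mulf; [|by apply: derivable_mulf; [exact: (derivable_cstE (eta (x, 0)) t)|exact: smooth1_derivable]|exact: (derivable_cstE (-1) t)].
  rewrite derive1_constf mulr0 addr0 derive1_mulf; [|exact: (derivable_cstE (eta (x, 0)) t)|exact: smooth1_derivable].
  by rewrite derive1_constf mul0r add0r.
have := green_bottom0 isg dvw lv lw tb b0; rewrite bE.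
have i1 := loc_int_test mQ lv (test_dt te); have i2 := loc_int_test mQ lv t2.
have i3 := loc_int_test mQ lw te; have i4 := loc_int_test mQ lw t1.
rewrite (_ : (fun p => v p * _) = (fun p => 1 * (v p * dt eta p) + -1 * (v p * (eta (p.1, 0) * derive1 zeta p.2)))); last first.
  by apply/funext => p; ring.
rewrite (_ : (fun p => w p * _) = (fun p => 1 * (w p * eta p) + -1 * (w p * (eta (p.1, 0) * zeta p.2)))); last first.
  by apply/funext => p; rewrite /b; ring.
rewrite !Rintegral_lin// RintegralD//.
by move: fub; lra.
Qed.

(** Differentiation in x under the time average: [vxt] is also the derivative in
    time of [vx]. *)
Lemma bottom_avg_wd1 r v vt vx vxt : is_weight r ->
  L2w r v -> L2w r vt -> L2w r vx -> L2w r vxt ->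
  is_weak_deriv Q 0 1 v vt -> is_weak_deriv Q 1 0 v vx -> is_weak_deriv Q 1 1 v vxt ->
  is_weak_deriv1 (bottom_avg v vt) (bottom_avg vx vxt).
Proof.
move=> ir Lv Lvt Lvx Lvxt dvt dvx dvxt.
have lv := L2w_loc_int ir Lv; have lvt := L2w_loc_int ir Lvt.
have lvx := L2w_loc_int ir Lvx; have lvxt := L2w_loc_int ir Lvxt.
have mQ := measurable_Qset T.
split.
- apply: (L2w_locally_integrable ir); last exact: bottom_avg_L2.
  by apply: bottom_avg_measurable; [case: Lv|case: Lvt].
- apply: (L2w_locally_integrable ir); last exact: bottom_avg_L2.
  by apply: bottom_avg_measurable; [case: Lvx|case: Lvxt].
move=> a ta; have ta' := test1_derive ta.
have tz' : test_fun1 [set t | t < T] (derive1 zeta) by exact: test1_derive.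
have sa : smooth1 a by case: ta.
have f1 := bottom_avg_fubini lv lvt (smooth1_measurable (D := half_line) (smooth1_derive sa)) (test_bottom ta' tz) (test_bottom ta' tz').
have f2 := bottom_avg_fubini lvx lvxt (smooth1_measurable (D := half_line) sa) (test_bottom ta tz) (test_bottom ta tz').
have mixed := wd_mixed_bottom isg dvt dvxt lvt lvxt ta tz.
(* on Q the factor [zeta'] vanishes near t = 0, so this term needs no limit *)
have [n hn] : exists n, forall t, 0 < t -> derive1 zeta t * rise sg n t = derive1 zeta t.
  have T3 : 0 < T / 3 by rewrite divr_gt0.
  near \oo => n; exists n => t t0.
  have [h|h] := ltP t (T / 3).
    rewrite (_ : derive1 zeta t = 0) ?mul0r//.
    rewrite -(@derive1_constf R 1 t) !derive1E; apply: near_eq_derive.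
    near=> u; apply: z1; apply/andP; split; apply/ltW; near: u.
      by apply: lt_nbhsr; lra.
    exact: lt_nbhsl.
  rewrite /rise; case: isg => _ _ _ ->; first by rewrite mulr1.
  have : 2 < n.+1%:R * (T / 3) by near: n; exact: rise_near.
  have : n.+1%:R * (T / 3) <= n.+1%:R * t by rewrite ler_wpM2l.
  by lra.
have t3 := rise_test isg n (test_bottom ta tz').
have [_ _ /(_ _ t3)] := dvx.
rewrite /= (_ : (fun p => a p.1 * _ * _) = (fun p => a p.1 * (derive1 zeta p.2 * rise sg n p.2))); last first.
  by apply/funext => p; rewrite mulrA.
rewrite (dx_prod (fun t => derive1 zeta t * rise sg n t) sa) expr1 mulN1r.
have E (u : R * R -> R) (b : R -> R) :
    \int[mu2]_(p in Q) (u p * (b p.1 * (derive1 zeta p.2 * rise sg n p.2))) =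
    \int[mu2]_(p in Q) (u p * (b p.1 * derive1 zeta p.2)).
  by apply: eq_Rintegral => p; rewrite inE => -[_ /andP[p0 _]]; rewrite hn.
have E' : \int[mu2]_(p in Q) (vx p * (a p.1 * derive1 zeta p.2 * rise sg n p.2)) =
    \int[mu2]_(p in Q) (vx p * (a p.1 * derive1 zeta p.2)).
  by apply: eq_Rintegral => p; rewrite inE => -[_ /andP[p0 _]]; rewrite -mulrA hn.
rewrite /= E E' => h; move: f1; rewrite mixed h -opprD f2 opprK.
by move=> /(congr1 -%R); rewrite opprK => ->.
Unshelve. all: by end_near. Qed.

End TraceExists.

(** * The weight functions *)

Section Weights.
Context {R : realType} (c T lam : R).
Hypotheses (c0 : 0 < c) (T0 : 0 < T) (lam_gt : - (1 / 3) < lam) (lam0 : lam < 0).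
Local Notation plane := (plane (R := R)).
Local Notation phi := (Defs.phi c lam).
Local Notation psi := (Defs.psi c).
Local Notation box_psi := (Defs.box_psi c).
Local Notation omega := (Defs.omega c lam).
Local Notation omega0 := (Defs.omega0 c lam).
Local Notation rho := (Defs.rho c lam).
Local Notation a0 := (Defs.a0 c lam).
Local Notation r0 := (Defs.r0 c lam).

Lemma phi_gt0 p : 0 < phi p.
Proof. exact: expR_gt0. Qed.

Lemma ct_ge0 t : 0 <= t -> 0 <= c * t.
Proof. by move=> t0; rewrite mulr_ge0// ltW. Qed.

Lemma phi_ge1 x t : 0 <= x -> 0 <= t -> 1 <= phi (x, t).
Proof.
move=> x0 t0; have ct := ct_ge0 t0.
rewrite /Defs.phi -[leLHS]expR0 ler_expR /Defs.psi /=.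
have h1 : 0 <= ln (1 + c * t) by apply: ln_ge0; lra.
have h2 : 0 <= ln (1 + x + c * t) by apply: ln_ge0; lra.
by rewrite -opprD mulrN -mulNr mulr_ge0 ?addr_ge0// oppr_ge0 ltW.
Qed.

Lemma phi_le_t x t : 0 <= x -> 0 <= t -> phi (x, 0) <= phi (x, t).
Proof.
move=> x0 t0; have ct := ct_ge0 t0.
rewrite /Defs.phi ler_expR; apply: ler_wnM2l; first exact: ltW.
rewrite /Defs.psi /= mulr0 !addr0; apply: lerB.
  by rewrite lerN2 ler_ln ?posrE; lra.
by rewrite ler_ln ?posrE; lra.
Qed.

Lemma phi_le_x x y : 0 <= x -> x <= y -> phi (x, 0) <= phi (y, 0).
Proof.
move=> x0 xy; rewrite /Defs.phi ler_expR; apply: ler_wnM2l; first exact: ltW.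
rewrite /Defs.psi /= mulr0 !addr0; apply: lerB => //.
by rewrite ler_ln ?posrE; lra.
Qed.

(** The number (1 + c T)^(- 2 lam), a bound for [phi (x, t) / phi (x, 0)] that is
    uniform in x. *)
Definition phi_ratio : R := expR (- lam * (2 * ln (1 + c * T))).

Lemma phi_ratio_ge1 : 1 <= phi_ratio.
Proof.
rewrite /phi_ratio -[leLHS]expR0 ler_expR.
have h1 : 0 <= ln (1 + c * T) by apply: ln_ge0; have := ct_ge0 (ltW T0); lra.
have l0 : 0 <= - lam by rewrite oppr_ge0 ltW.
by rewrite mulr_ge0// mulr_ge0.
Qed.

Lemma phi_le_bottom x t : 0 <= x -> 0 <= t -> t <= T ->
  phi (x, t) <= phi_ratio * phi (x, 0).
Proof.
move=> x0 t0 tT; have ct := ct_ge0 t0.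
have cT : c * t <= c * T by rewrite ler_wpM2l// ltW.
rewrite /Defs.phi /phi_ratio -expRD ler_expR /Defs.psi /= mulr0 !addr0 ln1.
have h1 : ln (1 + c * t) <= ln (1 + c * T) by rewrite ler_ln ?posrE; lra.
have h2 : ln (1 + x + c * t) <= ln (1 + x) + ln (1 + c * T).
  rewrite -lnM ?posrE; [|lra|lra].
  by rewrite ler_ln ?posrE//; nra.
have l0 : 0 <= - lam by rewrite oppr_ge0 ltW.
by have := ler_wpM2l l0 (lerD h1 h2); lra.
Qed.

Lemma omega_gt0 s p : 0 < omega s p.
Proof. exact: expR_gt0. Qed.

Lemma omega_le s x t : s <= 0 -> 0 <= x -> 0 <= t -> omega s (x, t) <= omega s (x, 0).
Proof.
move=> s0 x0 t0; rewrite /Defs.omega ler_expR ler_wnM2l// lerD2r.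
exact: phi_le_t.
Qed.

Lemma omega_sqr_le s x t : s <= 0 -> 0 <= x -> 0 <= t ->
  omega s (x, t) ^+ 2 <= omega0 s x ^+ 2.
Proof.
move=> s0 x0 t0; rewrite ler_sqr ?nnegrE; [|exact: ltW (omega_gt0 _ _)|exact: ltW (omega_gt0 _ _)].
exact: omega_le.
Qed.

Lemma rho_gt0 s x : 0 < rho s x.
Proof. by rewrite /Defs.rho mulr_gt0// exprn_gt0//; [exact: omega_gt0|exact: phi_gt0]. Qed.

Lemma omega0_le_rho s x : 0 <= x -> omega0 s x ^+ 2 <= rho s x.
Proof.
move=> x0; rewrite /Defs.rho ler_peMr ?sqr_ge0//.
by apply: exprn_ege1; exact: phi_ge1.
Qed.

Lemma omega_le_rho s x t : s <= 0 -> 0 <= x -> 0 <= t -> omega s (x, t) ^+ 2 <= rho s x.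
Proof.
by move=> s0 x0 t0; apply: le_trans (omega0_le_rho s x0); exact: omega_sqr_le.
Qed.

Lemma omega_phi3_le_rho s x t : s <= 0 -> 0 <= x -> 0 <= t -> t <= T ->
  omega s (x, t) ^+ 2 * phi (x, t) ^+ 3 <= phi_ratio ^+ 3 * rho s x.
Proof.
move=> s0 x0 t0 tT.
have gen (a b r f g : R) : 0 <= a -> 0 <= g -> a <= b -> g <= r * f ->
    a * g ^+ 3 <= r ^+ 3 * (b * f ^+ 3).
  move=> a_ge0 g_ge0 ab grf.
  have -> : r ^+ 3 * (b * f ^+ 3) = b * (r * f) ^+ 3 by ring.
  apply: ler_pM => //; first exact: exprn_ge0.
  by rewrite lerXn2r ?nnegrE// (le_trans g_ge0).
apply: gen; [exact: sqr_ge0|exact: ltW (phi_gt0 _)|exact: omega_sqr_le|].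
exact: phi_le_bottom.
Qed.

Lemma measurable_phi (D : set plane) : measurable_fun D (phi : plane -> R).
Proof.
apply: measurable_funTS; apply: measurableT_comp; first exact: measurable_expR.
apply: measurable_funM => //; apply: measurable_funB; last first.
  apply: measurableT_comp; first exact: measurable_ln.
  apply: measurable_funD; first by apply: measurable_funD => //; exact: measurable_fst.
  by apply: measurable_funM => //; exact: measurable_snd.
apply: measurableT_comp => //; apply: measurableT_comp; first exact: measurable_ln.
by apply: measurable_funD => //; apply: measurable_funM => //; exact: measurable_snd.
Qed.

Lemma measurable_omega s (D : set plane) : measurable_fun D (omega s : plane -> R).
Proof.
apply: measurableT_comp; first exact: measurable_expR.
apply: measurable_funM => //; apply: measurable_funB => //; exact: measurable_phi.
Qed.

Lemma measurable_phi0 (D : set (measurableTypeR R)) :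
  measurable_fun D ((fun x => phi (x, 0)) : measurableTypeR R -> R).
Proof.
apply: measurable_funTS.
apply: (measurableT_comp (f := phi : plane -> R) (g := fun x : measurableTypeR R => (x, 0) : plane)).
  exact: measurable_phi.
exact: pair2_measurable.
Qed.

Lemma measurable_omega0 s (D : set (measurableTypeR R)) :
  measurable_fun D (omega0 s : measurableTypeR R -> R).
Proof.
apply: measurable_funTS.
apply: (measurableT_comp (f := omega s : plane -> R) (g := fun x : measurableTypeR R => (x, 0) : plane)).
  exact: measurable_omega.
exact: pair2_measurable.
Qed.

Lemma measurable_rho s (D : set (measurableTypeR R)) :
  measurable_fun D (rho s : measurableTypeR R -> R).
Proof.
apply: measurable_funM; apply: measurable_funX; first exact: measurable_omega0.
exact: measurable_phi0.
Qed.

(** As [phi] grows with x, [omega0] is bounded below on (0, B] by its value at B. *)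
Lemma rho_weight s : s <= 0 -> is_weight (rho s).
Proof.
move=> s0; split; first exact: measurable_rho.
  by move=> x _; rewrite ltW// rho_gt0.
move=> B; exists (omega0 s (Num.max B 0) ^+ 2).
  by rewrite exprn_gt0//; exact: omega_gt0.
move=> x /half_lineP x0 xB; apply: le_trans (omega0_le_rho s (ltW x0)).
rewrite ler_sqr ?nnegrE; [|exact: ltW (omega_gt0 _ _)|exact: ltW (omega_gt0 _ _)].
rewrite /Defs.omega0 /Defs.omega ler_expR ler_wnM2l// lerD2r.
by apply: phi_le_x; [exact: ltW|rewrite le_max xB].
Qed.

Section BottomDerivatives.
Variable x : R.
Hypothesis x0 : 0 <= x.

Local Notation y := ((1 + x)^-1).
Let y0 : 0 < y. Proof. by rewrite invr_gt0; have := x0; lra. Qed.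
Let y1 : y <= 1. Proof. by have := x0 => h; rewrite invf_le1; lra. Qed.

Lemma is_derive_aff (a b t : R) : is_derive t 1 (fun u => a + b * u) b.
Proof.
have := is_deriveD (is_derive_cst a t 1) (is_deriveZ b (is_derive_id t 1)).
by rewrite add0r /GRing.scale /= mulr1.
Qed.

Lemma is_derive_affine_inv (a b t : R) : a + b * t != 0 ->
  is_derive t 1 (fun u => (a + b * u)^-1) (- b / (a + b * t) ^+ 2).
Proof.
move=> h; have := @is_deriveV R (fun u => a + b * u) t b 1 h (is_derive_aff a b t) => /is_derive_eq; apply.
by rewrite /GRing.scale /= mulrC mulrN mulNr.
Qed.

Lemma is_derive_affine_ln (a b t : R) : 0 < a + b * t ->
  is_derive t 1 (fun u => ln (a + b * u)) (b / (a + b * t)).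
Proof.
move=> h; have := @is_derive1_comp R (@ln R) (fun u => a + b * u) t _ _ (is_derive1_ln h) (is_derive_aff a b t).
by move=> /is_derive_eq; apply; rewrite mulrC.
Qed.

Lemma is_derive_mul (f g : R -> R) (t a b : R) : is_derive t 1 f a ->
  is_derive t 1 g b -> is_derive t 1 (fun u => f u * g u) (a * g t + f t * b).
Proof.
move=> df dg; have := is_deriveM df dg => /is_derive_eq; apply.
by rewrite /GRing.scale /= addrC [g t * a]mulrC.
Qed.

Lemma is_derive_add (f g : R -> R) (t a b : R) : is_derive t 1 f a ->
  is_derive t 1 g b -> is_derive t 1 (fun u => f u + g u) (a + b).
Proof. by move=> df dg; exact: (is_deriveD df dg). Qed.

Lemma is_derive_scale (f : R -> R) (k t a : R) : is_derive t 1 f a ->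
  is_derive t 1 (fun u => k * f u) (k * a).
Proof. by move=> df; exact: (is_deriveZ k df). Qed.

Lemma derive1_val (f : R -> R) (t l : R) : is_derive t 1 f l -> derive1 f t = l.
Proof. by move=> h; rewrite derive1E derive_val. Qed.

Lemma is_derive_psi t : 0 < 1 + c * t ->
  is_derive t 1 (fun u => psi (x, u)) (- (c / (1 + c * t)) - c / (1 + x + c * t)).
Proof.
move=> h; have h2 : 0 < 1 + x + c * t by have := x0; lra.
exact: (is_deriveB (is_deriveN (is_derive_affine_ln h)) (is_derive_affine_ln h2)).
Qed.

Lemma dt_psi t : 0 < 1 + c * t ->
  dt psi (x, t) = - (c / (1 + c * t)) - c / (1 + x + c * t).
Proof. by move=> h; rewrite dtE; exact/derive1_val/is_derive_psi. Qed.

Lemma dx_psi t : 0 < 1 + c * t -> dx psi (x, t) = - (1 + x + c * t)^-1.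
Proof.
move=> h; have h2 : 0 < (1 + c * t) + 1 * x by have := x0; lra.
rewrite dxE (_ : (fun u => psi (u, t)) =
    fun u => - ln (1 + c * t) - ln ((1 + c * t) + 1 * u)); last first.
  by apply/funext => u; rewrite /Defs.psi /= mul1r [1 + u + _]addrAC.
apply: derive1_val.
have := is_deriveB (is_derive_cst (- ln (1 + c * t)) x (1 : R)) (is_derive_affine_ln h2).
by rewrite sub0r div1r (_ : 1 + c * t + 1 * x = 1 + x + c * t); last by ring.
Qed.

Lemma box_psiE t : 0 < 1 + c * t -> box_psi (x, t) =
  (c ^+ 2) * ((1 + c * t)^-1 * (1 + c * t)^-1 + 2 * ((1 + c * t)^-1 * (1 + x + c * t)^-1)).
Proof.
move=> h; have h2 : 0 < 1 + x + c * t by have := x0; lra.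
by rewrite /Defs.box_psi dt_psi// dx_psi//; ring.
Qed.

Lemma is_derive_phi0 :
  is_derive (0 : R) 1 (fun t => phi (x, t)) (- lam * c * (1 + y) * phi (x, 0)).
Proof.
have h : 0 < 1 + c * 0 by lra.
have := @is_derive1_comp R expR (fun t => lam * psi (x, t)) 0 _ _
  (is_derive_expR (lam * psi (x, 0))) (is_deriveZ lam (is_derive_psi h)).
move=> /is_derive_eq; apply.
by rewrite /GRing.scale /= /Defs.phi mulr0 !addr0 invr1 mulr1; ring.
Qed.

Lemma dt_phi0 : dt phi (x, 0) = - lam * c * (1 + y) * phi (x, 0).
Proof. by rewrite dtE; exact/derive1_val/is_derive_phi0. Qed.

Lemma box_psi0 : box_psi (x, 0) = c ^+ 2 * (1 + 2 * y).
Proof.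
rewrite box_psiE; last by rewrite mulr0 addr0.
by rewrite mulr0 !addr0 invr1; ring.
Qed.

Lemma r0E : r0 x = lam ^+ 2 / 2 * c ^+ 3 * phi (x, 0) *
  (2 + 2 * y + 2 * y ^+ 2 + lam * (1 + 3 * y + 2 * y ^+ 2)).
Proof.
have h : 0 < 1 + c * 0 by lra.
have h1 : 1 + c * 0 != 0 by rewrite gt_eqF.
have h2 : 1 + x + c * 0 != 0 by rewrite gt_eqF//; have := x0; lra.
have near0 : \forall t \near (0 : R), phi (x, t) * ((c ^+ 2) * ((1 + c * t)^-1 * (1 + c * t)^-1
    + 2 * ((1 + c * t)^-1 * (1 + x + c * t)^-1))) = phi (x, t) * box_psi (x, t).
  near=> t; rewrite box_psiE//.
  have : - c^-1 < t by near: t; apply: lt_nbhsr; rewrite oppr_lt0 invr_gt0.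
  rewrite -(ltr_pM2l c0) mulrN divff ?gt_eqF//; lra.
have dA := is_derive_affine_inv h1; have dB := is_derive_affine_inv h2.
have dbox := is_derive_scale (c ^+ 2) (is_derive_add (is_derive_mul dA dA) (is_derive_scale 2 (is_derive_mul dA dB))).
have := near_eq_is_derive near0 (is_derive_mul is_derive_phi0 dbox).
move=> /derive1_val; rewrite /Defs.r0 /dt /= => ->.
rewrite mulr0 !addr0 invr1 expr1n -[(1 + x) ^- 2]exprVn.
by field; rewrite gt_eqF//; have := x0; lra.
Unshelve. all: by end_near. Qed.

End BottomDerivatives.
End Weights.

(** * Bounds for the coefficients at t = 0 *)

Section WeightBounds.
Context {R : realType} (c T lam : R).
Hypotheses (c0 : 0 < c) (T0 : 0 < T) (lam_gt : - (1 / 3) < lam) (lam0 : lam < 0).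
Local Notation phi := (Defs.phi c lam).
Local Notation omega := (Defs.omega c lam).
Local Notation omega0 := (Defs.omega0 c lam).
Local Notation rho := (Defs.rho c lam).
Local Notation a0 := (Defs.a0 c lam).
Local Notation r0 := (Defs.r0 c lam).

Lemma inv1x_bounds (x : R) : 0 <= x -> 0 < (1 + x)^-1 <= 1.
Proof.
move=> x0; have h : 0 < 1 + x by lra.
by rewrite invr_gt0 h invf_le1// lerDl.
Qed.

Lemma dt_phi0_bounds x : 0 <= x ->
  0 <= dt phi (x, 0) <= 2 * c * phi (x, 0).
Proof.
move=> x0; have /andP[y0 y1] := inv1x_bounds x0.
have f0 := phi_gt0 c lam (x, 0); rewrite dt_phi0//.
set y := (1 + x)^-1 in y0 y1 *; set f := phi (x, 0) in f0 *.
have l0 := lam0; have l1 := lam_gt; have cc := c0.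
have k0 : 0 <= - lam * c * (1 + y).
  by apply: mulr_ge0; [apply: mulr_ge0; [lra|exact: ltW]|lra].
have k1 : - lam * c * (1 + y) <= 2 * c.
  have : - lam * (1 + y) <= 2 by nra.
  by move=> /(ler_wpM2r (ltW cc)); lra.
by apply/andP; split; [apply: mulr_ge0 => //; exact: ltW|apply: ler_wpM2r => //; exact: ltW].
Qed.

Lemma a0_bounds x : 0 <= x -> 0 <= a0 x <= 6 * c ^+ 3 * phi (x, 0) ^+ 2.
Proof.
move=> x0; have /andP[y0 y1] := inv1x_bounds x0.
have /andP[d0 d1] := dt_phi0_bounds x0.
have f0 := phi_gt0 c lam (x, 0); rewrite /Defs.a0 box_psi0//.
set d := dt phi (x, 0) in d0 d1 *.
set y := (1 + x)^-1 in y0 y1 *; set f := phi (x, 0) in f0 d0 d1 *.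
have l0 := lam0; have l1 := lam_gt; have cc := c0.
have ll : 0 <= lam ^+ 2 <= 1 by rewrite sqr_ge0/=; nra.
have /andP[ll0 ll1] := ll.
have b0 : 0 <= c ^+ 2 * (1 + 2 * y) by rewrite mulr_ge0 ?sqr_ge0//; lra.
have b1 : c ^+ 2 * (1 + 2 * y) <= 3 * c ^+ 2.
  by rewrite mulrC ler_wpM2r ?sqr_ge0//; lra.
have fl0 : 0 <= lam ^+ 2 * f by apply: mulr_ge0 => //; exact: ltW.
apply/andP; split; first by apply: mulr_ge0 => //; exact: mulr_ge0.
have -> : 6 * c ^+ 3 * f ^+ 2 = 1 * f * (2 * c * f) * (3 * c ^+ 2) by ring.
apply: ler_pM => //; first exact: mulr_ge0.
apply: ler_pM => //.
by apply: ler_wpM2r => //; exact: ltW.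
Qed.

(** The factor 2 + 2 y + 2 y^2 + lam (1 + 3 y + 2 y^2) of [r0], where
    y = 1 / (1 + x), stays positive because [- (1 / 3) < lam]. *)
Lemma r0_bounds x : 0 <= x -> 0 <= r0 x <= 6 * c ^+ 3 * phi (x, 0).
Proof.
move=> x0; have /andP[y0 y1] := inv1x_bounds x0.
have f0 := phi_gt0 c lam (x, 0); rewrite r0E//.
rewrite (_ : 2 + 2 / (1 + x) = 2 + 2 * (1 + x)^-1)//.
set y := (1 + x)^-1 in y0 y1 *; set f := phi (x, 0) in f0 *.
have l0 := lam0; have l1 := lam_gt; have cc := c0.
have y20 := sqr_ge0 y; have y21 : y ^+ 2 <= 1 by nra.
have ll : 0 <= lam ^+ 2 / 2 <= 1 by rewrite mulr_ge0 ?sqr_ge0//=; nra.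
have /andP[ll0 ll1] := ll.
have g0 : 0 <= 2 + 2 * y + 2 * y ^+ 2 + lam * (1 + 3 * y + 2 * y ^+ 2).
  have : (- lam) * (1 + 3 * y + 2 * y ^+ 2) <= (1 / 3) * (1 + 3 * y + 2 * y ^+ 2).
    by rewrite ler_wpM2r//; [lra|lra].
  by lra.
have g1 : 2 + 2 * y + 2 * y ^+ 2 + lam * (1 + 3 * y + 2 * y ^+ 2) <= 6.
  have : 0 <= (- lam) * (1 + 3 * y + 2 * y ^+ 2) by rewrite mulr_ge0//; lra.
  by lra.
have cc3 : 0 <= c ^+ 3 by rewrite exprn_ge0// ltW.
have lc0 : 0 <= lam ^+ 2 / 2 * c ^+ 3 * f.
  by apply: mulr_ge0; [exact: mulr_ge0|exact: ltW].
apply/andP; split; first exact: mulr_ge0.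
have -> : 6 * c ^+ 3 * f = 1 * c ^+ 3 * f * 6 by ring.
apply: ler_pM => //.
by apply: ler_wpM2r; [exact: ltW|exact: ler_wpM2r].
Qed.

Lemma omega0_phi_le_rho s x (h : R) k : (k <= 3)%N -> 0 <= x -> 0 <= h ->
  omega0 s x ^+ 2 * (h * phi (x, 0) ^+ k) <= h * rho s x.
Proof.
move=> k3 x0 h0; rewrite /Defs.rho.
have f1 := @phi_ge1 _ c lam c0 lam0 x 0 x0 (lexx 0).
rewrite mulrCA ler_wpM2l// ler_wpM2l ?sqr_ge0//.
exact: ler_weXn2l.
Qed.

(** At t = 0 the coefficients of the forms [Gfun] and [Ifun] are at most of order
    [phi ^ 3], the power that the weight [rho] contains. *)
Lemma bottom_weights_bound s : exists2 C, 0 <= C & forall x, 0 <= x ->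
  [/\ 0 <= omega0 s x ^+ 2 * (c ^+ 2 * dt phi (x, 0)) <= C * rho s x,
      0 <= omega0 s x ^+ 2 * (r0 x + 2 * s ^+ 2 * phi (x, 0) * a0 x) <= C * rho s x &
      0 <= omega0 s x ^+ 2 * a0 x <= C * rho s x].
Proof.
have c3 : 0 <= c ^+ 3 by rewrite exprn_ge0// ltW.
pose C1 := c ^+ 2 * (2 * c); pose C2 := 6 * c ^+ 3; pose C3 := 2 * s ^+ 2 * C2.
have C10 : 0 <= C1 by rewrite /C1 !mulr_ge0// ltW.
have C20 : 0 <= C2 by rewrite /C2 mulr_ge0.
have C30 : 0 <= C3 by rewrite /C3 mulr_ge0// mulr_ge0// sqr_ge0.
exists (C1 + C2 + C3); first by rewrite !addr_ge0.
move=> x x0; have w0 := sqr_ge0 (omega0 s x).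
have /andP[d0 d1] := dt_phi0_bounds x0; have /andP[aa0 aa1] := a0_bounds x0.
have /andP[rr0 rr1] := r0_bounds x0; have f0 := ltW (phi_gt0 c lam (x, 0)).
have rp := ltW (rho_gt0 c lam s x).
have mC C : C <= C1 + C2 + C3 -> C * rho s x <= (C1 + C2 + C3) * rho s x.
  by move=> h; exact: ler_wpM2r.
have cc0 := sqr_ge0 c; have ss0 := sqr_ge0 s.
have sf0 : 0 <= 2 * s ^+ 2 * phi (x, 0) by apply: mulr_ge0 => //; exact: mulr_ge0.
split; apply/andP; split.
- by apply: mulr_ge0 => //; exact: mulr_ge0.
- apply: le_trans (mC C1 _); last by rewrite -addrA lerDl addr_ge0.
  apply: le_trans (@omega0_phi_le_rho s x _ 1 isT x0 C10).
  by rewrite expr1 ler_wpM2l// /C1 -mulrA ler_wpM2l.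
- by apply: mulr_ge0 => //; apply: addr_ge0 => //; exact: mulr_ge0.
- apply: le_trans (mC (C2 + C3) _); last by rewrite -addrA lerDr.
  rewrite [leLHS]mulrDr [leRHS]mulrDl; apply: lerD.
    apply: le_trans (@omega0_phi_le_rho s x _ 1 isT x0 C20).
    by rewrite expr1 ler_wpM2l.
  apply: le_trans (@omega0_phi_le_rho s x _ 3 isT x0 C30).
  rewrite ler_wpM2l//.
  have -> : C3 * phi (x, 0) ^+ 3 = 2 * s ^+ 2 * phi (x, 0) * (C2 * phi (x, 0) ^+ 2).
    by rewrite /C3; ring.
  exact: ler_wpM2l.
- exact: mulr_ge0.
- apply: le_trans (mC C2 _); last by rewrite addrAC lerDr addr_ge0.
  apply: le_trans (@omega0_phi_le_rho s x _ 2 isT x0 C20).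
  by rewrite ler_wpM2l.
Qed.

Lemma measurable_inv1x :
  measurable_fun half_line ((fun x => (1 + x)^-1) : measurableTypeR R -> R).
Proof.
apply: open_continuous_measurable_fun; first exact: open_half_line.
move=> x; rewrite inE => /half_lineP x0; have h : 1 + x != 0 by rewrite gt_eqF//; lra.
have c1 : {for x, continuous (fun u : R => 1 + u)}.
  by apply: cvgD; [exact: cvg_cst|exact: cvg_id].
exact: (continuousV h c1).
Qed.

Lemma measurable_dt_phi0 :
  measurable_fun half_line ((fun x => dt phi (x, 0)) : measurableTypeR R -> R).
Proof.
apply: (eq_measurable_fun (fun x : measurableTypeR R => - lam * c * (1 + (1 + x)^-1) * phi (x, 0))).
  by move=> x; rewrite inE => /half_lineP x0; rewrite dt_phi0// ltW.
apply: measurable_funM; last exact: measurable_phi0.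
by apply: measurable_funM => //; apply: measurable_funD => //; exact: measurable_inv1x.
Qed.

Lemma measurable_a0 : measurable_fun half_line (a0 : measurableTypeR R -> R).
Proof.
apply: (eq_measurable_fun (fun x : measurableTypeR R =>
  lam ^+ 2 * phi (x, 0) * dt phi (x, 0) * (c ^+ 2 * (1 + 2 * (1 + x)^-1)))).
  by move=> x; rewrite inE => /half_lineP x0; rewrite /Defs.a0 box_psi0// ltW.
apply: measurable_funM.
  apply: measurable_funM; last exact: measurable_dt_phi0.
  by apply: measurable_funM => //; exact: measurable_phi0.
apply: measurable_funM => //; apply: measurable_funD => //; apply: measurable_funM => //.
exact: measurable_inv1x.
Qed.

Lemma measurable_r0 : measurable_fun half_line (r0 : measurableTypeR R -> R).
Proof.
apply: (eq_measurable_fun (fun x : measurableTypeR R =>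
  lam ^+ 2 / 2 * c ^+ 3 * phi (x, 0) *
  (2 + 2 * (1 + x)^-1 + 2 * (1 + x)^-1 ^+ 2 + lam * (1 + 3 * (1 + x)^-1 + 2 * (1 + x)^-1 ^+ 2)))).
  by move=> x; rewrite inE => /half_lineP x0; rewrite r0E// ltW.
have mi := measurable_inv1x.
have mi2 : measurable_fun half_line ((fun x => (1 + x)^-1 ^+ 2) : measurableTypeR R -> R).
  exact: measurable_funX.
apply: measurable_funM; first by apply: measurable_funM => //; exact: measurable_phi0.
apply: measurable_funD.
  apply: measurable_funD; last exact: measurable_funM.
  by apply: measurable_funD => //; exact: measurable_funM.
apply: measurable_funM => //; apply: measurable_funD; last exact: measurable_funM.
by apply: measurable_funD => //; exact: measurable_funM.
Qed.

Lemma supp_dchi_bounds (chi : R -> R) t : Defs.supp_dchi T chi t -> 0 <= t <= T.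
Proof.
move=> h; have : `[0, T]%classic t.
  have -> : `[0, T]%classic = closure `[0, T]%classic.
    by apply/closure_id; exact: itv_closed.
  by move: h; apply: closureS => u [u0 _]; rewrite /= in_itv.
by rewrite /= in_itv.
Qed.

Lemma dchi_out (chi : R -> R) t : 0 <= t <= T -> ~ Defs.supp_dchi T chi t ->
  derive1 chi t = 0.
Proof.
move=> tT; apply: contra_notP => /eqP d; apply: subset_closure; by split.
Qed.

Lemma gamma_le (chi : R -> R) x t : 0 <= x -> Defs.supp_dchi T chi t ->
  Defs.gamma c T lam chi <= phi (x, t) - phi (x, 0).
Proof.
move=> x0 ts; apply: ge_inf; last by exists x, t.
exists 0 => _ [x' [t' [x'0 t's ->]]]; rewrite subr_ge0.
by have /andP[t0 _] := supp_dchi_bounds t's; exact: phi_le_t.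
Qed.

(** On the support of [chi'] the weight has lost the factor [e^(s gamma)]
    with respect to its value on the bottom side. *)
Lemma omega_supp_le s (chi : R -> R) x t : s <= 0 -> 0 <= x ->
  Defs.supp_dchi T chi t ->
  omega s (x, t) ^+ 2 <= expR (2 * s * Defs.gamma c T lam chi) * rho s x.
Proof.
move=> s0 x0 ts.
apply: (@le_trans _ _ (expR (2 * s * Defs.gamma c T lam chi) * omega0 s x ^+ 2)); last first.
  by rewrite ler_wpM2l ?expR_ge0//; exact: omega0_le_rho.
rewrite /Defs.omega0 /Defs.omega -!expRM_natl -expRD ler_expR.
have := ler_wnM2l s0 (gamma_le x0 ts); lra.
Qed.

End WeightBounds.

(** * Weighted quadratic functionals and the state space *)

Section WeightedIntegral.
Context d {T : measurableType d} {R : realType}.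
Variables (mu : {measure set T -> \bar R}) (D : set T).
Hypothesis mD : measurable D.
Implicit Types (w f g h e : T -> R).

Definition wint (w f : T -> R) : \bar R := (\int[mu]_(x in D) (w x * f x ^+ 2)%:E)%E.

(** A density is measurable and nonnegative on the domain, so that its integral is
    additive and monotone without integrability. *)
Definition density (w : T -> R) : Prop := measurable_fun D w /\ forall x, D x -> 0 <= w x.

Lemma wint_ge0 w f : density w -> (0 <= wint w f)%E.
Proof.
by move=> [_ w0]; apply: integral_ge0 => x Dx; rewrite lee_fin mulr_ge0 ?sqr_ge0// w0.
Qed.

Lemma wint_measurable w f : density w -> measurable_fun D f ->
  measurable_fun D (fun x => (w x * f x ^+ 2)%:E).
Proof.
move=> [mw _] mf; apply/measurable_EFinP; apply: measurable_funM => //.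
exact: measurable_funX.
Qed.

Lemma wint_pos w (f : T -> R) x : density w -> D x -> (0 <= (w x * f x ^+ 2)%:E)%E.
Proof. by move=> [_ w0] Dx; rewrite lee_fin mulr_ge0 ?sqr_ge0// w0. Qed.

Lemma wint_ae w f g : density w -> measurable_fun D f -> measurable_fun D g ->
  {ae mu, forall x, D x -> f x = g x} -> wint w f = wint w g.
Proof.
move=> ww mf mg fg; apply: ge0_ae_eq_integral => //.
- exact: wint_measurable.
- exact: wint_measurable.
- by move=> x; exact: wint_pos.
- by move=> x; exact: wint_pos.
- by apply: filterS fg => x h /h ->.
Qed.

Lemma wint_le w w' f (C : R) : density w -> density w' -> measurable_fun D f -> 0 <= C ->
  (forall x, D x -> w x <= C * w' x) -> (wint w f <= C%:E * wint w' f)%E.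
Proof.
move=> ww ww' mf C0 ww'C; rewrite /wint -ge0_integralZl//; first last.
- by move=> x; exact: wint_pos.
- exact: wint_measurable.
apply: ge0_le_integral => //.
- by move=> x; exact: wint_pos.
- exact: wint_measurable.
- by apply: emeasurable_funM => //; exact: wint_measurable.
- move=> x Dx; rewrite -EFinM lee_fin [leRHS]mulrA.
  by apply: ler_wpM2r; [exact: sqr_ge0|exact: ww'C].
Qed.

Lemma wint_lin_fin w f g (a b : R) : density w -> measurable_fun D f -> measurable_fun D g ->
  (wint w f < +oo)%E -> (wint w g < +oo)%E -> (wint w (fun x => (a * f x + b * g x)%R) < +oo)%E.
Proof.
move=> ww mf mg ff gf; have [mw w0] := ww.
pose A := 2 * a ^+ 2; pose B := 2 * b ^+ 2.
have A0 : 0 <= A by rewrite mulr_ge0 ?sqr_ge0.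
have B0 : 0 <= B by rewrite mulr_ge0 ?sqr_ge0.
have mlin : measurable_fun D (fun x => a * f x + b * g x).
  by apply: measurable_funD; apply: measurable_funM.
apply: (@le_lt_trans _ _ (\int[mu]_(x in D) (A%:E * (w x * f x ^+ 2)%:E + B%:E * (w x * g x ^+ 2)%:E))%E).
  apply: ge0_le_integral => //.
  - by move=> x; exact: (wint_pos (fun x => a * f x + b * g x) ww).
  - exact: (wint_measurable ww mlin).
  - by apply: emeasurable_funD; apply: emeasurable_funM => //; exact: wint_measurable.
  - move=> x Dx; rewrite -!EFinM -EFinD lee_fin.
    have -> : A * (w x * f x ^+ 2) + B * (w x * g x ^+ 2) =
      w x * (2 * (a * f x) ^+ 2 + 2 * (b * g x) ^+ 2) by rewrite /A /B; ring.
    apply: ler_wpM2l; first exact: w0.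
    have := sqr_ge0 (a * f x - b * g x); lra.
rewrite ge0_integralD//.
- rewrite !ge0_integralZl//; try exact: wint_measurable; try by move=> x; exact: wint_pos.
  by apply: lte_add_pinfty; apply: lte_mul_pinfty.
- by move=> x Dx; apply: mule_ge0 => //; exact: wint_pos.
- by apply: emeasurable_funM => //; exact: wint_measurable.
- by move=> x Dx; apply: mule_ge0 => //; exact: wint_pos.
- by apply: emeasurable_funM => //; exact: wint_measurable.
Qed.

(** The identities for [h] and [e] hold almost everywhere only, because derivatives
    and traces of linear combinations are known up to null sets. *)
Lemma wint_parallelogram w f g h e : density w ->
  measurable_fun D f -> measurable_fun D g -> measurable_fun D h -> measurable_fun D e ->
  {ae mu, forall x, D x -> h x = 2^-1 * f x + 2^-1 * g x} ->
  {ae mu, forall x, D x -> e x = 1 * f x + -1 * g x} ->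
  ((2 : R)%:E * wint w h + (2^-1 : R)%:E * wint w e = wint w f + wint w g)%E.
Proof.
move=> ww mf mg mh me hE eE; have [mw w0] := ww.
rewrite /wint -!ge0_integralZl//; try exact: wint_measurable; try by move=> x; exact: wint_pos.
have mZ (k : R) (u : T -> R) : measurable_fun D u -> measurable_fun D (fun x => k%:E * (w x * u x ^+ 2)%:E)%E.
  by move=> mu'; apply: emeasurable_funM => //; exact: wint_measurable.
have pZ (k : R) (u : T -> R) x : 0 <= k -> D x -> (0 <= k%:E * (w x * u x ^+ 2)%:E)%E.
  by move=> k0 Dx; apply: mule_ge0 => //; exact: wint_pos.
rewrite -!ge0_integralD//; try exact: wint_measurable; try exact: mZ;
  try (by move=> x; exact: wint_pos); try (by move=> x; apply: pZ).
apply: ge0_ae_eq_integral => //.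
- by apply: emeasurable_funD; exact: mZ.
- by apply: emeasurable_funD; exact: wint_measurable.
- by move=> x Dx; apply: adde_ge0; exact: pZ.
- by move=> x Dx; apply: adde_ge0; exact: wint_pos.
apply: filterS2 hE eE => x h1 h2 Dx; rewrite (h1 Dx) (h2 Dx) -!EFinM -!EFinD; congr EFin.
by field.
Qed.

End WeightedIntegral.

Section StateSpace.
Context {R : realType} (sg : R -> R) (isg : is_step sg).
Context (c T lam : R).
Hypotheses (c0 : 0 < c) (T0 : 0 < T) (lam_gt : - (1 / 3) < lam) (lam0 : lam < 0).
Variable s : R.
Hypothesis s0 : s <= 0.
Local Notation plane := (plane (R := R)).
Local Notation lm := (@lebesgue_measure R).
Local Notation Q := (Qset T).
Local Notation rho := (Defs.rho c lam s).
Local Notation in_X := (Defs.in_X c T lam s).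
Local Notation sqnorm_X := (Defs.sqnorm_X c T lam s).
Local Notation adm := (Defs.adm c T lam s).
Local Notation trace := (trace_t0 T).
Implicit Types (u v : R * R -> R).

Lemma rho_density : @density _ plane R Q (fun p => rho p.1).
Proof.
split; first by apply: weight_measurable; exact: rho_weight.
by move=> p _; exact: ltW (rho_gt0 _ _ _ _).
Qed.

Lemma rho_density1 : @density _ (measurableTypeR R) R half_line rho.
Proof.
by split; [exact: measurable_rho|move=> x _; exact: ltW (rho_gt0 _ _ _ _)].
Qed.

Local Notation wQ := (@wint _ plane R mu2 Q (fun p => rho p.1)).
Local Notation wH := (@wint _ (measurableTypeR R) R lm half_line rho).

Lemma sqnorm_XE m v : sqnorm_X m v =
  (\sum_(j < m.+1) \sum_(k < m.+1 | (j + k <= m)%N) wQ (wD Q j k v))%E.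
Proof. by []. Qed.

Lemma wQ_ge0 v : (0 <= wQ v)%E.
Proof. by apply: wint_ge0; exact: rho_density. Qed.

Lemma sqnorm_X_ge0 m v : (0 <= sqnorm_X m v)%E.
Proof.
by rewrite sqnorm_XE; apply: sume_ge0 => j _; apply: sume_ge0 => k _; exact: wQ_ge0.
Qed.

Lemma wQ_le_sqnorm m v j k : (j + k <= m)%N -> (wQ (wD Q j k v) <= sqnorm_X m v)%E.
Proof.
move=> jk; have jm : (j < m.+1)%N by rewrite ltnS (leq_trans (leq_addr k j)).
have km : (k < m.+1)%N by rewrite ltnS (leq_trans (leq_addl j k)).
rewrite sqnorm_XE (bigD1 (Ordinal jm))//= (bigD1 (Ordinal km))//=.
rewrite -addeA leeDl// adde_ge0//.
  by apply: sume_ge0 => k' _; exact: wQ_ge0.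
by apply: sume_ge0 => j' _; apply: sume_ge0 => k' _; exact: wQ_ge0.
Qed.

Lemma in_X_has m v j k : in_X m v -> (j + k <= m)%N -> has_weak_deriv Q j k v.
Proof. by move=> [h _]; exact: h. Qed.

Lemma in_X_L2w m v j k : in_X m v -> (j + k <= m)%N -> L2w T rho (wD Q j k v).
Proof.
move=> Xv jk; split; first exact: wD_meas (in_X_has Xv jk).
exact: le_lt_trans (wQ_le_sqnorm v jk) Xv.2.
Qed.

Lemma in_X_meas m v : in_X m v -> measurable_fun (Q : set plane) (v : plane -> R).
Proof. by move=> Xv; exact: has_wd_meas (@in_X_has m v 0 0 Xv isT). Qed.

Lemma in_X_ae0 m v : in_X m v -> {ae mu2, forall p, Q p -> wD Q 0 0 v p = v p}.
Proof. by move=> Xv; apply: (wD00 isg); exact: (@in_X_has m v 0 0 Xv isT). Qed.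

Lemma in_X_L2w0 m v : in_X m v -> L2w T rho v.
Proof.
move=> Xv; have [m0 f0] := @in_X_L2w m v 0 0 Xv isT.
split; first exact: in_X_meas Xv.
have := wint_ae (measurable_Qset T) rho_density m0 (in_X_meas Xv) (in_X_ae0 Xv).
by rewrite /wint => <-.
Qed.

Lemma wQ0_le_sqnorm m v : in_X m v -> (wQ v <= sqnorm_X m v)%E.
Proof.
move=> Xv; have [m0 _] := @in_X_L2w m v 0 0 Xv isT.
rewrite -(wint_ae (measurable_Qset T) rho_density m0 (in_X_meas Xv) (in_X_ae0 Xv)).
exact: wQ_le_sqnorm.
Qed.

Lemma sqnorm_X_mono m1 m2 v : (m1 <= m2)%N -> (sqnorm_X m1 v <= sqnorm_X m2 v)%E.
Proof.
move=> mm; rewrite !sqnorm_XE.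
rewrite (big_ord_widen m2.+1 (fun j => \sum_(k < m1.+1 | (j + k <= m1)%N) wQ (wD Q j k v))%E)//.
rewrite big_mkcond/=; apply: lee_sum => j _; case: ifPn => [jm|_]; last first.
  by apply: sume_ge0 => k _; exact: wQ_ge0.
rewrite (big_ord_widen_cond m2.+1 (fun k => (j + k <= m1)%N) (fun k => wQ (wD Q j k v)))//.
rewrite [leLHS]big_mkcond [leRHS]big_mkcond/=; apply: lee_sum => k _.
case: ifPn => [/andP[jk _]|_]; first by rewrite (leq_trans jk mm).
by case: ifPn => // _; exact: wQ_ge0.
Qed.

Lemma in_X_lin m u v (a b : R) : in_X m u -> in_X m v ->
  in_X m (fun p => a * u p + b * v p).
Proof.
move=> Xu Xv; split.
  by move=> j k jk; apply: has_wd_lin; [exact: in_X_has Xu jk|exact: in_X_has Xv jk].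
rewrite sqnorm_XE; apply: lte_sum_pinfty => j _; apply: lte_sum_pinfty => k jk.
have [mu fu] := in_X_L2w Xu jk; have [mv fv] := in_X_L2w Xv jk.
have hu := in_X_has Xu jk; have hv := in_X_has Xv jk.
rewrite (wint_ae (measurable_Qset T) rho_density _ _ (wD_lin a b isg hu hv)).
- exact: wint_lin_fin rho_density mu mv fu fv.
- by apply: wD_meas; exact: has_wd_lin.
- by apply: measurable_funD; apply: measurable_funM.
Qed.

Lemma sqnorm_X_parallelogram m u v : in_X m u -> in_X m v ->
  ((2 : R)%:E * sqnorm_X m (fun p => 2^-1 * u p + 2^-1 * v p)%R
   + (2^-1 : R)%:E * sqnorm_X m (fun p => 1 * u p + -1 * v p)%R =
   sqnorm_X m u + sqnorm_X m v)%E.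
Proof.
move=> Xu Xv; rewrite !sqnorm_XE.
rewrite !ge0_sume_distrr; last 2 first.
- by move=> j _; apply: sume_ge0 => k _; exact: wQ_ge0.
- by move=> j _; apply: sume_ge0 => k _; exact: wQ_ge0.
rewrite -!big_split/=; apply: eq_bigr => j _.
rewrite !ge0_sume_distrr; last 2 first.
- by move=> k _; exact: wQ_ge0.
- by move=> k _; exact: wQ_ge0.
rewrite -!big_split/=; apply: eq_bigr => k jk.
have hu := in_X_has Xu jk; have hv := in_X_has Xv jk.
apply: (wint_parallelogram (measurable_Qset T) rho_density).
- exact: wD_meas.
- exact: wD_meas.
- by apply: wD_meas; exact: has_wd_lin.
- by apply: wD_meas; exact: has_wd_lin.
- exact: (wD_lin _ _ isg hu hv).
- exact: (wD_lin _ _ isg hu hv).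
Qed.

(** [bottom_avg] represents the trace of [v] by [v] and [v_t], and the derivative of
    this trace by [v_x] and [v_xt], which is why order 2 is needed. *)
Lemma in_X_trace m v : (2 <= m)%N -> in_X m v ->
  [/\ is_trace_t0 T v (trace v), is_weak_deriv1 (trace v) (wD1 (trace v)),
      (wH (trace v) < +oo)%E & (wH (wD1 (trace v)) < +oo)%E].
Proof.
move=> m2 Xv; have m1 : (1 <= m)%N by exact: ltnW.
have [zeta tz z1] := plateau_exists isg T0.
have iw := rho_weight c0 lam0 s0.
have Lv := in_X_L2w0 Xv.
have Lt := @in_X_L2w m v 0 1 Xv m1; have Lx := @in_X_L2w m v 1 0 Xv m1.
have Lxt := @in_X_L2w m v 1 1 Xv m2.
have dt := wDP (@in_X_has m v 0 1 Xv m1); have dx := wDP (@in_X_has m v 1 0 Xv m1).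
have dxt := wDP (@in_X_has m v 1 1 Xv m2).
have tr := bottom_avg_trace isg T0 tz z1 iw Lv Lt dt.
have wd := bottom_avg_wd1 isg T0 tz z1 iw Lv Lt Lx Lxt dt dx dxt.
have fp := bottom_avg_L2 T0 tz iw Lv Lt; have fq := bottom_avg_L2 T0 tz iw Lx Lxt.
have trv := trace_t0P tr; have ee := is_trace_t0_unique isg T0 tr trv.
have lp : locally_integrable half_line (trace v) by case: trv.
have wdv := wd1_ae wd lp ee.
have wdv' := wD1P wdv; have ee' := wd1_unique isg wdv wdv'.
split=> //.
- rewrite -(wint_ae measurable_half_line rho_density1 _ _ ee)//.
    by case: tr => -[].
  by case: lp.
- rewrite -(wint_ae measurable_half_line rho_density1 _ _ ee')//.
    by case: wd => _ [].
  by case: wdv' => _ [].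
Qed.

Lemma trace_lin m u v (a b : R) : (2 <= m)%N -> in_X m u -> in_X m v ->
  {ae lm, forall x, half_line x ->
     trace (fun p => a * u p + b * v p) x = a * trace u x + b * trace v x}.
Proof.
move=> m2 Xu Xv; have [tu _ _ _] := in_X_trace m2 Xu; have [tv _ _ _] := in_X_trace m2 Xv.
have [tw _ _ _] := in_X_trace m2 (in_X_lin a b Xu Xv).
exact: (is_trace_t0_unique isg T0 tw (is_trace_t0_lin a b tu tv)).
Qed.

Lemma dtrace_lin m u v (a b : R) : (2 <= m)%N -> in_X m u -> in_X m v ->
  {ae lm, forall x, half_line x ->
     wD1 (trace (fun p => a * u p + b * v p)) x = a * wD1 (trace u) x + b * wD1 (trace v) x}.
Proof.
move=> m2 Xu Xv; have [_ wu _ _] := in_X_trace m2 Xu; have [_ wv _ _] := in_X_trace m2 Xv.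
have [tw ww _ _] := in_X_trace m2 (in_X_lin a b Xu Xv).
have wl := wd1_lin a b wu wv.
have lp : locally_integrable half_line (trace (fun p => a * u p + b * v p)) by case: tw.
have ee := trace_lin a b m2 Xu Xv.
apply: (wd1_unique isg ww); apply: (wd1_ae wl lp).
by apply: ae1S ee => x h /h.
Qed.

Lemma adm_lin m u v (h g p h' g' p' : R -> R) (a b : R) : (2 <= m)%N ->
  adm m h g p u -> adm m h' g' p' v ->
  adm m (fun t => a * h t + b * h' t) (fun t => a * g t + b * g' t)
    (fun t => a * p t + b * p' t) (fun q => a * u q + b * v q).
Proof.
move=> m2 [Xu hu gu pu] [Xv hv gv pv]; have m1 : (1 <= m)%N by exact: ltnW.
have Xw := in_X_lin a b Xu Xv.
split=> //.
- exact: is_trace_x0_lin.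
- apply: is_trace_x0_ae (is_trace_x0_lin a b gu gv).
    exact: wD_meas (@in_X_has m _ 1 0 Xw m1).
  have := wD_lin a b isg (@in_X_has m u 1 0 Xu m1) (@in_X_has m v 1 0 Xv m1).
  by apply: aeS => q e /e.
- apply: is_trace_t0_ae (is_trace_t0_lin a b pu pv).
    exact: wD_meas (@in_X_has m _ 0 1 Xw m1).
  have := wD_lin a b isg (@in_X_has m u 0 1 Xu m1) (@in_X_has m v 0 1 Xv m1).
  by apply: aeS => q e /e.
Qed.

End StateSpace.

(** * The quadratic forms of the trace *)

(** Distributivity of the extended reals needs the signs. *)
Lemma parallelogram_comb {R : realType} (k : R) (xm xd xu xv pm pd pu pv : \bar R) :
  (0 <= k%:E)%E -> (0 <= xm)%E -> (0 <= xd)%E -> (0 <= xu)%E -> (0 <= xv)%E ->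
  (0 <= pm)%E -> (0 <= pd)%E -> (0 <= pu)%E -> (0 <= pv)%E ->
  ((2 : R)%:E * xm + (2^-1 : R)%:E * xd = xu + xv)%E ->
  ((2 : R)%:E * pm + (2^-1 : R)%:E * pd = pu + pv)%E ->
  ((2 : R)%:E * (k%:E * (xm + pm)) + (2^-1 : R)%:E * (k%:E * (xd + pd)) =
   k%:E * (xu + pu) + k%:E * (xv + pv))%E.
Proof.
move=> k0 m0 d0 u0 v0 m0' d0' u0' v0' E1 E2.
have t0 : (0 <= (2 : R)%:E)%E by rewrite lee_fin.
have h0 : (0 <= (2^-1 : R)%:E)%E by rewrite lee_fin invr_ge0.
rewrite -(ge0_muleDr _ (adde_ge0 u0 u0') (adde_ge0 v0 v0')) addeACA -E1 -E2.
rewrite ![(_ * (k%:E * _))%E]muleCA.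
rewrite (ge0_muleDr _ m0 m0') (ge0_muleDr _ d0 d0').
rewrite -(ge0_muleDr k%:E) ?adde_ge0 ?mule_ge0//.
by rewrite addeACA.
Qed.

Section BottomForms.
Context {R : realType} (sg : R -> R) (isg : is_step sg).
Context (c T X lam : R).
Hypotheses (c0 : 0 < c) (T0 : 0 < T) (X0 : 0 < X) (lam_gt : - (1 / 3) < lam) (lam0 : lam < 0).
Variable s : R.
Hypothesis s0 : s <= 0.
Local Notation lm := (@lebesgue_measure R).
Local Notation phi := (Defs.phi c lam).
Local Notation omega0 := (Defs.omega0 c lam s).
Local Notation rho := (Defs.rho c lam s).
Local Notation in_X := (Defs.in_X c T lam s).
Local Notation trace := (trace_t0 T).
Local Notation G := (Defs.Gfun c lam s).
Local Notation I := (Defs.Ifun c X lam s).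
Implicit Types (u v : R * R -> R).

Definition Wx (x : R) : R := omega0 x ^+ 2 * (c ^+ 2 * dt phi (x, 0)).
Definition Wp (x : R) : R :=
  omega0 x ^+ 2 * (Defs.r0 c lam x + 2 * s ^+ 2 * phi (x, 0) * Defs.a0 c lam x).
Definition Wobs (x : R) : R := omega0 x ^+ 2 * Defs.a0 c lam x.

Local Notation wH := (@wint _ (measurableTypeR R) R lm half_line).

Lemma Wx_density : @density _ (measurableTypeR R) R half_line Wx.
Proof.
split.
  apply: measurable_funM; first by apply: measurable_funX; exact: measurable_omega0.
  by apply: measurable_funM => //; exact: measurable_dt_phi0.
move=> x /half_lineP x0; have [C _ h] := bottom_weights_bound c0 lam_gt lam0 s.
by have [/andP[]] := h x (ltW x0).
Qed.

Lemma Wp_density : @density _ (measurableTypeR R) R half_line Wp.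
Proof.
split.
  apply: measurable_funM; first by apply: measurable_funX; exact: measurable_omega0.
  apply: measurable_funD; first exact: measurable_r0.
  apply: measurable_funM; last exact: measurable_a0.
  by apply: measurable_funM => //; exact: measurable_phi0.
move=> x /half_lineP x0; have [C _ h] := bottom_weights_bound c0 lam_gt lam0 s.
by have [_ /andP[]] := h x (ltW x0).
Qed.

Lemma Wobs_density : @density _ (measurableTypeR R) R half_line Wobs.
Proof.
split.
  apply: measurable_funM; first by apply: measurable_funX; exact: measurable_omega0.
  exact: measurable_a0.
move=> x /half_lineP x0; have [C _ h] := bottom_weights_bound c0 lam_gt lam0 s.
by have [_ _ /andP[]] := h x (ltW x0).
Qed.

Lemma bottom_wint_fin (w p : R -> R) : w = Wx \/ w = Wp \/ w = Wobs ->
  measurable_fun half_line (p : measurableTypeR R -> R) ->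
  (wH rho p < +oo)%E -> (wH w p < +oo)%E.
Proof.
move=> hw mp pfin; have [C C0 h] := bottom_weights_bound c0 lam_gt lam0 s.
have ww : @density _ (measurableTypeR R) R half_line w.
  by case: hw => [->|[->|->]]; [exact: Wx_density|exact: Wp_density|exact: Wobs_density].
apply: le_lt_trans (wint_le lm measurable_half_line ww (rho_density1 c lam s) mp C0 _) _; last first.
  by apply: lte_mul_pinfty => //; exact: wint_ge0 lm p (rho_density1 c lam s).
move=> x /half_lineP x0; have [/andP[_ h1] /andP[_ h2] /andP[_ h3]] := h x (ltW x0).
by case: hw => [->|[->|->]].
Qed.

Lemma GfunE (p : R -> R) : measurable_fun half_line (p : measurableTypeR R -> R) ->
  measurable_fun half_line (wD1 p : measurableTypeR R -> R) ->
  (G p = (- s)%:E * (wH Wx (wD1 p) + wH Wp p))%E.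
Proof.
move=> mp mq; rewrite /Defs.Gfun; congr (_ * _)%E.
rewrite /wint -ge0_integralD//.
- apply: eq_integral => x _; rewrite -EFinD; congr EFin.
  by rewrite /Wx /Wp; ring.
- by move=> x; exact: wint_pos Wx_density.
- exact: wint_measurable Wx_density mq.
- by move=> x; exact: wint_pos Wp_density.
- exact: wint_measurable Wp_density mp.
Qed.

Lemma trace_meas m v : (2 <= m)%N -> in_X m v ->
  measurable_fun half_line (trace v : measurableTypeR R -> R) /\
  measurable_fun half_line (wD1 (trace v) : measurableTypeR R -> R).
Proof.
move=> m2 Xv; have [tv wv _ _] := in_X_trace isg c0 T0 lam0 s0 m2 Xv.
by split; [case: tv => -[]|case: wv => _ []].
Qed.

Lemma Gfun_trace_fin m v : (2 <= m)%N -> in_X m v -> (0 <= G (trace v) < +oo)%E.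
Proof.
move=> m2 Xv; have [mp mq] := trace_meas m2 Xv.
have [_ _ fp fq] := in_X_trace isg c0 T0 lam0 s0 m2 Xv.
rewrite GfunE//; have ns : (0 <= (- s)%:E)%E by rewrite lee_fin oppr_ge0.
have g1 := wint_ge0 lm (wD1 (trace v)) Wx_density.
have g2 := wint_ge0 lm (trace v) Wp_density.
apply/andP; split; first by apply: mule_ge0 => //; exact: adde_ge0.
apply: lte_mul_pinfty => //; apply: lte_add_pinfty.
  by apply: bottom_wint_fin => //; left.
by apply: bottom_wint_fin => //; right; left.
Qed.

Lemma Gfun_parallelogram m u v : (2 <= m)%N -> in_X m u -> in_X m v ->
  ((2 : R)%:E * G (trace (fun p => 2^-1 * u p + 2^-1 * v p)%R)
   + (2^-1 : R)%:E * G (trace (fun p => 1 * u p + -1 * v p)%R) =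
   G (trace u) + G (trace v))%E.
Proof.
move=> m2 Xu Xv; set um := (fun p => 2^-1 * _ + _)%R; set ud := (fun p => 1 * _ + _)%R.
have Xm : in_X m um := in_X_lin isg c0 lam0 s0 2^-1 2^-1 Xu Xv.
have Xd : in_X m ud := in_X_lin isg c0 lam0 s0 1 (-1) Xu Xv.
have [mu mu'] := trace_meas m2 Xu; have [mv mv'] := trace_meas m2 Xv.
have [mm mm'] := trace_meas m2 Xm; have [md md'] := trace_meas m2 Xd.
rewrite !GfunE//.
have ns : (0 <= (- s)%:E)%E by rewrite lee_fin oppr_ge0.
have P1 := wint_parallelogram measurable_half_line Wx_density mu' mv' mm' md'
  (dtrace_lin isg c0 T0 lam0 s0 2^-1 2^-1 m2 Xu Xv) (dtrace_lin isg c0 T0 lam0 s0 1 (-1) m2 Xu Xv).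
have P2 := wint_parallelogram measurable_half_line Wp_density mu mv mm md
  (trace_lin isg c0 T0 lam0 s0 2^-1 2^-1 m2 Xu Xv) (trace_lin isg c0 T0 lam0 s0 1 (-1) m2 Xu Xv).
have gx f := wint_ge0 lm f Wx_density; have gp f := wint_ge0 lm f Wp_density.
exact: parallelogram_comb ns (gx _) (gx _) (gx _) (gx _) (gp _) (gp _) (gp _) (gp _) P1 P2.
Qed.

Lemma Ifun_trace_fin m v : (2 <= m)%N -> in_X m v -> (0 <= I (trace v) < +oo)%E.
Proof.
move=> m2 Xv; have [mp mq] := trace_meas m2 Xv.
have [_ _ fp fq] := in_X_trace isg c0 T0 lam0 s0 m2 Xv.
have [_ w0] := Wobs_density.
have sub : obs_int X `<=` half_line.
  by move=> x; rewrite /obs_int /= in_itv/= => /andP[x0 _]; exact/half_lineP.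
have mo : measurable (obs_int X : set (measurableTypeR R)) by exact: measurable_itv.
apply/andP; split.
  apply: integral_ge0 => x /sub Hx; rewrite lee_fin mulr_ge0 ?sqr_ge0//.
  exact: w0.
apply: (@le_lt_trans _ _ (wH Wobs (trace v))).
  apply: ge0_subset_integral => //.
    exact: wint_measurable Wobs_density mp.
  by move=> x; exact: wint_pos Wobs_density.
by apply: bottom_wint_fin => //; right; right.
Qed.

End BottomForms.

(** * The energy of a cut-off function *)

Section Density.
Context d {T : measurableType d} {R : realType}.
Variables (mu : {measure set T -> \bar R}) (D : set T).
Hypothesis mD : measurable D.
Implicit Types (F G H : T -> R).

Local Notation density := (density D).

Definition dint F : \bar R := (\int[mu]_(x in D) (F x)%:E)%E.

Lemma dint_ge0 F : density F -> (0 <= dint F)%E.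
Proof. by move=> [_ F0]; apply: integral_ge0 => x Dx; rewrite lee_fin; exact: F0. Qed.

Lemma dint_le F G : density F -> density G ->
  {ae mu, forall x, D x -> F x <= G x} -> (dint F <= dint G)%E.
Proof.
move=> [mF F0] [mG G0] FG; apply: ae_ge0_le_integral => //.
- exact/measurable_EFinP.
- exact/measurable_EFinP.
Qed.

Lemma densityD F G : density F -> density G -> density (fun x => F x + G x).
Proof.
move=> [mF F0] [mG G0]; split; first exact: measurable_funD.
by move=> x Dx; rewrite addr_ge0 ?F0 ?G0.
Qed.

Lemma densityZ (a : R) F : 0 <= a -> density F -> density (fun x => a * F x).
Proof.
move=> a0 [mF F0]; split; first exact: measurable_funM.
by move=> x Dx; rewrite mulr_ge0 ?F0.
Qed.

Lemma density_sqr (w f : T -> R) : density w -> measurable_fun D f ->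
  density (fun x => w x * f x ^+ 2).
Proof.
move=> [mw w0] mf; split; first by apply: measurable_funM => //; exact: measurable_funX.
by move=> x Dx; rewrite mulr_ge0 ?sqr_ge0 ?w0.
Qed.

Lemma density_sqr1 (f : T -> R) : measurable_fun D f -> density (fun x => f x ^+ 2).
Proof. by move=> mf; split; [exact: measurable_funX|move=> x _; exact: sqr_ge0]. Qed.

Lemma dintD F G : density F -> density G ->
  dint (fun x => F x + G x) = (dint F + dint G)%E.
Proof.
move=> [mF F0] [mG G0]; rewrite /dint -ge0_integralD//.
- exact/measurable_EFinP.
- exact/measurable_EFinP.
Qed.

Lemma dintZ (a : R) F : 0 <= a -> density F -> dint (fun x => a * F x) = (a%:E * dint F)%E.
Proof.
move=> a0 [mF F0]; rewrite /dint -ge0_integralZl//.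
- exact/measurable_EFinP.
Qed.

Lemma dintZ_fin (a : R) F : 0 <= a -> density F -> (dint F < +oo)%E ->
  (dint (fun x => a * F x)%R < +oo)%E.
Proof. by move=> a0 dF fF; rewrite dintZ//; apply: lte_mul_pinfty. Qed.

(** The pointwise form of the midpoint inequality: the defect of the right side is
    the square of [b / 2 + n]. *)
Lemma midpoint_dint (A1 A2 b a1 a2 n : T -> R) :
  measurable_fun D A1 -> measurable_fun D A2 -> measurable_fun D b ->
  measurable_fun D a1 -> measurable_fun D a2 -> measurable_fun D n ->
  {ae mu, forall x, D x -> [/\ A1 x = a1 x - 2^-1 * b x, A2 x = a2 x + 2^-1 * b x &
     a1 x - a2 x = b x + n x]} ->
  (dint (fun x => A1 x ^+ 2)%R + dint (fun x => A2 x ^+ 2)%R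
   + (4^-1 : R)%:E * dint (fun x => b x ^+ 2)%R <=
   dint (fun x => a1 x ^+ 2)%R + dint (fun x => a2 x ^+ 2)%R + dint (fun x => n x ^+ 2)%R)%E.
Proof.
move=> /density_sqr1 A1d /density_sqr1 A2d /density_sqr1 bd /density_sqr1 a1d /density_sqr1 a2d.
move=> /density_sqr1 nd hae; have q0 : 0 <= (4^-1 : R) by rewrite invr_ge0.
rewrite -dintZ// -!dintD//; try exact: densityD; try exact: densityZ.
apply: dint_le.
- by apply: densityD; [exact: densityD|exact: densityZ].
- by apply: densityD => //; exact: densityD.
apply: filterS hae => x hx Dx; have [-> -> e] := hx Dx.
have -> : b x = a1 x - a2 x - n x by rewrite e; ring.
have := sqr_ge0 (a1 x - a2 x + n x); nra.
Qed.

End Density.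

Section DataEnergy.
Context {R : realType} (sg : R -> R) (isg : is_step sg).
Context (c T X lam Tm Tp : R) (chi : R -> R).
Hypotheses (c0 : 0 < c) (T0 : 0 < T) (lam_gt : - (1 / 3) < lam) (lam0 : lam < 0).
Hypothesis chiP : is_cutoff T Tm Tp chi.
Variable M1 : R.
Hypothesis M1P : forall t, 0 <= t <= T -> derive1 chi t ^+ 2 <= M1.
Variable s : R.
Hypothesis s0 : s <= 0.
Local Notation plane := (plane (R := R)).
Local Notation Q := (Qset T).
Local Notation phi := (Defs.phi c lam).
Local Notation omega := (Defs.omega c lam s).
Local Notation rho := (Defs.rho c lam s).
Local Notation in_X := (Defs.in_X c T lam s).
Local Notation adm := (Defs.adm c T lam s).
Local Notation box := (Defs.box c T).
Local Notation vt := (v_t T).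
Local Notation vx := (v_x T).
Local Notation in_L2 := (Defs.in_L2 T).
Local Notation S := (sqnorm_L2 T).
Local Notation E := (Efun c T lam s).
Local Notation cut := (Defs.cut chi).
Local Notation dintQ := (@dint _ plane R mu2 Q).
Local Notation densQ := (@density _ plane R Q).
Local Notation measQ f := (measurable_fun (Q : set plane) (f : plane -> R)).
Implicit Types (u v w z : R * R -> R).

Let mQ := measurable_Qset T.
Local Notation k p := (omega p * chi p.2).

Lemma measurable_snd_Q (a : R -> R) : smooth1 a -> measQ (fun p => a p.2).
Proof.
move=> ha; have ca : continuous a := smooth1_continuous ha.
apply: (@measurable_funS _ _ plane _ setT) => //.
apply: continuous_measurable2 => p; apply: (@continuous_comp _ _ _ snd a p).
  exact: cvg_snd.
exact: ca.
Qed.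

Lemma chi_smooth : smooth1 chi. Proof. by case: chiP. Qed.

Lemma chi_sqr_le1 t : 0 <= t <= T -> chi t ^+ 2 <= 1.
Proof. by case: chiP => _ h _ _ /h /andP[? ?]; rewrite expr_le1. Qed.

Lemma measurable_k : measQ (fun p => k p).
Proof.
apply: measurable_funM; first exact: measurable_omega.
by apply: measurable_snd_Q; exact: chi_smooth.
Qed.

Lemma k_sqr_le p : Q p -> k p ^+ 2 <= rho p.1.
Proof.
case: p => x t [/= x0 /andP[t0 tT]].
have h1 := omega_le_rho c0 lam0 s0 (ltW x0) (ltW t0).
have tI : 0 <= t <= T by rewrite !ltW.
rewrite exprMn; apply: le_trans h1; rewrite -[leRHS]mulr1.
by apply: ler_wpM2l; [exact: sqr_ge0|exact: chi_sqr_le1].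
Qed.

Lemma S_fin g : in_L2 g -> (0 <= S g < +oo)%E.
Proof.
move=> [mg fg]; rewrite fg andbT.
by apply: integral_ge0 => p _; rewrite lee_fin sqr_ge0.
Qed.

Lemma SE g : S g = @wint _ plane R mu2 Q (fun=> 1) g.
Proof. by apply: eq_integral => p _; rewrite mul1r. Qed.

Lemma density1 : @density _ plane R Q (fun=> 1).
Proof. by split; [exact: measurable_cst|move=> *; exact: ler01]. Qed.

Lemma in_L2_lin (a b : R) g1 g2 : in_L2 g1 -> in_L2 g2 ->
  in_L2 (fun p => a * g1 p + b * g2 p).
Proof.
move=> [m1 f1] [m2 f2]; split; first by apply: measurable_funD; apply: measurable_funM.
move: f1 f2; rewrite !SE => f1 f2.
exact: (@wint_lin_fin _ plane R mu2 Q mQ _ _ _ a b density1 m1 m2 f1 f2).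
Qed.

Lemma in_L2_dom g v : measQ g -> L2w T rho v ->
  (forall p, Q p -> g p ^+ 2 <= k p ^+ 2 * v p ^+ 2) -> in_L2 g.
Proof.
move=> mg [mv fv] gv; split=> //; apply: le_lt_trans fv.
apply: (@dint_le _ plane R mu2 Q mQ (fun p => g p ^+ 2) (fun p => rho p.1 * v p ^+ 2)).
- exact: density_sqr1.
- exact: density_sqr (rho_density T c0 lam0 s0) mv.
- apply/aeW => p Qp; apply: le_trans (gv p Qp) _.
  by apply: ler_wpM2r; [exact: sqr_ge0|exact: k_sqr_le].
Qed.

Lemma k_in_L2 v : L2w T rho v -> in_L2 (fun p => k p * v p).
Proof.
move=> Lv; apply: (in_L2_dom _ Lv).
  by case: Lv => mv _; apply: measurable_funM => //; exact: measurable_k.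
by move=> p _; rewrite exprMn.
Qed.

Lemma box_meas m v : (2 <= m)%N -> in_X m v -> measQ (box v).
Proof.
move=> m2 Xv; apply: measurable_funB.
  exact: wD_meas (@in_X_has _ _ _ _ _ m v 0 2 Xv m2).
by apply: measurable_funM => //; exact: wD_meas (@in_X_has _ _ _ _ _ m v 2 0 Xv m2).
Qed.

Lemma L2w_lin (a b : R) u v : L2w T rho u -> L2w T rho v ->
  L2w T rho (fun p => a * u p + b * v p).
Proof.
move=> [m1 f1] [m2 f2]; split; first by apply: measurable_funD; apply: measurable_funM.
exact: (@wint_lin_fin _ plane R mu2 Q mQ _ _ _ a b (rho_density T c0 lam0 s0) m1 m2 f1 f2).
Qed.

Lemma box_L2w m v : (2 <= m)%N -> in_X m v -> L2w T rho (box v).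
Proof.
move=> m2 Xv; have L1 := @in_X_L2w _ _ _ _ c0 lam0 _ s0 m v 0 2 Xv m2.
have L2 := @in_X_L2w _ _ _ _ c0 lam0 _ s0 m v 2 0 Xv m2.
rewrite (_ : box v = fun p => 1 * wD Q 0 2 v p + (- c ^+ 2) * wD Q 2 0 v p).
  exact: L2w_lin.
by apply: funext => p; rewrite /Defs.box mul1r mulNr.
Qed.

Lemma box_lin m u v (a b : R) : (2 <= m)%N -> in_X m u -> in_X m v ->
  {ae mu2, forall p, Q p -> box (fun p => a * u p + b * v p) p = a * box u p + b * box v p}.
Proof.
move=> m2 Xu Xv.
have e1 := wD_lin a b isg (@in_X_has _ _ _ _ _ m u 0 2 Xu m2) (@in_X_has _ _ _ _ _ m v 0 2 Xv m2).
have e2 := wD_lin a b isg (@in_X_has _ _ _ _ _ m u 2 0 Xu m2) (@in_X_has _ _ _ _ _ m v 2 0 Xv m2).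
apply: aeS2 e1 e2 => p h1 h2 Qp.
rewrite /Defs.box (h1 Qp) (h2 Qp).
move: (wD Q 0 2 u p) (wD Q 0 2 v p) (wD Q 2 0 u p) (wD Q 2 0 v p) => *; ring.
Qed.

Lemma cut_vx m v : (1 <= m)%N -> in_X m v ->
  measQ (vx (cut v)) /\ {ae mu2, forall p, Q p -> vx (cut v) p = chi p.2 * vx v p}.
Proof.
move=> m1 Xv; have W := wd_cut_x chi_smooth (wDP (@in_X_has _ _ _ _ _ m v 1 0 Xv m1)).
split; last exact: wD_unique isg W.
by apply: wD_meas; exists (cut (wD Q 1 0 v)).
Qed.

Lemma cut_vt m v : (1 <= m)%N -> in_X m v ->
  measQ (vt (cut v)) /\
  {ae mu2, forall p, Q p ->
    vt (cut v) p = (chi p.2 * vt v p + derive1 chi p.2 * v p)}.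
Proof.
move=> m1 Xv; have W := wd_cut_t chi_smooth (wDP (@in_X_has _ _ _ _ _ m v 0 1 Xv m1)).
split; last exact: wD_unique isg W.
by apply: wD_meas; eexists; exact: W.
Qed.

Definition energy v (p : R * R) : R :=
  omega p ^+ 2 * ((- s) ^+ 3 * phi p ^+ 3 * v p ^+ 2 + (- s) * (vt v p ^+ 2 + vx v p ^+ 2)).

Lemma energy_density m v : (1 <= m)%N -> in_X m v -> densQ (energy (cut v)).
Proof.
move=> m1 Xv; have [mx _] := cut_vx m1 Xv; have [mt _] := cut_vt m1 Xv.
have mc : measQ (cut v).
  by apply: measurable_funM; [apply: measurable_snd_Q; exact: chi_smooth|exact: in_X_meas Xv].
split.
  apply: measurable_funM; first by apply: measurable_funX; exact: measurable_omega.
  apply: measurable_funD.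
    apply: measurable_funM; last exact: measurable_funX.
    by apply: measurable_funM => //; apply: measurable_funX; exact: measurable_phi.
  apply: measurable_funM; first exact: measurable_cst.
  by apply: measurable_funD; [exact: (measurable_funX 2 mt)|exact: (measurable_funX 2 mx)].
move=> p _; have ns : 0 <= - s by rewrite oppr_ge0.
apply: mulr_ge0; first exact: sqr_ge0.
apply: addr_ge0; last by apply: mulr_ge0 => //; apply: addr_ge0; exact: sqr_ge0.
apply: mulr_ge0; last exact: sqr_ge0.
by apply: mulr_ge0; apply: exprn_ge0 => //; exact: ltW (phi_gt0 _ _ _).
Qed.

Lemma Efun_ge0 m v : (1 <= m)%N -> in_X m v -> (0 <= E (cut v))%E.
Proof. by move=> m1 Xv; exact: (dint_ge0 _ (energy_density m1 Xv)). Qed.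

Lemma M1_ge0 : 0 <= M1.
Proof. by apply: le_trans (M1P (t := 0) _); [exact: sqr_ge0|rewrite lexx ltW]. Qed.

(** The letters are values at one point of Q: [q], [a], [b] of [v], [v_t], [v_x];
    [al], [be] of [chi] and its derivative; [om] of [omega], [ph] of [phi ^ 3], [r]
    of [rho]; [y] is [- s] and [k3] its cube. *)
Lemma energy_bound (q r y a b al be P3 ph om k3 : R) :
  0 <= y -> 0 <= k3 -> al ^+ 2 <= 1 -> be ^+ 2 <= M1 ->
  om ^+ 2 <= r -> om ^+ 2 * ph <= P3 * r -> 0 <= ph ->
  om ^+ 2 * (k3 * ph * (al * q) ^+ 2 + y * ((al * a + be * q) ^+ 2 + (al * b) ^+ 2)) <=
  (k3 * P3 + 2 * y * M1) * (r * q ^+ 2) + 2 * y * (r * a ^+ 2) + y * (r * b ^+ 2).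
Proof.
move=> y0 k30 al1 be1 omr omph ph0.
have o0 := sqr_ge0 om.
have q0 := sqr_ge0 q; have a0 := sqr_ge0 a; have b0 := sqr_ge0 b.
have H (d e u : R) : 0 <= u -> 0 <= d -> e ^+ 2 <= d -> om ^+ 2 * (e ^+ 2 * u) <= d * (r * u).
  move=> u0 d0 ed; rewrite mulrCA; apply: ler_pM => //; first exact: sqr_ge0.
    exact: mulr_ge0.
  exact: ler_wpM2r.
have h1 : k3 * (om ^+ 2 * ph * (al ^+ 2 * q ^+ 2)) <= k3 * (P3 * r * q ^+ 2).
  apply: ler_wpM2l => //; apply: ler_pM => //; first exact: mulr_ge0.
    by apply: mulr_ge0 => //; exact: sqr_ge0.
  by rewrite -[leRHS]mul1r; apply: ler_wpM2r.
have h2 : om ^+ 2 * (al ^+ 2 * a ^+ 2) <= 1 * (r * a ^+ 2) by exact: H.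
have h3 : om ^+ 2 * (al ^+ 2 * b ^+ 2) <= 1 * (r * b ^+ 2) by exact: H.
have h4 : om ^+ 2 * (be ^+ 2 * q ^+ 2) <= M1 * (r * q ^+ 2) by apply: H => //; exact: M1_ge0.
have h5 : om ^+ 2 * (al * a + be * q) ^+ 2 <=
   2 * (om ^+ 2 * (al ^+ 2 * a ^+ 2)) + 2 * (om ^+ 2 * (be ^+ 2 * q ^+ 2)).
  have -> : 2 * (om ^+ 2 * (al ^+ 2 * a ^+ 2)) + 2 * (om ^+ 2 * (be ^+ 2 * q ^+ 2)) =
    om ^+ 2 * (2 * (al * a) ^+ 2 + 2 * (be * q) ^+ 2) by ring.
  apply: ler_wpM2l => //; have := sqr_ge0 (al * a - be * q); lra.
have h6 : y * (om ^+ 2 * (al * a + be * q) ^+ 2 + om ^+ 2 * (al ^+ 2 * b ^+ 2)) <=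
   y * (2 * (r * a ^+ 2) + 2 * (M1 * (r * q ^+ 2)) + r * b ^+ 2).
  by apply: ler_wpM2l => //; lra.
lra.
Qed.

Lemma Efun_fin m v : (1 <= m)%N -> in_X m v -> (E (cut v) < +oo)%E.
Proof.
move=> m1 Xv; have [_ ex] := cut_vx m1 Xv; have [_ et] := cut_vt m1 Xv.
have [mq fq] := in_X_L2w0 isg c0 lam0 s0 Xv.
have [ma fa] := @in_X_L2w _ _ _ _ c0 lam0 _ s0 m v 0 1 Xv m1.
have [mb fb] := @in_X_L2w _ _ _ _ c0 lam0 _ s0 m v 1 0 Xv m1.
have ns : 0 <= - s by rewrite oppr_ge0.
pose A := (- s) ^+ 3 * phi_ratio c T lam ^+ 3 + 2 * (- s) * M1.
have A0 : 0 <= A.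
  apply: addr_ge0; last by apply: mulr_ge0; [exact: mulr_ge0|exact: M1_ge0].
  apply: mulr_ge0; apply: exprn_ge0 => //.
  by apply: le_trans (phi_ratio_ge1 c0 T0 lam0); exact: ler01.
have y20 : 0 <= 2 * (- s) by exact: mulr_ge0.
have dq := density_sqr (rho_density T c0 lam0 s0) mq; have da := density_sqr (rho_density T c0 lam0 s0) ma.
have db := density_sqr (rho_density T c0 lam0 s0) mb.
have Aq := densityZ A0 dq; have Aa := densityZ y20 da; have Ab := densityZ ns db.
have dF := densityD Aq Aa; have dG := densityD dF Ab.
set G := (X in densQ X) in dG.
apply: (@le_lt_trans _ _ (dintQ G)).
  apply: (dint_le mQ (energy_density m1 Xv) dG).
  apply: aeS2 ex et => -[x t] hx ht Qp; rewrite /energy /G (hx Qp) (ht Qp) /Defs.cut.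
  have [/= x0 /andP[t0 tT]] := Qp.
  have tI : 0 <= t <= T by rewrite !ltW.
  apply: energy_bound => //.
  - exact: exprn_ge0.
  - exact: chi_sqr_le1.
  - exact: M1P.
  - exact: (omega_le_rho c0 lam0 s0 (ltW x0) (ltW t0)).
  - exact: (omega_phi3_le_rho c0 lam0 s0 (ltW x0) (ltW t0) (ltW tT)).
  - by apply: exprn_ge0; exact: ltW (phi_gt0 _ _ _).
rewrite /G.
rewrite (dintD mu2 mQ dF Ab).
rewrite (dintD mu2 mQ Aq Aa).
apply: lte_add_pinfty; first apply: lte_add_pinfty.
- exact: (dintZ_fin mQ A0 dq fq).
- exact: (dintZ_fin mQ y20 da fa).
- exact: (dintZ_fin mQ ns db fb).
Qed.

End DataEnergy.

(** * The nonlinear term *)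

Lemma sqr_le_of_norm {R : realType} (x y : R) : `|x| <= y -> x ^+ 2 <= y ^+ 2.
Proof.
move=> xy; rewrite -(real_normK (num_real x)); apply: lerXn2r => //; rewrite nnegrE//.
exact: le_trans xy.
Qed.

Section Nonlinearity.
Context {R : realType} (sg : R -> R) (isg : is_step sg).
Context (c T X lam Tm Tp : R) (chi : R -> R).
Hypotheses (c0 : 0 < c) (T0 : 0 < T) (lam_gt : - (1 / 3) < lam) (lam0 : lam < 0).
Hypothesis chiP : is_cutoff T Tm Tp chi.
Variable M1 : R.
Hypothesis M1P : forall t, 0 <= t <= T -> derive1 chi t ^+ 2 <= M1.
Variables (N : R -> R -> R -> R -> R -> R) (K0 K1 K2 : R).
Hypotheses (K00 : 0 <= K0) (K10 : 0 <= K1) (K20 : 0 <= K2) (N_lip : lipschitzN T N K0 K1 K2).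
Variable s : R.
Hypothesis s0 : s <= 0.
Local Notation plane := (plane (R := R)).
Local Notation Q := (Qset T).
Local Notation phi := (Defs.phi c lam).
Local Notation omega := (Defs.omega c lam s).
Local Notation rho := (Defs.rho c lam s).
Local Notation in_X := (Defs.in_X c T lam s).
Local Notation box := (Defs.box c T).
Local Notation vt := (v_t T).
Local Notation vx := (v_x T).
Local Notation in_L2 := (Defs.in_L2 T).
Local Notation S := (sqnorm_L2 T).
Local Notation E := (Efun c T lam s).
Local Notation cut := (Defs.cut chi).
Local Notation wQ := (@wint _ plane R mu2 Q (fun p => rho p.1)).
Local Notation NU := (NU T N).
Local Notation gam := (Defs.gamma c T lam chi).
Local Notation dintQ := (@dint _ plane R mu2 Q).
Local Notation densQ := (@density _ plane R Q).
Local Notation measQ f := (measurable_fun (Q : set plane) (f : plane -> R)).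
Implicit Types (u v w z U V : R * R -> R).

Local Notation mid u v := (fun p => 2^-1 * u p + 2^-1 * v p).
Local Notation diff u v := (fun p => 1 * u p + -1 * v p).
Let mQ := measurable_Qset T.
Local Notation k p := (omega p * chi p.2).
Let L := K0 ^+ 2 + K1 ^+ 2 + K2 ^+ 2.

Lemma L_ge0 : 0 <= L.
Proof. by rewrite /L; do !apply: addr_ge0; exact: sqr_ge0. Qed.

Lemma lipschitz0 x t a b d : Q (x, t) ->
  `|N x t a b d - N x t 0 0 0| <= K0 * `|a| + K1 * `|b| + K2 * `|d|.
Proof. by move=> Qp; have := N_lip Qp a b d 0 0 0; rewrite !subr0. Qed.

Lemma lipschitz_diff x t a b d a' b' d' q qt qx : Q (x, t) ->
  q = 1 * a + -1 * a' -> qt = 1 * b + -1 * b' -> qx = 1 * d + -1 * d' ->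
  `|N x t a b d - N x t a' b' d'| <= K0 * `|q| + K1 * `|qt| + K2 * `|qx|.
Proof. by move=> Qp -> -> ->; rewrite !mul1r !mulN1r; exact: N_lip. Qed.

Lemma L2w_norm v : L2w T rho v -> L2w T rho (fun p => `|v p|).
Proof.
move=> [mv fv]; split; first exact: measurableT_comp.
by under eq_integral do rewrite (real_normK (num_real _)).
Qed.

Lemma L2w_lin3 (a b d : R) u v w : L2w T rho u -> L2w T rho v -> L2w T rho w ->
  L2w T rho (fun p => a * u p + b * v p + d * w p).
Proof.
move=> Lu Lv Lw.
have := L2w_lin c0 lam0 s0 1 d (L2w_lin c0 lam0 s0 a b Lu Lv) Lw.
by congr (L2w _ _ _); apply: funext => p; rewrite mul1r.
Qed.

(** Finiteness of the data term: the Lipschitz bound compares [N(.,U,U_t,U_x)] with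
    [N(.,0,0,0)], whose weighted norm is finite by assumption. *)
Lemma defect_in_L2 (f : R * R -> R) m U v : (2 <= m)%N -> in_X m U -> in_X m v ->
  in_L2 (fun p => k p * f p) -> in_L2 (fun p => k p * N p.1 p.2 0 0 0) ->
  measQ (NU U) -> in_L2 (fun p => k p * (box v p + NU U p - f p)).
Proof.
move=> m2 XU Xv Lf LN mN; have m1 : (1 <= m)%N by exact: ltnW.
have Lb := k_in_L2 c0 lam0 chiP s0 (box_L2w c0 lam0 s0 m2 Xv).
have [mN0 _] := LN.
have LU := L2w_norm (in_X_L2w0 isg c0 lam0 s0 XU).
have Lt := L2w_norm (@in_X_L2w _ _ _ _ c0 lam0 _ s0 m U 0 1 XU m1).
have Lx := L2w_norm (@in_X_L2w _ _ _ _ c0 lam0 _ s0 m U 1 0 XU m1).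
have Lw := L2w_lin3 K0 K1 K2 LU Lt Lx.
pose g := fun p => k p * NU U p - k p * N p.1 p.2 0 0 0.
have Lg : in_L2 g.
  apply: (in_L2_dom c0 lam0 chiP s0 _ Lw).
    apply: measurable_funB => //; apply: measurable_funM => //.
    exact: (measurable_k _ _ chiP).
  move=> [x t] Qp; rewrite /g -mulrBr exprMn.
  apply: ler_wpM2l; first exact: sqr_ge0.
  have hN : `|NU U (x, t) - N x t 0 0 0| <=
      K0 * `|U (x, t)| + K1 * `|vt U (x, t)| + K2 * `|vx U (x, t)|.
    exact: lipschitz0.
  apply: sqr_le_of_norm; exact: hN.
have L1 := in_L2_lin 1 1 Lb Lg; have L2 := in_L2_lin 1 (-1) LN Lf.
have := in_L2_lin 1 1 L1 L2; congr (in_L2 _); apply: funext => p; rewrite /g; ring.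
Qed.

(** The letters are values at one point of Q: [q], [a], [b] of the difference w of
    two states and of its derivatives; [zt], [zx] of the derivatives of chi w;
    [al], [be] of chi and its derivative; [om] of [omega], [ph] of [phi], [r] of
    [rho]; [y] is [- s].  The product rule [al * a = zt - be * q] produces the term
    with [B], and the weights [y] and [ph] of the energy give the factor [y^-1]. *)
Lemma lipschitz_diff_bound (q a b D zt zx al be om ph y r B : R) :
  `|D| <= K0 * `|q| + K1 * `|a| + K2 * `|b| ->
  zt = al * a + be * q -> zx = al * b -> 1 <= y -> 1 <= ph ->
  om ^+ 2 * be ^+ 2 <= B * r ->
  (om * al * D) ^+ 2 <= 2 * L * (y^-1 * (om ^+ 2 * (y ^+ 3 * ph ^+ 3 * (al * q) ^+ 2 + y * (zt ^+ 2 + zx ^+ 2)))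
     + B * (r * q ^+ 2)).
Proof.
move=> hD -> -> y1 ph1 hB.
have y0 : y != 0 by rewrite gt_eqF// (lt_le_trans ltr01).
have L0 := L_ge0.
have D2 : D ^+ 2 <= L * (q ^+ 2 + a ^+ 2 + b ^+ 2).
  apply: le_trans (sqr_le_of_norm hD) _; rewrite -(real_normK (num_real q)) -(real_normK (num_real a)) -(real_normK (num_real b)) /L.
  move: `|q| `|a| `|b| => x1 x2 x3.
  have := sqr_ge0 (K0 * x2 - K1 * x1); have := sqr_ge0 (K0 * x3 - K2 * x1).
  have := sqr_ge0 (K1 * x3 - K2 * x2); lra.
have Y : 1 <= y ^+ 2 * ph ^+ 3.
  by rewrite -[leLHS]mulr1; apply: ler_pM => //; apply: exprn_ege1.
have -> : y^-1 * (om ^+ 2 * (y ^+ 3 * ph ^+ 3 * (al * q) ^+ 2 + y * ((al * a + be * q) ^+ 2 + (al * b) ^+ 2))) =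
  om ^+ 2 * (y ^+ 2 * ph ^+ 3 * (al * q) ^+ 2 + (al * a + be * q) ^+ 2 + (al * b) ^+ 2) by field.
have o0 := sqr_ge0 om.
have s1 : (om * al * D) ^+ 2 <= (om ^+ 2 * al ^+ 2) * (L * (q ^+ 2 + a ^+ 2 + b ^+ 2)).
  rewrite !exprMn; apply: ler_wpM2l => //; apply: mulr_ge0 => //; exact: sqr_ge0.
apply: le_trans s1 _.
have -> : om ^+ 2 * al ^+ 2 * (L * (q ^+ 2 + a ^+ 2 + b ^+ 2)) =
  L * (om ^+ 2 * ((al * q) ^+ 2 + (al * a) ^+ 2 + (al * b) ^+ 2)) by ring.
have -> : forall Z, 2 * L * Z = L * (2 * Z) by move=> Z; ring.
apply: ler_wpM2l => //.
have h2 : B * (r * q ^+ 2) >= om ^+ 2 * (be * q) ^+ 2.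
  by rewrite exprMn [leLHS]mulrA [leRHS]mulrA; apply: ler_wpM2r; [exact: sqr_ge0|exact: hB].
have h3 : om ^+ 2 * ((al * q) ^+ 2 + (al * a) ^+ 2 + (al * b) ^+ 2) <=
   om ^+ 2 * (2 * (y ^+ 2 * ph ^+ 3 * (al * q) ^+ 2 + (al * a + be * q) ^+ 2 + (al * b) ^+ 2)
      + 2 * (be * q) ^+ 2).
  apply: ler_wpM2l => //.
  have h4 : 1 * (al * q) ^+ 2 <= y ^+ 2 * ph ^+ 3 * (al * q) ^+ 2.
    by apply: ler_wpM2r => //; exact: sqr_ge0.
  have := sqr_ge0 (al * q); have := sqr_ge0 (al * b).
  have := sqr_ge0 (al * a + be * q + be * q); lra.
lra.
Qed.

(** The energy controls the first derivatives of the cut-off difference with the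
    small factor [1 / (- s)]; the commutator with the cutoff lives where
    [chi' != 0], and there the squared weight has lost [expR (2 * s * gam)]. *)
Lemma nonlinear_diff_le m U V : (1 <= m)%N -> s <= - 1 -> in_X m U -> in_X m V ->
  measQ (NU U) -> measQ (NU V) ->
  (S (fun p => (k p * (NU U p - NU V p))%R) <=
   (2 * L)%:E * ((- s)^-1%:E * E (cut (diff U V)) + (M1 * expR (2 * s * gam))%:E * wQ (diff U V)))%E.
Proof.
move=> m1 s1 XU XV mU mV; set w := diff U V; have Xw : in_X m w by exact: (in_X_lin isg c0 lam0 s0 1 (-1) XU XV).
have L0 : 0 <= 2 * L by apply: mulr_ge0; [exact: ler0n|exact: L_ge0].
have [_ ex] := cut_vx isg chiP m1 Xw; have [_ et] := cut_vt isg chiP m1 Xw.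
have lt := wD_lin 1 (-1) isg (@in_X_has _ _ _ _ _ m U 0 1 XU m1) (@in_X_has _ _ _ _ _ m V 0 1 XV m1).
have lx := wD_lin 1 (-1) isg (@in_X_has _ _ _ _ _ m U 1 0 XU m1) (@in_X_has _ _ _ _ _ m V 1 0 XV m1).
have y0 : 0 <= (- s)^-1 by rewrite invr_ge0 oppr_ge0.
have M0 := M1_ge0 T0 M1P.
have B0 : 0 <= M1 * expR (2 * s * gam) by rewrite mulr_ge0 ?expR_ge0.
have dE := energy_density isg chiP s0 m1 Xw.
have dw := density_sqr (rho_density T c0 lam0 s0) (in_X_meas Xw).
have d1 := densityZ y0 dE; have d2 := densityZ B0 dw; have d3 := densityD d1 d2.
have d4 := densityZ L0 d3.
have dn : densQ (fun p => (k p * (NU U p - NU V p)) ^+ 2).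
  apply: density_sqr1; apply: measurable_funM; first exact: (measurable_k _ _ chiP).
  exact: measurable_funB.
have step : (S (fun p => (k p * (NU U p - NU V p))%R) <= dintQ
      (fun p => (2 * L * ((- s)^-1 * energy c T lam s (cut w) p
                 + M1 * expR (2 * s * gam) * (rho p.1 * w p ^+ 2)))%R))%E.
  apply: (dint_le mQ dn d4).
  have hx := aeS2 (P'' := fun p => Q p -> vx (cut w) p = chi p.2 * vx w p /\ vx w p = 1 * vx U p + -1 * vx V p)
    (fun p a b Qp => conj (a Qp) (b Qp)) ex lx.
  have ht := aeS2 (P'' := fun p => Q p -> vt (cut w) p = chi p.2 * vt w p + derive1 chi p.2 * w p /\ vt w p = 1 * vt U p + -1 * vt V p)
    (fun p a b Qp => conj (a Qp) (b Qp)) et lt.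
  apply: aeS2 hx ht => -[x t] hx ht Qp; rewrite /energy /=.
  have [hx1 hx2] := hx Qp; have [ht1 ht2] := ht Qp.
  have [/= x0 /andP[t0 tT]] := Qp.
  have tI : 0 <= t <= T by rewrite !ltW.
  apply: (lipschitz_diff_bound _ ht1 hx1).
  - exact: (lipschitz_diff Qp erefl ht2 hx2).
  - by rewrite lerNr.
  - exact: (phi_ge1 c0 lam0 (ltW x0) (ltW t0)).
  - have [hs|hs] := pselect (supp_dchi T chi t).
      rewrite mulrC -mulrA; apply: ler_pM; [exact: sqr_ge0|exact: sqr_ge0|exact: M1P|].
      exact: (omega_supp_le c0 lam0 s0 (ltW x0) hs).
    rewrite (dchi_out tI hs) expr0n/= mulr0.
    by apply: mulr_ge0 => //; exact: ltW (rho_gt0 _ _ _ _).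
apply: le_trans step _.
rewrite (dintZ mu2 mQ L0 d3) (dintD mu2 mQ d1 d2).
rewrite le_eqVlt; apply/orP; left; apply/eqP; congr (_ * (_ + _))%E.
- exact: (dintZ mu2 mQ y0 dE).
- exact: (dintZ mu2 mQ B0 dw).
Qed.

(** The frozen nonlinear terms are the only difference between the two problems,
    so they are the only source on the right. *)
Lemma defect_midpoint (f : R * R -> R) m U V u v : (2 <= m)%N ->
  in_X m u -> in_X m v -> measQ (NU U) -> measQ (NU V) ->
  in_L2 (fun p => k p * f p) ->
  (S (fun p => (k p * (box (mid u v) p + NU U p - f p))%R) + S (fun p => (k p * (box (mid u v) p + NU V p - f p))%R)
   + (4^-1 : R)%:E * S (fun p => (k p * box (diff u v) p)%R) <=
   S (fun p => (k p * (box u p + NU U p - f p))%R) + S (fun p => (k p * (box v p + NU V p - f p))%R)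
   + S (fun p => (k p * (NU U p - NU V p))%R))%E.
Proof.
move=> m2 Xu Xv mU mV [mf _]; set um := mid u v; set d := diff u v.
have Xm : in_X m um by exact: (in_X_lin isg c0 lam0 s0 _ _ Xu Xv).
have Xd : in_X m d by exact: (in_X_lin isg c0 lam0 s0 _ _ Xu Xv).
have mk := measurable_k c lam chiP s.
have mdef w W : in_X m w -> measQ (NU W) -> measQ (fun p => k p * (box w p + NU W p - f p)).
  move=> Xw mW; rewrite (_ : (fun p => _) = (fun p => k p * (box w p + NU W p) - k p * f p)); last first.
    by apply: funext => p; rewrite -mulrBr.
  apply: measurable_funB => //; apply: measurable_funM => //.
  by apply: measurable_funD => //; exact: box_meas m2 Xw.
apply: (midpoint_dint mQ).
- exact: mdef.
- exact: mdef.
- by apply: measurable_funM => //; exact: box_meas m2 Xd.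
- exact: mdef.
- exact: mdef.
- by apply: measurable_funM => //; exact: measurable_funB.
have em := box_lin isg 2^-1 2^-1 m2 Xu Xv; have ed := box_lin isg 1 (-1) m2 Xu Xv.
apply: aeS2 em ed => p em ed Qp; rewrite /um /d (em Qp) (ed Qp).
move: (box u p) (box v p) (NU U p) (NU V p) (f p) (omega p) (chi p.2) => *.
by split; field.
Qed.

End Nonlinearity.

(** * The contraction estimate *)

Lemma fin_real {R : realType} (q : \bar R) : (0 <= q < +oo)%E -> exists2 r, 0 <= r & q = r%:E.
Proof.
case: q => [r||] /andP[q0 q1]; [by exists r|by rewrite ltxx in q1|].
by move: q0; rewrite leeNy_eq.
Qed.

Lemma dchi_sqr_bound {R : realType} (T : R) (chi : R -> R) : 0 < T -> smooth1 chi ->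
  exists M, forall t, 0 <= t <= T -> derive1 chi t ^+ 2 <= M.
Proof.
move=> T0 hchi; have cd : continuous (derive1 chi) := smooth1_continuous (smooth1_derive hchi).
have [|a _ ha] := @EVT_max R (fun t => derive1 chi t ^+ 2) 0 T (ltW T0).
  apply: continuous_subspaceT => t; have := @continuous_comp _ _ _ (derive1 chi) (fun x : R => x ^+ 2) t (cd t).
  by apply; exact: exprn_continuous.
by exists (derive1 chi a ^+ 2) => t tT; apply: ha; rewrite in_itv.
Qed.

(** The hypotheses on [a1] and [a2] are minimality, tested with the midpoint.
    Together with the parallelogram identities and the midpoint inequality they
    bound [Sb / 4 + (eps * Xd + kap * Gd) / 2] by [Sn]; the Carleman estimate
    extends this bound to the whole graph norm, with constant [C'].  The choices of
    [eps] and of the lower bound for [y] make each of the two contributions to [Sn]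
    at most [th ^ 2 / 2] times the corresponding term of the graph norm of the
    data. *)
Lemma contraction_real {R : realType} (a1 a2 A1 A2 Xu Xv Xm Xd X1d Gu Gv Gm Gd Sb Sn
    Ed Id Ew Iw Xw Gw wq e eps kap CX K M1 y s2 th : R) :
  let C' := 4 * CX + 2 * CX / kap + 4 in
  0 <= Xd -> 0 <= Gd -> 0 <= Sb -> 0 <= Sn -> 0 <= Iw -> 0 <= Xw -> 0 <= Gw -> 0 <= Ew ->
  0 < CX -> 0 < kap -> 0 < th -> 0 <= K -> 0 <= M1 -> 0 < e -> 0 < y -> 0 <= s2 ->
  eps = (CX + 2 * K * C' * M1 / th ^+ 2) * e -> 2 * K * C' / th ^+ 2 <= y ->
  a1 + eps * Xu + kap * Gu <= A1 + eps * Xm + kap * Gm ->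
  a2 + eps * Xv + kap * Gv <= A2 + eps * Xm + kap * Gm ->
  2 * Xm + 2^-1 * Xd = Xu + Xv -> 2 * Gm + 2^-1 * Gd = Gu + Gv ->
  A1 + A2 + 4^-1 * Sb <= a1 + a2 + Sn ->
  Ed + s2 * Id <= CX * (Sb + Gd + e * X1d) -> X1d <= Xd ->
  Sn <= K * (y^-1 * Ew + M1 * e * wq) -> wq <= Xw ->
  Ed + s2 * Id + eps * Xd + kap * Gd <= th ^+ 2 * (Ew + s2 * Iw + eps * Xw + kap * Gw).
Proof.
move=> C' Xd0 Gd0 Sb0 Sn0 Iw0 Xw0 Gw0 Ew0 CX0 kap0 th0 K0 M10 e0 y0 s20 epsE yC hu hv pX pG mp car X1 nb wX.
have th2 : 0 < th ^+ 2 by exact: exprn_gt0.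
have C'0 : 0 <= C'.
  by rewrite /C'; do !apply: addr_ge0; rewrite ?ler0n// ?mulr_ge0 ?invr_ge0 ?ltW//.
pose P := 2 * K * C' * M1 / th ^+ 2.
have P0 : 0 <= P.
  by apply: divr_ge0; [exact: (mulr_ge0 (mulr_ge0 (mulr_ge0 (ler0n _ 2) K0) C'0) M10)|exact: ltW].
have PE : th ^+ 2 * P = 2 * K * C' * M1 by rewrite /P; field; rewrite gt_eqF.
have eps0 : 0 < eps by rewrite epsE mulr_gt0// ltr_pwDl.
have key : 4^-1 * Sb + 2^-1 * (eps * Xd + kap * Gd) <= Sn.
  have e1 : eps * Xu + eps * Xv = 2 * (eps * Xm) + 2^-1 * (eps * Xd).
    by rewrite -mulrDr -pX; ring.
  have e2 : kap * Gu + kap * Gv = 2 * (kap * Gm) + 2^-1 * (kap * Gd).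
    by rewrite -mulrDr -pG; ring.
  lra.
have eX : 0 <= eps * Xd by rewrite mulr_ge0// ltW.
have kG : 0 <= kap * Gd by rewrite mulr_ge0// ltW.
have bG : CX * Gd <= (2 * CX / kap) * Sn.
  have -> : CX * Gd = CX / kap * (kap * Gd) by field; rewrite gt_eqF.
  have -> : 2 * CX / kap * Sn = CX / kap * (2 * Sn) by field; rewrite gt_eqF.
  by apply: ler_wpM2l; [rewrite divr_ge0 ?ltW|lra].
have bS : CX * Sb <= CX * (4 * Sn) by apply: ler_wpM2l; [exact: ltW|lra].
have bX : CX * (e * X1d) <= eps * Xd.
  apply: (@le_trans _ _ (CX * e * Xd)).
    by rewrite mulrA; apply: ler_wpM2l => //; rewrite mulr_ge0 ?ltW.
  apply: ler_wpM2r => //; rewrite epsE -/P; apply: ler_wpM2r; first exact: ltW.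
  by rewrite lerDl.
have tot : Ed + s2 * Id + eps * Xd + kap * Gd <= C' * Sn.
  have -> : C' * Sn = 4 * (CX * Sn) + 2 * CX / kap * Sn + 4 * Sn.
    by rewrite /C'; ring.
  have carE : CX * (Sb + Gd + e * X1d) = CX * Sb + CX * Gd + CX * (e * X1d) by ring.
  have bSE : CX * (4 * Sn) = 4 * (CX * Sn) by ring.
  rewrite carE in car; rewrite bSE in bS.
  have eXle : eps * Xd + kap * Gd <= 2 * Sn by move: key; lra.
  have l1 := le_trans car (lerD (lerD bS bG) bX).
  have l3 : eps * Xd <= 2 * Sn by apply: le_trans eXle; rewrite lerDl.
  move: l1 l3 eXle; move: (2 * CX / kap * Sn) => z; clear; lra.
apply: le_trans tot _.
rewrite -/P in epsE.
clearbody P C'.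
have n1 : C' * Sn <= C' * (K * (y^-1 * Ew + M1 * e * wq)) by apply: ler_wpM2l.
apply: le_trans n1 _.
have q1 : C' * K * y^-1 <= 2^-1 * th ^+ 2.
  rewrite ler_pdivrMr//.
  have := yC; rewrite ler_pdivrMr// => h; lra.
have q2 : C' * K * M1 * e * wq <= 2^-1 * th ^+ 2 * (eps * Xw).
  apply: (@le_trans _ _ (C' * K * M1 * e * Xw)).
    by apply: ler_wpM2l => //; do !apply: mulr_ge0 => //; exact: ltW.
  rewrite epsE (_ : _ * (_ * e * Xw) = 2^-1 * (th ^+ 2 * (CX + P)) * (e * Xw)); last by ring.
  rewrite (_ : _ * Xw = C' * K * M1 * (e * Xw)); last by ring.
  apply: ler_wpM2r; first by rewrite mulr_ge0// ltW.
  rewrite mulrDr PE.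
  have : 0 <= th ^+ 2 * CX by rewrite mulr_ge0 ?ltW.
  lra.
have q3 : C' * K * y^-1 * Ew <= 2^-1 * th ^+ 2 * Ew by apply: ler_wpM2r.
have r1 : 0 <= th ^+ 2 * Ew by rewrite mulr_ge0// ltW.
have r2 : 0 <= th ^+ 2 * (eps * Xw) by rewrite mulr_ge0 ?mulr_ge0// ltW.
have r3 : 0 <= th ^+ 2 * (s2 * Iw) by rewrite mulr_ge0 ?mulr_ge0// ltW.
have r4 : 0 <= th ^+ 2 * (kap * Gw) by rewrite mulr_ge0 ?mulr_ge0// ltW.
have -> : C' * (K * (y^-1 * Ew + M1 * e * wq)) = C' * K * y^-1 * Ew + C' * K * M1 * e * wq by ring.
rewrite !mulrDr.
move: q2 q3 r1 r2 r3 r4; rewrite -!(mulrA 2^-1).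
by move=> *; lra.
Qed.

Lemma sqrte_contract {R : realType} (th a b : R) : 0 <= th -> 0 <= b -> a <= th ^+ 2 * b ->
  (sqrte a%:E <= th%:E * sqrte b%:E)%E.
Proof.
move=> th0 b0 ab; rewrite /= -EFinM lee_fin.
rewrite -{1}(ger0_norm th0) -sqrtr_sqr -sqrtrM ?sqr_ge0//.
by apply: ler_wsqrtr.
Qed.

Theorem theorem5p2 (R : realType) (c T X lam Tm Tp : R) (chi : R -> R) (m : nat)
    (CX K0 K1 K2 : R) (N : R -> R -> R -> R -> R -> R)
    (f : R * R -> R) (h g phi1 : R -> R) (kappa theta : R)
    (c_gt0 : 0 < c) (T_gt0 : 0 < T) (X_gt0 : 0 < X) (X_lt : X < c * T)
    (lam_gt : - (1 / 3) < lam) (lam_lt0 : lam < 0)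
    (Tm_gt : X / c < Tm) (Tm_lt : Tm < Tp) (Tp_lt : Tp < T)
    (chi_cutoff : is_cutoff T Tm Tp chi)
    (m_ge4 : (4 <= m)%N)
    (CX_carleman : is_carleman_const c T X lam chi m CX)
    (K0_ge0 : 0 <= K0) (K1_ge0 : 0 <= K1) (K2_ge0 : 0 <= K2)
    (N_lip : lipschitzN T N K0 K1 K2)
    (kappa_gt0 : 0 < kappa) (theta_gt0 : 0 < theta) (theta_lt1 : theta < 1) :
  exists2 s_theta : R, s_theta < 0 &
    forall s, s <= s_theta ->
    standing c T lam chi N f h g phi1 m s ->
    exists eps : R,
      [/\ 0 < eps, CX * expR (2 * s * gamma c T lam chi) <= eps &
        forall Phi, is_frozen_map c T lam chi N f h g phi1 m s eps kappa Phi ->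
        (forall U, adm c T lam s m h g phi1 U -> adm c T lam s m h g phi1 (Phi U)) /\
        forall U V, adm c T lam s m h g phi1 U -> adm c T lam s m h g phi1 V ->
          (Gnorm c T X lam chi m s eps kappa (U \- V)%R < +oo)%E /\
          (Gnorm c T X lam chi m s eps kappa (Phi U \- Phi V)%R <=
           theta%:E * Gnorm c T X lam chi m s eps kappa (U \- V)%R)%E].
Proof.
have Tm0 : 0 < Tm by apply: lt_trans Tm_gt; rewrite divr_gt0.
have [sg isg] := step_exists Tm0 Tm_lt Tp_lt chi_cutoff.
have [M1 M1P] := dchi_sqr_bound T_gt0 (chi_smooth chi_cutoff).
have M10 := M1_ge0 T_gt0 M1P.
have [CX0 [s0 s0_lt0 carleman]] := CX_carleman.
pose K := 2 * (K0 ^+ 2 + K1 ^+ 2 + K2 ^+ 2).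
have KK0 : 0 <= K by apply: mulr_ge0 => //; exact: L_ge0.
(* [C'] bounds the squared graph norm of the difference of the minimizers by the
   squared norm of the nonlinear difference; [B] is the size of [- s] that makes
   the energy term small *)
pose C' := 4 * CX + 2 * CX / kappa + 4.
have C'0 : 0 <= C'.
  by rewrite /C'; do !apply: addr_ge0; rewrite ?ler0n// ?mulr_ge0 ?invr_ge0 ?ltW//.
have th2 : 0 < theta ^+ 2 by exact: exprn_gt0.
pose B := 2 * K * C' / theta ^+ 2.
have B0 : 0 <= B by apply: divr_ge0; [exact: (mulr_ge0 (mulr_ge0 (ler0n _ 2) KK0) C'0)|exact: ltW].
exists (s0 - 1 - B); first lra.
move=> s s_le [kf_L2 kN_L2 NU_meas _].
have ss0 : s <= s0 by lra.
have s_le1 : s <= - 1 by lra.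
have sle0 : s <= 0 by lra.
have yB : B <= - s by lra.
have ns0 : 0 < - s by lra.
pose e := expR (2 * s * gamma c T lam chi).
have e0 : 0 < e by exact: expR_gt0.
(* [CX] absorbs the remainder of the Carleman estimate, the other summand the
   commutator of the time derivative with the cutoff *)
pose M := CX + 2 * K * C' * M1 / theta ^+ 2.
have P0 : 0 <= 2 * K * C' * M1 / theta ^+ 2.
  by apply: divr_ge0; [exact: (mulr_ge0 (mulr_ge0 (mulr_ge0 (ler0n _ 2) KK0) C'0) M10)|exact: ltW].
have CXM : CX <= M by rewrite lerDl.
exists (M * e); split; first by rewrite mulr_gt0// (lt_le_trans CX0).
  by apply: ler_wpM2r => //; exact: ltW.
set eps := M * e.
move=> Phi Phi_min; split; first by move=> U /Phi_min[[]].
have m2 : (2 <= m)%N by exact: leq_trans m_ge4.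
have m1 : (1 <= m)%N by exact: leq_trans m_ge4.
move=> U V admU admV.
have [[admu minu] _] := Phi_min U admU; have [[admv minv] _] := Phi_min V admV.
have diffE (a b : R * R -> R) : a \- b = (fun p => 1 * a p + -1 * b p).
  by apply: funext => p; rewrite mul1r mulN1r.
rewrite !diffE.
move: (Phi U) (Phi V) admu admv minu minv => u v admu admv minu minv.
have [XU _ _ _] := admU; have [XV _ _ _] := admV.
have [Xu _ _ _] := admu; have [Xv _ _ _] := admv.
have mNU := NU_meas U admU; have mNV := NU_meas V admV.
pose um := fun p => 2^-1 * u p + 2^-1 * v p.
pose d := fun p => 1 * u p + -1 * v p.
pose w := fun p => 1 * U p + -1 * V p.
have admm : adm c T lam s m h g phi1 um.
  have := adm_lin isg c_gt0 lam_lt0 sle0 2^-1 2^-1 m2 admu admv.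
  have hf (r : R -> R) : (fun t => 2^-1 * r t + 2^-1 * r t) = r.
    by apply: funext => t; field.
  by rewrite !hf.
have admd : adm c T lam s m (fun=> 0) (fun=> 0) (fun=> 0) d.
  have := adm_lin isg c_gt0 lam_lt0 sle0 1 (-1) m2 admu admv.
  have hf (r : R -> R) : (fun t => 1 * r t + -1 * r t) = (fun=> 0).
    by apply: funext => t; ring.
  by rewrite !hf.
have Xm : in_X c T lam s m um by case: admm.
have Xd : in_X c T lam s m d by case: admd.
have Xw : in_X c T lam s m w by exact: (in_X_lin isg c_gt0 lam_lt0 sle0 1 (-1) XU XV).
have carl := carleman s ss0 d admd.
have ju := minu um admm; have jv := minv um admm.
have pX := sqnorm_X_parallelogram isg c_gt0 lam_lt0 sle0 Xu Xv.
have pG := Gfun_parallelogram isg c_gt0 T_gt0 lam_gt lam_lt0 sle0 m2 Xu Xv.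
have X1d := sqnorm_X_mono T c_gt0 lam_lt0 sle0 d m1.
have X1f : (sqnorm_X c T lam s 1 d < +oo)%E by apply: le_lt_trans X1d _; case: Xd.
have wX := wQ0_le_sqnorm isg c_gt0 lam_lt0 sle0 Xw.
have mp := defect_midpoint isg c_gt0 lam_lt0 chi_cutoff sle0 m2 Xu Xv mNU mNV kf_L2.
have nb := nonlinear_diff_le isg c_gt0 T_gt0 lam_lt0 chi_cutoff M1P N_lip sle0 m1 s_le1 XU XV mNU mNV.
have finX (z : R * R -> R) : in_X c T lam s m z -> (0 <= sqnorm_X c T lam s m z < +oo)%E.
  by move=> [_ fz]; rewrite fz sqnorm_X_ge0.
have finG (z : R * R -> R) (Xz : in_X c T lam s m z) :=
  Gfun_trace_fin isg c_gt0 T_gt0 lam_gt lam_lt0 sle0 m2 Xz.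
have finI (z : R * R -> R) (Xz : in_X c T lam s m z) :=
  Ifun_trace_fin isg X c_gt0 T_gt0 lam_gt lam_lt0 sle0 m2 Xz.
have finE (z : R * R -> R) (Xz : in_X c T lam s m z) : (0 <= Efun c T lam s (Defs.cut chi z) < +oo)%E.
  apply/andP; split; first exact: (Efun_ge0 isg chi_cutoff sle0 m1 Xz).
  exact: (Efun_fin isg c_gt0 T_gt0 lam_lt0 chi_cutoff M1P sle0 m1 Xz).
have finS (W z : R * R -> R) (XW : in_X c T lam s m W) (Xz : in_X c T lam s m z) mW :=
  S_fin (defect_in_L2 isg c_gt0 lam_lt0 chi_cutoff N_lip sle0 m2 XW Xz kf_L2 kN_L2 mW).
have finSb := S_fin (k_in_L2 c_gt0 lam_lt0 chi_cutoff sle0 (box_L2w c_gt0 lam_lt0 sle0 m2 Xd)).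
have finwQ : (0 <= @wint _ (plane (R := R)) R mu2 (Qset T) (fun p => rho c lam s p.1) w < +oo)%E.
  apply/andP; split; first exact: wQ_ge0.
  by apply: le_lt_trans wX _; case: Xw.
rewrite -/um -/d in mp pX pG; rewrite -/w -/K in nb.
have [xu xu0 Exu] := fin_real (finX u Xu); have [xv xv0 Exv] := fin_real (finX v Xv).
have [xm xm0 Exm] := fin_real (finX um Xm); have [xd xd0 Exd] := fin_real (finX d Xd).
have [xw xw0 Exw] := fin_real (finX w Xw).
have [gu gu0 Egu] := fin_real (finG u Xu); have [gv gv0 Egv] := fin_real (finG v Xv).
have [gm gm0 Egm] := fin_real (finG um Xm); have [gd gd0 Egd] := fin_real (finG d Xd).
have [gw gw0 Egw] := fin_real (finG w Xw).
have [iw iw0 Eiw] := fin_real (finI w Xw); have [id id0 Eid] := fin_real (finI d Xd).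
have [ew ew0 Eew] := fin_real (finE w Xw); have [ed ed0 Eed] := fin_real (finE d Xd).
have [a1 a10 Ea1] := fin_real (finS U u XU Xu mNU).
have [a2 a20 Ea2] := fin_real (finS V v XV Xv mNV).
have [A1 A10 EA1] := fin_real (finS U um XU Xm mNU).
have [A2 A20 EA2] := fin_real (finS V um XV Xm mNV).
have [sb sb0 Esb] := fin_real finSb.
have [wq wq0 Ewq] := fin_real finwQ.
have [x1 x10 Ex1] : exists2 r, 0 <= r & sqnorm_X c T lam s 1 d = r%:E.
  by apply: fin_real; rewrite X1f sqnorm_X_ge0.
rewrite Eew Ewq -?EFinM -?EFinD -?EFinM in nb.
have [sn sn0 Esn] : exists2 r, 0 <= r & sqnorm_L2 T
    (fun p => (omega c lam s p * chi p.2 * (NU T N U p - NU T N V p))%R) = r%:E.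
  apply: fin_real; apply/andP; split; last exact: le_lt_trans nb (ltry _).
  by apply: integral_ge0 => p _; rewrite lee_fin sqr_ge0.
rewrite Esn lee_fin in nb.
rewrite /Jfun Ea1 EA1 Exu Exm Egu Egm -?EFinM -?EFinD lee_fin in ju.
rewrite /Jfun Ea2 EA2 Exv Exm Egv Egm -?EFinM -?EFinD lee_fin in jv.
rewrite Exm Exd Exu Exv -?EFinM -?EFinD in pX; move: pX => [pX].
rewrite Egm Egd Egu Egv -?EFinM -?EFinD in pG; move: pG => [pG].
rewrite EA1 EA2 Esb Ea1 Ea2 Esn -?EFinM -?EFinD lee_fin in mp.
rewrite Eed Eid Esb Egd Ex1 -?EFinM -?EFinD -?EFinM -?EFinD lee_fin in carl.
rewrite Ex1 Exd lee_fin in X1d; rewrite Ewq Exw lee_fin in wX.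
rewrite /Gnorm Eew Eiw Exw Egw Eed Eid Exd Egd -?EFinM -?EFinD.
split; first exact: ltry.
apply: sqrte_contract; first exact: ltW.
  have eps0 : 0 <= eps by rewrite mulr_ge0 ?ltW// (lt_le_trans CX0).
  by do !apply: addr_ge0 => //; apply: mulr_ge0 => //; [exact: sqr_ge0|exact: ltW].
by apply: (contraction_real (X1d := x1) (wq := wq) xd0 gd0 sb0 sn0 iw0 xw0 gw0 ew0 CX0 kappa_gt0
  theta_gt0 KK0 M10 e0 ns0 (sqr_ge0 s) erefl yB ju jv pX pG mp carl X1d nb wX).
Qed.
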